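(* For every integer $j\ge1$, $$(\Psi_j,\Psi_{j-\frac12})=(-\mathcal A_j,-\mathcal M_{j-\frac12})+\mathcal P_j,\qquad(\Psi_{-j},\Psi_{-j+\frac12})=(-\alpha_0^{-j}\mathcal B_j,-\alpha_0^{-j+\frac12}\mathcal N_{j-\frac12})+\mathcal P_{-j},\qquad\Psi_0=0+\mathcal P_0,$$ where each $\mathcal P_j=\mathcal P_j(\alpha_0^{1/2},\mathcal A,\mathcal M,\mathcal B,\mathcal N)$, $j\in\mathbb Z$, contains only terms of total degree at least one in the $\mathcal A_k$'s and $\mathcal M_{k-1/2}$'s and of total degree at least one in the $\mathcal B_k$'s and $\mathcal N_{k-1/2}$'s. Both $$\exp\Big(\sum_{j\ge1}\big(\Psi_{-j}L_{-j}(x,\varphi)+\Psi_{-j+\frac12}G_{-j+\frac12}(x,\varphi)\big)\Big)\quad\text{and}\quad\exp\Big(\sum_{j\ge1}\big(\Psi_jL_j(x,\varphi)+\Psi_{j-\frac12}G_{j-\frac12}(x,\varphi)\big)\Big)$$ are in the algebra $\big((\mathrm{End}\,\mathbb C[x,x^{-1},\varphi])[\alpha_0^{1/2},\alpha_0^{-1/2}][[\mathcal A,\mathcal B]][\mathcal M,\mathcal N]\big)^0$, and in this algebra we have $$\exp\Big(-\sum_{j\ge1}\big(\mathcal A_jL_j+\mathcal M_{j-\frac12}G_{j-\frac12}\big)\Big)\cdot(\alpha_0^{1/2})^{-2L_0}\cdot\exp\Big(-\sum_{j\ge1}\big(\mathcal B_jL_{-j}+\mathcal N_{j-\frac12}G_{-j+\frac12}\big)\Big)$$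 $$=\exp\Big(\sum_{j\ge1}\big(\Psi_{-j}L_{-j}+\Psi_{-j+\frac12}G_{-j+\frac12}\big)\Big)\cdot\exp\Big(\sum_{j\ge1}\big(\Psi_jL_j+\Psi_{j-\frac12}G_{j-\frac12}\big)\Big)\cdot(\alpha_0^{1/2})^{-2L_0}\cdot\exp\big(2\Psi_0L_0\big),$$ where all $L_k$, $G_{k-1/2}$ are $L_k(x,\varphi)$, $G_{k-1/2}(x,\varphi)$.
   Context: Formal variables: $x$, $\alpha_0^{1/2}$, $\mathcal A=\{\mathcal A_j\}_{j\ge1}$, $\mathcal B=\{\mathcal B_j\}_{j\ge1}$ are even; $\varphi$, $\mathcal M=\{\mathcal M_{j-1/2}\}_{j\ge1}$, $\mathcal N=\{\mathcal N_{j-1/2}\}_{j\ge1}$ are odd (mutually anticommuting, square zero). $V[[\mathcal A,\mathcal B]][\mathcal M,\mathcal N]$ denotes all formal, possibly infinite, sums of monomials in these variables with coefficients in $V$; superscript $0$ denotes the even part. For $j\in\mathbb Z$: $$L_j(x,\varphi)=-\Big(x^{j+1}\frac{\partial}{\partial x}+\frac{j+1}{2}\varphi x^j\frac{\partial}{\partial\varphi}\Big),\qquad G_{j-\frac12}(x,\varphi)=-x^j\Big(\frac{\partial}{\partial\varphi}-\varphi\frac{\partial}{\partial x}\Big).$$ $b^{\mp2L_0(x,\varphi)}$ is the operator $c\,\varphi^mx^n\mapsto c\,b^{\pm(2n+m)}\varphi^mx^n$ ($m\in\{0,1\}$). Products of operators act from right to left, and on pairs componentwise. $I(x,\varphi)=(1/x,i\varphi/x)$.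 Let $H^{(1)}(x,\varphi)=\exp(-\sum_{j\ge1}(\mathcal A_jL_j+\mathcal M_{j-1/2}G_{j-1/2}))\cdot(\alpha_0^{1/2})^{-2L_0}\cdot(x,\varphi)$ and $H^{(2)}(x,\varphi)=\exp(\sum_{j\ge1}(\mathcal B_jL_{-j}+\mathcal N_{j-1/2}G_{-j+1/2}))\cdot(1/x,i\varphi/x)$, so that $(H^{(2)})^{-1}\circ I(x,\varphi)=\exp(-\sum_{j\ge1}(\mathcal B_jL_{-j}+\mathcal N_{j-1/2}G_{-j+1/2}))\cdot(x,\varphi)$. Definition of $\Psi_j$, $j\in\frac12\mathbb Z$: these are the uniquely determined elements of $\mathbb C[\alpha_0^{1/2},\alpha_0^{-1/2}][[\mathcal A,\mathcal B]][\mathcal M,\mathcal N]$ (even for $j\in\mathbb Z$, odd for $j\in\mathbb Z+\frac12$), with no term of degree zero in $(\mathcal A,\mathcal M,\mathcal B,\mathcal N)$, such that the series $$\bar F^{(1)}(x,\varphi)=\exp\Big(\sum_{j\ge1}(\Psi_{-j}L_{-j}+\Psi_{-j+\frac12}G_{-j+\frac12})\Big)\cdot(x,\varphi),$$ $$\bar F^{(2)}(x,\varphi)=\exp(-2\Psi_0L_0)\cdot(\alpha_0^{1/2})^{2L_0}\cdot\exp\Big(-\sum_{j\ge1}(\Psi_jL_j+\Psi_{j-\frac12}G_{j-\frac12})\Big)\cdot(x,\varphi)$$ are the solution of the formal sewing equation $\bar F^{(1)}=\bar F^{(2)}\circ(H^{(2)})^{-1}\circ I\circ H^{(1)}$ (expanded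 in nonnegative powers of the $\mathcal A_j,\mathcal B_j,\mathcal M_{j-1/2},\mathcal N_{j-1/2}$) with the boundary conditions $\bar F^{(1)}|_{(\mathcal B,\mathcal N)=0}=(x,\varphi)$, $\bar F^{(2)}|_{(\mathcal A,\mathcal M)=0}=(\alpha_0^{-1}x,\alpha_0^{-1/2}\varphi)$. *)

(* Defs.v *)
From HB Require Import structures.
From mathcomp Require Import all_boot all_order all_algebra.
From mathcomp Require Import finmap multiset.
From mathcomp Require Import boolp classical_sets functions cardinality fsbigop.
From mathcomp Require Import reals.
From mathcomp Require Import complex.

Set Implicit Arguments.
Unset Strict Implicit.
Unset Printing Implicit Defensive.

Import Order.TTheory GRing.Theory Num.Theory.
Local Open Scope classical_set_scope.
Local Open Scope ring_scope.

(* All the infinite sums below are sums [\sum_(i \in A) f i] of finitely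
   supported families (fsbigop.v), taken coefficient by coefficient, as is
   usual for formal series. *)

(** * Monomials in the A_j, B_j, M_{j-1/2}, N_{j-1/2} *)

(* The variable (s, k) stands for A_(k+1) (s = false) or B_(k+1) (s = true) in
   the even component of a monomial, and for M_(k+1/2) (s = false) or N_(k+1/2)
   (s = true) in its odd component. *)
Definition gvar := (bool * nat)%type.

(* (e, S) is the monomial e * (product of the elements of S in increasing order
   for [ovlt]). *)
Definition smono := ({mset gvar}%mset * {fset gvar}%fset)%type.

Definition smono1 : smono := (mset0, fset0).

Definition ovlt (u v : gvar) : bool :=
  ((u.1 < v.1)%N || ((u.1 == v.1) && (u.2 < v.2)%N)).

Definition inversions (S T : {fset gvar}%fset) : nat :=
  (\sum_(s <- S) count (fun t => ovlt t s) T)%N.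

(* m1 * m2 = (-1) ^ inversions m1.2 m2.2 * m, and the product does not vanish *)
Definition smono_prod (m1 m2 m : smono) : Prop :=
  [/\ (m1.1 `+` m2.1)%mset = m.1,
      [disjoint m1.2 & m2.2]%fset & (m1.2 `|` m2.2)%fset = m.2].

(* parity of the number of factors M, N *)
Definition smono_odd (m : smono) : bool := odd (size m.2).

(* total degree in the A's and M's (s = false), in the B's and N's (s = true) *)
Definition smono_deg (s : bool) (m : smono) : nat :=
  (count (fun v : gvar => v.1 == s) m.1 + count (fun v : gvar => v.1 == s) m.2)%N.

(* exponents (n, b) of x^n phi^b *)
Definition xphi := (int * bool)%type.

Section SuperSeries.
Context (R : realType).

Local Notation C := (R[i]).
Local Notation K := {fraction {poly R[i]}}.

(** * Coefficients *)

Definition cst (c : C) : K := tofrac c%:P.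

(* the formal variable alpha_0^(1/2) *)
Definition ah : K := tofrac 'X.

(* C[alpha_0^(1/2), alpha_0^(-1/2)] inside its field of fractions *)
Definition laurent (f : K) : Prop :=
  exists (N : nat) (c : nat -> C),
    f = \sum_(k < N.*2) cst (c k) * ah ^ (k%:Z - N%:Z).

(* [sser] is K[[A,B]][M,N]. *)
Definition sser := smono -> K.

(* C[alpha_0^(1/2), alpha_0^(-1/2)][[A,B]][M,N] *)
Definition laurent_sser (f : sser) : Prop := forall m, laurent (f m).

Definition sser_mon (m0 : smono) : sser := fun m => (m == m0)%:R.

Definition sser_mul (f g : sser) : sser := fun m =>
  \sum_(p \in [set p : smono * smono | smono_prod p.1 p.2 m])
    (-1) ^+ inversions p.1.2 p.2.2 * f p.1 * g p.2.

(* f |-> (-1)^|f| f, the sign produced when an odd element moves past f *)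
Definition sser_sign (f : sser) : sser := fun m => (-1) ^+ smono_odd m * f m.

Definition sser_even (f : sser) : Prop := forall m, f m != 0 -> ~~ smono_odd m.
Definition sser_odd (f : sser) : Prop := forall m, f m != 0 -> smono_odd m.

(* The families are indexed by j >= 1 : [varA j] is A_j, [varM j] is
   M_{j-1/2}, etc. *)
Definition even_var (s : bool) (j : nat) : sser :=
  sser_mon ([mset (s, j.-1)]%mset, fset0).
Definition odd_var (s : bool) (j : nat) : sser :=
  sser_mon (mset0, [fset (s, j.-1)]%fset).
Definition varA := even_var false.
Definition varB := even_var true.
Definition varM := odd_var false.
Definition varN := odd_var true.

Definition mixed (f : sser) : Prop :=
  forall m, f m != 0 -> (1 <= smono_deg false m)%N /\ (1 <= smono_deg true m)%N.

(** * Superderivations *)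

(* u : xphi -> C is the formal series \sum u (n, b) x^n phi^b *)
Definition d_x (u : xphi -> C) : xphi -> C :=
  fun p => (p.1 + 1)%:~R * u (p.1 + 1, p.2).
Definition d_phi (u : xphi -> C) : xphi -> C :=
  fun p => if p.2 then 0 else u (p.1, true).
Definition mul_x (k : int) (u : xphi -> C) : xphi -> C :=
  fun p => u (p.1 - k, p.2).
Definition mul_phi (u : xphi -> C) : xphi -> C :=
  fun p => if p.2 then u (p.1, false) else 0.

Definition L (j : int) (u : xphi -> C) : xphi -> C := fun p =>
  - (mul_x (j + 1) (d_x u) p
     + (j + 1)%:~R / 2%:R * mul_phi (mul_x j (d_phi u)) p).

(* [G j] is G_{j-1/2}; hence G_{-j+1/2} is [G (1 - j)] *)
Definition G (j : int) (u : xphi -> C) : xphi -> C := fun p =>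
  - mul_x j (fun q => d_phi u q - mul_phi (d_x u) q) p.

(* the coefficient of p in D(q), for q the monomial x^n phi^b *)
Definition entry (D : (xphi -> C) -> xphi -> C) (p q : xphi) : K :=
  cst (D (fun r => (r == q)%:R) p).

(** * Even operators *)

(* T : sop is the formal sum over monomials m of m * T_m, where T_m is the
   operator sending x^n phi^b to the formal series \sum_p (T p (n, b) m) p.
   [sop] is only used for even operators; these commute with multiplication by
   elements of [sser] on the left, hence no sign appears in [sop_mul] and
   [sop_app] besides those of [sser_mul]. *)
Definition sop := xphi -> xphi -> sser.

Definition sop1 : sop := fun p q m => ((p == q) && (m == smono1))%:R.

Definition sop_opp (T : sop) : sop := fun p q m => - T p q m.

Definition sop_mul (S T : sop) : sop := fun p q m =>
  \sum_(r \in [set: xphi]) sser_mul (T r q) (S p r) m.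

Definition sop_exp (T : sop) : sop := fun p q m =>
  \sum_(k \in [set: nat]) (k`!%:R)^-1 * iter k (sop_mul T) sop1 p q m.

(* \sum_(j >= 1) (E j L_j + O j G_{j-1/2}) *)
Definition vf_pos (E O : nat -> sser) : sop := fun p q m =>
  \sum_(j \in [set j : nat | (1 <= j)%N])
    (E j m * entry (L j%:Z) p q + O j m * entry (G j%:Z) p q).

(* \sum_(j >= 1) (E j L_{-j} + O j G_{-j+1/2}) *)
Definition vf_neg (E O : nat -> sser) : sop := fun p q m =>
  \sum_(j \in [set j : nat | (1 <= j)%N])
    (E j m * entry (L (- j%:Z)) p q + O j m * entry (G (1 - j%:Z)) p q).

(* c * f * L_0 *)
Definition vf_zero (c : int) (f : sser) : sop := fun p q m =>
  c%:~R * f m * entry (L 0) p q.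

(* (alpha_0^(1/2))^(2 t L_0) *)
Definition alpha_2L0 (t : int) : sop := fun p q m =>
  if (p == q) && (m == smono1) then ah ^ (- t * (2 * q.1 + (q.2 : nat)%:Z)) else 0.

(** * Membership in ((End C[x,x^-1,phi])[alpha^(1/2),alpha^(-1/2)][[A,B]][M,N])^0 *)

(* endomorphisms of C[x,x^-1,phi], by their matrix in the basis x^n phi^b *)
Definition is_endo (T : xphi -> xphi -> C) : Prop :=
  forall q, finite_set [set p | T p q != 0].

Definition in_end_alg_even (T : sop) : Prop :=
  (forall m, exists (N : nat) (E : nat -> xphi -> xphi -> C),
     (forall k, is_endo (E k)) /\
     (forall p q,
        T p q m = \sum_(k < N.*2) cst (E k p q) * ah ^ (k%:Z - N%:Z)))
  /\ (forall m p q, T p q m != 0 -> smono_odd m = p.2 (+) q.2).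

(** * Series in x and phi, and their composition *)

(* u : fser is \sum (u (n, b)) x^n phi^b, with coefficients on the left *)
Definition fser := xphi -> sser.

(* C[x,x^-1,phi][alpha^(1/2),alpha^(-1/2)][[A,B]][M,N] *)
Definition in_fpoly (u : fser) : Prop :=
  forall m, finite_set [set p | u p m != 0] /\ (forall p, laurent (u p m)).

(* c x^n phi^b, for p = (n, b) *)
Definition fser_mon (c : K) (p : xphi) : fser := fun q m =>
  if (q == p) && (m == smono1) then c else 0.

Definition fser1 : fser := fser_mon 1 (0, false).

Definition fser_mul (u v : fser) : fser := fun p m =>
  \sum_(k \in [set: int])
    if p.2 then
      sser_mul (u (k, false)) (v (p.1 - k, true)) m
      + sser_mul (u (k, true)) (sser_sign (v (p.1 - k, false))) m
    else sser_mul (u (k, false)) (v (p.1 - k, false)) m.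

(* the inverse of u in the ring [in_fpoly]; computing in this ring is what
   expanding in nonnegative powers of the A, B, M, N amounts to *)
Definition fser_inv (u : fser) : fser :=
  xget (fun=> fun=> 0)
    [set v : fser | [/\ in_fpoly v, fser_mul u v = fser1 & fser_mul v u = fser1]].

Definition fser_pow (u : fser) (n : int) : fser :=
  match n with
  | Posz k => iter k (fser_mul u) fser1
  | Negz k => iter k.+1 (fser_mul (fser_inv u)) fser1
  end.

Definition sop_app (T : sop) (u : fser) : fser := fun p m =>
  \sum_(q \in [set: xphi]) sser_mul (u q) (T p q) m.

(* (even component, odd component) *)
Definition fpair := (fser * fser)%type.

Definition fpair_app (T : sop) (H : fpair) : fpair :=
  (sop_app T H.1, sop_app T H.2).

Definition subst (f : fser) (H : fpair) : fser := fun p m =>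
  \sum_(q \in [set: xphi])
    sser_mul (f q) (fser_mul (fser_pow H.1 q.1) (if q.2 then H.2 else fser1) p) m.

Definition comp (F H : fpair) : fpair := (subst F.1 H, subst F.2 H).

(* (x, phi) *)
Definition id_pair : fpair := (fser_mon 1 (1, false), fser_mon 1 (0, true)).

(* (1/x, i phi/x) *)
Definition I_pair : fpair := (fser_mon 1 (-1, false), fser_mon (cst 'i) (-1, true)).

Definition is_comp_inverse (F H : fpair) : Prop :=
  [/\ in_fpoly H.1, in_fpoly H.2, comp F H = id_pair & comp H F = id_pair].

(** * The sewing equation *)

(* exp(- \sum (A_j L_j + M_{j-1/2} G_{j-1/2})) *)
Definition exp_AM : sop := sop_exp (sop_opp (vf_pos varA varM)).

Definition H1 : fpair := fpair_app (sop_mul exp_AM (alpha_2L0 (-1))) id_pair.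

Definition H2 : fpair := fpair_app (sop_exp (vf_neg varB varN)) I_pair.

(* exp(- \sum (B_j L_{-j} + N_{j-1/2} G_{-j+1/2})) *)
Definition exp_BN : sop := sop_exp (sop_opp (vf_neg varB varN)).

(* [Psi j] is Psi_j and [PsiH j] is Psi_{j-1/2}; hence Psi_{-j+1/2} is
   [PsiH (1 - j)] *)
Section Sewing.
Context (Psi PsiH : int -> sser).

Definition vf_Psi_neg : sop :=
  vf_neg (fun j => Psi (- j%:Z)) (fun j => PsiH (1 - j%:Z)).
Definition vf_Psi_pos : sop :=
  vf_pos (fun j => Psi j%:Z) (fun j => PsiH j%:Z).

Definition F1 : fpair := fpair_app (sop_exp vf_Psi_neg) id_pair.

Definition F2 : fpair :=
  fpair_app
    (sop_mul (sop_exp (vf_zero (-2) (Psi 0)))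
       (sop_mul (alpha_2L0 1) (sop_exp (sop_opp vf_Psi_pos))))
    id_pair.

(* F and H agree where the variables of side s (false for A, M and true for
   B, N) are set to zero *)
Definition eq_at0 (s : bool) (F H : fpair) : Prop :=
  forall p m, smono_deg s m = 0%N -> F.1 p m = H.1 p m /\ F.2 p m = H.2 p m.

Definition sewing_solution : Prop :=
  [/\ (forall j, laurent_sser (Psi j) /\ sser_even (Psi j)),
      (forall j, laurent_sser (PsiH j) /\ sser_odd (PsiH j)),
      (forall j, Psi j smono1 = 0 /\ PsiH j smono1 = 0),
      (exists H2inv, is_comp_inverse H2 H2inv /\
         F1 = comp F2 (comp (comp H2inv I_pair) H1)) &
      eq_at0 true F1 id_pair /\
      eq_at0 false F2 (fser_mon (ah ^- 2) (1, false), fser_mon ah^-1 (0, true))].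

End Sewing.

End SuperSeries.

Arguments ah {R}.
Arguments varA {R} j _.
Arguments varB {R} j _.
Arguments varM {R} j _.
Arguments varN {R} j _.
Arguments exp_AM {R}.
Arguments exp_BN {R}.
Arguments alpha_2L0 {R} t.

(* Main.v *)
(* The exponential of an even superderivation is multiplicative, hence acts on
   series in x and phi as the substitution of the images of x and phi. So the
   sewing equation, once all the substitutions are written as operators (in
   reverse order), says that exp(Psi_-) and
     Theta exp(-2 Psi_0 L_0) alpha_0^{L_0} exp(-Psi_+),
   where Theta = exp(-(A,M)) alpha_0^{-L_0} exp(-(B,N)), send x and phi to the
   same series; both being multiplicative, they are equal, which is the operator
   identity. This requires that for each monomial m only finitely many Psi_j have
   a term in m. By induction on the degree of m, the terms linear in the Psi_j(m)
   are the only ones in the equation that could be infinite in number, those with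
   j < 0 appear on the left and those with j > 0 on the right, and each can be
   read off the coefficients of x. The leading terms follow by setting (A,M) or
   (B,N) to zero in the operator identity and in the boundary conditions, since
   modulo terms of higher degree an exponential is linear. *)

Require Import Defs.
From HB Require Import structures.
From mathcomp Require Import all_boot all_order all_algebra.
From mathcomp Require Import finmap multiset.
From mathcomp Require Import boolp classical_sets functions cardinality fsbigop.
From mathcomp Require Import reals.
From mathcomp Require Import complex.
From mathcomp Require Import ring zify.

Set Implicit Arguments.
Unset Strict Implicit.
Unset Printing Implicit Defensive.

Import Order.TTheory GRing.Theory Num.Theory.
Local Open Scope ring_scope.

(** * Monomials and the product of series *)

(** The sums over classical sets take the default value 0 on infinite support, and [sewing_solution]
    does not bound the number of Psi_j that involve a given monomial. Until such a bound is known,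
    the matrices of the two Psi exponents have meaningful entries, but their products may collapse
    to the default and [sop_mul] cannot be reassociated. So the algebra [eop] contains only
    column-finite operators, and the finiteness induction compares the raw exponential in degree d
    with the exponential of the part of degree below d, which does lie in [eop]. From then on
    everything is a computation in [eop], filtered by degree ([ord]). The column of x alone suffices
    to read the unknowns: L_j x = - x^(j+1) and G_{j-1/2} x = x^j phi are pairwise distinct
    monomials. In the finiteness argument Psi_0 stays inside a diagonal factor, which is harmless
    since it is a single coefficient. The powers of alpha_0 in the leading terms come from
    conjugating exp(-(B,N)) by alpha_0^{-L_0}, which is diagonal on the x^n phi^b. *)

Section Monomials.

Lemma inversionsE (S T : {fset gvar}) :
  inversions S T = (\sum_(s <- S) \sum_(t <- T) ovlt t s)%N.
Proof.
by apply: eq_bigr => s _; rewrite -sum1_count big_mkcond; apply: eq_bigr => t _; case: ovlt.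
Qed.

Lemma perm_fsetU_disj (A B : {fset gvar}) :
  [disjoint A & B]%fset -> perm_eq (A `|` B)%fset (A ++ B).
Proof.
move=> dAB; apply: uniq_perm; rewrite ?fset_uniq // ?cat_uniq ?fset_uniq ?andbT //=.
  apply/hasPn => x xB; apply/negP => xA.
  by have /fdisjointP/(_ x xA) := dAB; rewrite xB.
by move=> x; rewrite mem_cat in_fsetU.
Qed.

Lemma inversionsUl (A B T : {fset gvar}) : [disjoint A & B]%fset ->
  inversions (A `|` B)%fset T = (inversions A T + inversions B T)%N.
Proof.
by move=> dAB; rewrite !inversionsE (perm_big _ (perm_fsetU_disj dAB)) big_cat.
Qed.

Lemma inversionsUr (A B T : {fset gvar}) : [disjoint A & B]%fset ->
  inversions T (A `|` B)%fset = (inversions T A + inversions T B)%N.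
Proof.
move=> dAB; rewrite !inversionsE -big_split /=; apply: eq_bigr => s _.
by rewrite (perm_big _ (perm_fsetU_disj dAB)) big_cat.
Qed.

Lemma ovlt_total (u v : gvar) : u != v -> (ovlt u v + ovlt v u)%N = 1%N.
Proof.
case: u v => [a i] [b j]; rewrite /ovlt /= xpair_eqE (eq_sym b a).
by case: a b => [] [] //=; case: ltngtP.
Qed.

(** Two distinct variables are inverted in exactly one of the two orders. Modulo 2 this is the sign
    rule for exchanging two monomials. *)
Lemma inversionsC (A B : {fset gvar}) : [disjoint A & B]%fset ->
  (inversions A B + inversions B A)%N = (size A * size B)%N.
Proof.
move=> dAB; rewrite !inversionsE [X in (_ + X)%N]exchange_big /= -big_split /=.
rewrite (eq_big_seq (fun=> size B)); first by rewrite big_const_seq count_predT iter_addn_0 mulnC.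
move=> a aA; rewrite -big_split /= (eq_big_seq (fun=> 1%N)) ?sum1_size // => b bB.
apply: ovlt_total; apply: contraTneq bB => ->.
by have /fdisjointP := dAB; apply.
Qed.

Lemma inversions0l (A : {fset gvar}) : inversions fset0 A = 0%N.
Proof. by rewrite inversionsE big_seq_fset0. Qed.

Lemma inversions0r (A : {fset gvar}) : inversions A fset0 = 0%N.
Proof. by rewrite inversionsE big1 // => s _; rewrite big_seq_fset0. Qed.

(** The grading behind every induction below: it is additive on products and vanishes only at
    [smono1], so an operator without term of degree 0 has an exponential that is a finite sum in
    each coefficient. *)
Definition mdeg (m : smono) : nat := (smono_deg false m + smono_deg true m)%N.

Lemma count_msetD (P : pred gvar) (A B : {mset gvar}%mset) :
  count P (A `+` B)%mset = (count P A + count P B)%N.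
Proof.
by rewrite -count_cat; apply/permP/allP => /= x _; rewrite count_cat !count_mem_mset msetE2.
Qed.

Lemma smono_degM s a b m : smono_prod a b m ->
  smono_deg s m = (smono_deg s a + smono_deg s b)%N.
Proof.
rewrite /smono_deg; case=> <- dab <-.
have /permP-> := perm_fsetU_disj dab; rewrite count_cat.
by rewrite !count_msetD addnACA.
Qed.

Lemma mdegM a b m : smono_prod a b m -> mdeg m = (mdeg a + mdeg b)%N.
Proof. by move=> h; rewrite /mdeg !(smono_degM _ h) addnACA. Qed.

Lemma smono_oddM a b m : smono_prod a b m -> smono_odd m = smono_odd a (+) smono_odd b.
Proof.
rewrite /smono_odd; case=> _ dab <-; rewrite (perm_size (perm_fsetU_disj dab)).
by rewrite size_cat oddD.
Qed.

Lemma mdegE m : mdeg m = (size m.1 + size m.2)%N.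
Proof.
rewrite /mdeg /smono_deg addnACA.
suff h (s : seq gvar) :
  (count (fun v : gvar => v.1 == false) s + count (fun v : gvar => v.1 == true) s)%N = size s
  by rewrite !h.
rewrite -(count_predC (fun v : gvar => v.1 == false)); congr addn.
by apply: eq_count => -[[] ?].
Qed.

Lemma mdeg_eq0 m : (mdeg m == 0%N) = (m == smono1).
Proof.
apply/idP/eqP => [|->]; last by rewrite mdegE enum_mset0.
rewrite mdegE addn_eq0 !size_eq0; case: m => A S /= /andP[/eqP a0 /eqP s0].
congr pair; last by apply/fsetP => x; rewrite in_fset0; have <- : x \in enum_fset S = false by rewrite s0.
by apply/msetP => x; rewrite -count_mem_mset a0 mset0E.
Qed.

(** Divisibility of monomials. A monomial has finitely many divisors, so each coefficient of a
    product of series is a finite sum over [dvs m]. *)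
Definition sdvd (n m : smono) : bool := (n.1 `<=` m.1)%mset && (n.2 `<=` m.2)%fset.

(** Induction on the size: for x in M, a submultiset of M without x lies in M minus x, and one with
    x is x added to a submultiset of M minus x. *)
Lemma finite_msubset (M : {mset gvar}%mset) :
  finite_set [set n | (n `<=` M)%mset]%classic.
Proof.
have [k] := ubnP (size M); elim: k M => // k IH M hM.
have [->|] := eqVneq M mset0.
  apply: (@sub_finite_set _ _ [set mset0]%classic) => // n /=.
  by move/msubsetP => h; apply/msetP => x; have := h x; rewrite mset0E leqn0 => /eqP.
have [[x xM] _|h /eqP[]] := pselect (exists x, x \in M); last first.
  by apply/msetP => x; rewrite mset0E; apply/mset_eq0P/negP => xM; apply: h; exists x.
have sM : size M = (size (M `\ x)%mset).+1.
  by rewrite -[in LHS](msetB1K xM) -!count_predT count_msetD (enum_msetn 1).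
pose N := [set n | (n `<=` M `\ x)%mset]%classic.
have fN : finite_set N by apply: IH; rewrite sM in hM.
apply: (@sub_finite_set _ _ (N `|` [set (x +` n)%mset | n in N])%classic); last first.
  by rewrite finite_setU; split => //; apply: finite_image.
move=> n /= /msubsetP nM; have [xn|xn] := boolP (x \in n).
  right; exists (n `\ x)%mset; last exact: msetB1K.
  by apply/msubsetP => y; rewrite !msetB1E leq_sub2r.
left; apply/msubsetP => y; rewrite msetB1E; have [->|_] := eqVneq y x.
  by move/mset_eq0P: xn => ->.
by rewrite subn0.
Qed.

Lemma finite_sdvd m : finite_set [set n | sdvd n m]%classic.
Proof.
pose X := ([set A | (A `<=` m.1)%mset] `*` [set` fpowerset m.2])%classic.
apply: (@sub_finite_set _ _ X); last by apply: finite_setX; [apply: finite_msubset|].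
by move=> [A S] /= /andP[/= hA hS]; split => //=; rewrite fpowersetE.
Qed.

Definition dvs (m : smono) : {fset smono} := fset_set [set n | sdvd n m]%classic.

Lemma in_dvs n m : (n \in dvs m) = sdvd n m.
Proof. by rewrite in_fset_set; [apply/idP/idP; rewrite inE | exact: finite_sdvd]. Qed.

Lemma sdvd_refl m : sdvd m m.
Proof. by rewrite /sdvd msubset_refl fsubset_refl. Qed.

Lemma sdvd_trans b a c : sdvd a b -> sdvd b c -> sdvd a c.
Proof.
move=> /andP[h1 h2] /andP[h3 h4]; apply/andP; split.
  exact: msubset_trans h3.
exact: fsubset_trans h4.
Qed.

Definition smono_prodb (a b m : smono) : bool :=
  [&& (a.1 `+` b.1)%mset == m.1, [disjoint a.2 & b.2]%fset & (a.2 `|` b.2)%fset == m.2].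

Lemma smono_prodP a b m : reflect (smono_prod a b m) (smono_prodb a b m).
Proof.
by apply: (iffP and3P) => -[h1 h2 h3]; split => //; apply/eqP.
Qed.

Lemma smono_prod_dvdl a b m : smono_prod a b m -> sdvd a m.
Proof.
rewrite /sdvd; case=> <- _ <-; rewrite fsubsetUl andbT.
by apply/msubsetP => x; rewrite msetE2 leq_addr.
Qed.

Lemma smono_prod_dvdr a b m : smono_prod a b m -> sdvd b m.
Proof.
rewrite /sdvd; case=> <- _ <-; rewrite fsubsetUr andbT.
by apply/msubsetP => x; rewrite msetE2 leq_addl.
Qed.

Lemma smono_prod1l b m : smono_prod smono1 b m <-> b = m.
Proof.
rewrite /smono_prod /= mset0D fset0U; split=> [[h _ h']|->]; last first.
  by split => //; apply/fdisjointP.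
by apply/eqP; rewrite -pair_eqE /pair_eq h h' !eqxx.
Qed.

Lemma smono_prod1r a m : smono_prod a smono1 m <-> a = m.
Proof.
rewrite /smono_prod /= msetD0 fsetU0; split=> [[h _ h']|->]; last first.
  by split => //; rewrite fdisjoint_sym; apply/fdisjointP.
by apply/eqP; rewrite -pair_eqE /pair_eq h h' !eqxx.
Qed.

End Monomials.

Section FiniteSums.
Context {V : nmodType}.

Lemma big_only (I : eqType) (s : seq I) (i0 : I) (F : I -> V) : uniq s ->
  (forall i, i != i0 -> F i = 0) -> (i0 \notin s -> F i0 = 0) ->
  \sum_(i <- s) F i = F i0.
Proof.
move=> us hF h0; have [i0s|ni0s] := boolP (i0 \in s); last first.
  rewrite h0 // big1_seq // => i _; have [->|ne] := eqVneq i i0; [exact: h0|exact: hF].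
by rewrite (bigD1_seq i0) //= big1 ?addr0 // => i; exact: hF.
Qed.

Lemma fsumE (I : choiceType) (A : {fset I}) (F : I -> V) :
  (forall i, F i != 0 -> i \in A) ->
  \sum_(i \in [set: I]%classic) F i = \sum_(i <- A) F i.
Proof. by move=> h; apply: fsbigTE => i; apply: contraNeq; apply: h. Qed.

Lemma fsum_only (I : choiceType) (i0 : I) (F : I -> V) :
  (forall i, i != i0 -> F i = 0) -> \sum_(i \in [set: I]%classic) F i = F i0.
Proof.
move=> h; rewrite (fsumE (A := [fset i0]%fset)) ?big_seq_fset1 // => i.
by rewrite inE; apply: contraNT => /h ->.
Qed.

End FiniteSums.

(** * Associativity of the product of series *)

Section SeriesRing.
Context {R : realType}.
Local Notation K := {fraction {poly R[i]}}.
Implicit Types (f g h : sser R).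

(** Structure constants: the product of the monomials a and b is the sum over m of [sc a b m] times
    m, with at most one nonzero term. *)
Definition sc (a b m : smono) : K :=
  if smono_prodb a b m then (-1) ^+ inversions a.2 b.2 else 0.

Lemma sc_neq0 a b m : sc a b m != 0 -> smono_prod a b m.
Proof. by rewrite /sc; case: smono_prodP => // _; rewrite eqxx. Qed.

Lemma sc_prod a b : [disjoint a.2 & b.2]%fset ->
  sc a b ((a.1 `+` b.1)%mset, (a.2 `|` b.2)%fset) = (-1) ^+ inversions a.2 b.2.
Proof. by move=> dab; rewrite /sc /smono_prodb dab !eqxx. Qed.

(** Stated for every divisor n of m so that nested products are all summed over the same range
    [dvs m], where the summations can be exchanged. *)
Lemma sser_mulE f g m n : sdvd n m ->
  sser_mul f g n = \sum_(a <- dvs m) \sum_(b <- dvs m) sc a b n * f a * g b.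
Proof.
move=> nm; pose F (p : smono * smono) := sc p.1 p.2 n * f p.1 * g p.2.
rewrite /sser_mul (eq_fsbigr F); last first.
  by move=> p; rewrite inE /= /F /sc => /smono_prodP ->.
rewrite (fsbig_fwiden [seq (a, b) | a <- dvs m, b <- dvs m] _ F).
- by rewrite big_allpairs.
- move=> [a b] /= ab; apply/allpairsP; exists (a, b); split => //=; rewrite in_dvs.
    exact: sdvd_trans (smono_prod_dvdl ab) nm.
  exact: sdvd_trans (smono_prod_dvdr ab) nm.
- by apply: allpairs_uniq => //; rewrite ?fset_uniq // => -[x1 x2] [y1 y2].
- by move=> [a b] /= [_] ab; rewrite /F /sc /=; case: smono_prodP => // _; rewrite !mul0r.
Qed.

(** Only n = a b can contribute. If it is not in [dvs m], nothing is lost, because its structure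
    constant with c at m vanishes too. *)
Lemma sc_assocl a b c m :
  \sum_(n <- dvs m) sc a b n * sc n c m =
  if [disjoint a.2 & b.2]%fset then
    (-1) ^+ inversions a.2 b.2 * sc ((a.1 `+` b.1)%mset, (a.2 `|` b.2)%fset) c m
  else 0.
Proof.
case: ifPn => dab; last first.
  by rewrite big1 // => n _; rewrite /sc; case: smono_prodP => [[]|_]; rewrite ?(negPf dab) ?mul0r.
rewrite (big_only (i0 := ((a.1 `+` b.1)%mset, (a.2 `|` b.2)%fset))) ?fset_uniq //.
- by rewrite sc_prod.
- move=> n nn; rewrite {1}/sc; case: smono_prodP => [[h1 _ h2]|]; rewrite ?mul0r //.
  by move: nn; rewrite [n]surjective_pairing -h1 -h2 eqxx.
- rewrite in_dvs => h; rewrite {2}/sc; case: smono_prodP; rewrite ?mulr0 //.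
  by move/smono_prod_dvdl; rewrite (negPf h).
Qed.

Lemma sc_assocr a b c m :
  \sum_(n <- dvs m) sc b c n * sc a n m =
  if [disjoint b.2 & c.2]%fset then
    (-1) ^+ inversions b.2 c.2 * sc a ((b.1 `+` c.1)%mset, (b.2 `|` c.2)%fset) m
  else 0.
Proof.
case: ifPn => dab; last first.
  by rewrite big1 // => n _; rewrite /sc; case: smono_prodP => [[]|_]; rewrite ?(negPf dab) ?mul0r.
rewrite (big_only (i0 := ((b.1 `+` c.1)%mset, (b.2 `|` c.2)%fset))) ?fset_uniq //.
- by rewrite sc_prod.
- move=> n nn; rewrite {1}/sc; case: smono_prodP => [[h1 _ h2]|]; rewrite ?mul0r //.
  by move: nn; rewrite [n]surjective_pairing -h1 -h2 eqxx.
- rewrite in_dvs => h; rewrite {2}/sc; case: smono_prodP; rewrite ?mulr0 //.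
  by move/smono_prod_dvdr; rewrite (negPf h).
Qed.

(** [inversions] is additive on disjoint unions in each argument, so both bracketings carry the sign
    given by the inversions of (a, b), (a, c) and (b, c) together. *)
Lemma sc_assoc a b c m :
  \sum_(n <- dvs m) sc a b n * sc n c m = \sum_(n <- dvs m) sc b c n * sc a n m.
Proof.
rewrite sc_assocl sc_assocr /sc /smono_prodb /= msetDA fsetUA fdisjointUX fdisjointXU.
have [dab|_] := boolP [disjoint a.2 & b.2]%fset; have [dbc|_] := boolP [disjoint b.2 & c.2]%fset;
  have [dac|_] := boolP [disjoint a.2 & c.2]%fset; rewrite ?andbF ?mulr0 //=.
case: ifP => _; rewrite ?mulr0 // -!exprD.
by rewrite inversionsUl // inversionsUr // addnA [in RHS]addnC.
Qed.

Lemma sser_mulA f g h : sser_mul f (sser_mul g h) = sser_mul (sser_mul f g) h.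
Proof.
apply/funext => m; rewrite !(sser_mulE _ _ (sdvd_refl m)).
pose T a b c := f a * g b * h c.
transitivity (\sum_(a <- dvs m) \sum_(b <- dvs m) \sum_(c <- dvs m)
   (\sum_(n <- dvs m) sc b c n * sc a n m) * T a b c).
  apply: eq_bigr => a _.
  transitivity (\sum_(n <- dvs m) \sum_(b <- dvs m) \sum_(c <- dvs m)
     sc b c n * sc a n m * T a b c).
    apply: eq_big_seq => n; rewrite in_dvs => nm; rewrite (sser_mulE _ _ nm) mulr_sumr.
    apply: eq_bigr => b _; rewrite mulr_sumr; apply: eq_bigr => c _.
    by rewrite /T; ring.
  rewrite exchange_big; apply: eq_bigr => b _; rewrite exchange_big; apply: eq_bigr => c _.
  by rewrite mulr_suml.
transitivity (\sum_(n <- dvs m) \sum_(a <- dvs m) \sum_(b <- dvs m) \sum_(c <- dvs m)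
   sc a b n * sc n c m * T a b c).
  rewrite [RHS]exchange_big; apply: eq_bigr => a _; rewrite [RHS]exchange_big; apply: eq_bigr => b _.
  rewrite [RHS]exchange_big; apply: eq_bigr => c _.
  by rewrite -sc_assoc mulr_suml.
apply: eq_big_seq => n; rewrite in_dvs => nm.
rewrite [RHS](eq_bigr (fun c => \sum_(a <- dvs m) \sum_(b <- dvs m)
  sc a b n * sc n c m * T a b c)); last first.
  move=> c _; rewrite (sser_mulE _ _ nm) mulr_sumr mulr_suml; apply: eq_bigr => a _.
  rewrite mulr_sumr mulr_suml; apply: eq_bigr => b _; rewrite /T; ring.
rewrite [RHS]exchange_big; apply: eq_bigr => a _; rewrite [RHS]exchange_big.
by apply: eq_bigr.
Qed.

End SeriesRing.

(** * Bilinearity, constants and supercommutativity *)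

Section SeriesAlgebra.
Context {R : realType}.
Local Notation K := {fraction {poly R[i]}}.
Implicit Types (f g h : sser R).

Lemma sserDE f g m : (f + g) m = f m + g m. Proof. by []. Qed.
Lemma sserNE f m : (- f) m = - f m. Proof. by []. Qed.

Lemma sc_mul_prod (a b m : smono) (x y : K) :
  (smono_prod a b m -> x = y) -> sc a b m * x = sc a b m * y.
Proof.
by move=> h; have [->|/sc_neq0/h->//] := eqVneq (@sc R a b m) 0; rewrite !mul0r.
Qed.

(** A coefficient of a product depends only on the factorizations of its monomial. This is how a
    factor gets replaced by one that agrees with it in the relevant degrees only. *)
Lemma eq_sser_mul f g f' g' m :
  (forall a b, smono_prod a b m -> f a * g b = f' a * g' b) ->
  sser_mul f g m = sser_mul f' g' m.
Proof.
move=> h; rewrite !(sser_mulE _ _ (sdvd_refl m)).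
apply: eq_bigr => a _; apply: eq_bigr => b _; rewrite -!mulrA.
by apply: sc_mul_prod; exact: h.
Qed.

Lemma sser_mul_neq0 f g m : sser_mul f g m != 0 ->
  exists a b, [/\ smono_prod a b m, f a != 0 & g b != 0].
Proof.
apply: contra_neqP => h; pose z : sser R := fun=> 0.
transitivity (sser_mul z z m).
  apply: eq_sser_mul => a b ab; rewrite mul0r.
  have [->|fa] := eqVneq (f a) 0; rewrite ?mul0r //.
  have [->|gb] := eqVneq (g b) 0; rewrite ?mulr0 //.
  by case: h; exists a, b.
rewrite (sser_mulE _ _ (sdvd_refl m)) big1 // => a _; rewrite big1 // => b _.
by rewrite mulr0.
Qed.

Lemma sser_mulDl f g h : sser_mul (f + g) h = sser_mul f h + sser_mul g h.
Proof.
apply/funext => m; rewrite sserDE !(sser_mulE _ _ (sdvd_refl m)) -big_split /=.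
apply: eq_bigr => a _; rewrite -big_split /=; apply: eq_bigr => b _.
by rewrite sserDE mulrDr mulrDl.
Qed.

Lemma sser_mulDr f g h : sser_mul h (f + g) = sser_mul h f + sser_mul h g.
Proof.
apply/funext => m; rewrite sserDE !(sser_mulE _ _ (sdvd_refl m)) -big_split /=.
apply: eq_bigr => a _; rewrite -big_split /=; apply: eq_bigr => b _.
by rewrite sserDE mulrDr.
Qed.

Definition sscale (c : K) f : sser R := fun m => c * f m.

Lemma sser_mulZl c f g : sser_mul (sscale c f) g = sscale c (sser_mul f g).
Proof.
apply/funext => m; rewrite /sscale !(sser_mulE _ _ (sdvd_refl m)) mulr_sumr.
by apply: eq_bigr => a _; rewrite mulr_sumr; apply: eq_bigr => b _; ring.
Qed.

Lemma sser_mulZr c f g : sser_mul f (sscale c g) = sscale c (sser_mul f g).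
Proof.
apply/funext => m; rewrite /sscale !(sser_mulE _ _ (sdvd_refl m)) mulr_sumr.
by apply: eq_bigr => a _; rewrite mulr_sumr; apply: eq_bigr => b _; ring.
Qed.

Lemma sser_mul0l g : sser_mul 0 g = 0.
Proof. by apply/(@addIr _ (sser_mul 0 g)); rewrite -sser_mulDl !add0r. Qed.

Lemma sser_mul0r g : sser_mul g 0 = 0.
Proof. by apply/(@addIr _ (sser_mul g 0)); rewrite -sser_mulDr !add0r. Qed.

Lemma sser_mulNl f g : sser_mul (- f) g = - sser_mul f g.
Proof. by apply/(@addIr _ (sser_mul f g)); rewrite -sser_mulDl !addNr sser_mul0l. Qed.

Lemma sser_mulNr f g : sser_mul f (- g) = - sser_mul f g.
Proof. by apply/(@addIr _ (sser_mul f g)); rewrite -sser_mulDr !addNr sser_mul0r. Qed.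

Lemma sser_mul_suml (I : Type) (s : seq I) (F : I -> sser R) g :
  sser_mul (\sum_(i <- s) F i) g = \sum_(i <- s) sser_mul (F i) g.
Proof.
by elim: s => [|i s IH]; rewrite ?big_nil ?sser_mul0l // !big_cons sser_mulDl IH.
Qed.

Lemma sser_mul_sumr (I : Type) (s : seq I) (F : I -> sser R) g :
  sser_mul g (\sum_(i <- s) F i) = \sum_(i <- s) sser_mul g (F i).
Proof.
by elim: s => [|i s IH]; rewrite ?big_nil ?sser_mul0r // !big_cons sser_mulDr IH.
Qed.

Definition sconst (c : K) : sser R := fun m => if m == smono1 then c else 0.

Lemma sser_mul_constl c f : sser_mul (sconst c) f = sscale c f.
Proof.
apply/funext => m; rewrite (sser_mulE _ _ (sdvd_refl m)) /sconst.
have d1 : sdvd smono1 m by apply: (@smono_prod_dvdl _ m m); apply/smono_prod1l.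
rewrite (big_only (i0 := smono1)) ?fset_uniq ?in_dvs ?d1 //; last first.
  by move=> a /negPf na; rewrite big1 // => b _; rewrite na mulr0 mul0r.
rewrite (big_only (i0 := m)) ?fset_uniq ?in_dvs ?sdvd_refl //; last first.
  move=> b bm; rewrite /sc; case: smono_prodP => [/smono_prod1l|_]; rewrite ?mul0r //.
  by move/eqP; rewrite (negPf bm).
rewrite eqxx /sc; case: smono_prodP => [_|[]]; last exact/smono_prod1l.
by rewrite inversions0l mul1r.
Qed.

Lemma sser_mul_constr c f : sser_mul f (sconst c) = sscale c f.
Proof.
apply/funext => m; rewrite (sser_mulE _ _ (sdvd_refl m)) /sconst exchange_big.
have d1 : sdvd smono1 m by apply: (@smono_prod_dvdl _ m m); apply/smono_prod1l.
rewrite (big_only (i0 := smono1)) ?fset_uniq ?in_dvs ?d1 //; last first.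
  by move=> a /negPf na; rewrite big1 // => b _; rewrite na mulr0.
rewrite (big_only (i0 := m)) ?fset_uniq ?in_dvs ?sdvd_refl //; last first.
  move=> b bm; rewrite /sc; case: smono_prodP => [/smono_prod1r|_]; rewrite ?mul0r //.
  by move/eqP; rewrite (negPf bm).
rewrite eqxx /sc; case: smono_prodP => [_|[]]; last exact/smono_prod1r.
by rewrite inversions0r mul1r mulrC.
Qed.

Lemma sscale1 f : sscale 1 f = f.
Proof. by apply/funext => m; rewrite /sscale mul1r. Qed.

Lemma sscaleA c d f : sscale c (sscale d f) = sscale (c * d) f.
Proof. by apply/funext => m; rewrite /sscale mulrA. Qed.

Lemma sscale0r c : sscale c 0 = 0.
Proof. by apply/funext => m; rewrite /sscale mulr0. Qed.

Lemma sscale0l f : sscale 0 f = 0.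
Proof. by apply/funext => m; rewrite /sscale mul0r. Qed.

Definition par (b : bool) f : Prop := forall m, f m != 0 -> smono_odd m = b.

Lemma par0 b : par b 0.
Proof. by move=> m; rewrite eqxx. Qed.

Lemma parN b f : par b f -> par b (- f).
Proof. by move=> hf m; rewrite sserNE oppr_eq0; exact: hf. Qed.

Lemma parZ b c f : par b f -> par b (sscale c f).
Proof. by move=> hf m; rewrite mulf_eq0 negb_or => /andP[_ /hf]. Qed.

Lemma parM b c f g : par b f -> par c g -> par (b (+) c) (sser_mul f g).
Proof.
by move=> hf hg m /sser_mul_neq0[x [y [/smono_oddM-> /hf-> /hg->]]].
Qed.

Lemma par_const c : par false (sconst c).
Proof. by move=> m; rewrite /sconst; have [->|_] := eqVneq m smono1; rewrite ?eqxx. Qed.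

(** By [inversionsC], exchanging an odd monomial with b costs the parity of b, which is what
    [sser_sign] records. *)
Lemma sser_odd_comm f g : par true f -> sser_mul g f = sser_mul f (sser_sign g).
Proof.
move=> hf; apply/funext => m; rewrite !(sser_mulE _ _ (sdvd_refl m)) exchange_big.
apply: eq_bigr => a _; apply: eq_bigr => b _.
have [->|/hf oa] := eqVneq (f a) 0; first by rewrite !mulr0 !mul0r.
suff key : @sc R b a m = sc a b m * (-1) ^+ smono_odd b by rewrite key /sser_sign; ring.
rewrite /sc; have -> : smono_prodb a b m = smono_prodb b a m.
  by rewrite /smono_prodb msetDC fsetUC fdisjoint_sym.
case: smono_prodP => [[_ dab _]|_]; last by rewrite mul0r.
rewrite -(signr_odd _ (inversions b.2 a.2)) -(signr_odd _ (inversions a.2 b.2)) -signr_addb.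
have := inversionsC dab => /(congr1 odd); rewrite oddD oddM -/(smono_odd a) oa andbT.
by rewrite -/(smono_odd b) => <-; rewrite addbCA addbb addbF.
Qed.

(** For an even monomial a the product of the sizes of a and b is even, so the two orders have
    inversions of the same parity. *)
Lemma sser_even_comm f g : par false f -> sser_mul f g = sser_mul g f.
Proof.
move=> hf; apply/funext => m; rewrite !(sser_mulE _ _ (sdvd_refl m)) [RHS]exchange_big.
apply: eq_bigr => a _; apply: eq_bigr => b _.
have [->|/hf oa] := eqVneq (f a) 0; first by rewrite !mulr0 !mul0r.
suff key : @sc R a b m = sc b a m by rewrite key; ring.
rewrite /sc; have -> : smono_prodb a b m = smono_prodb b a m.
  by rewrite /smono_prodb msetDC fsetUC fdisjoint_sym.
case: smono_prodP => [[_ dab _]|_] //.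
rewrite -(signr_odd _ (inversions b.2 a.2)) -(signr_odd _ (inversions a.2 b.2)).
have := inversionsC dab => /(congr1 odd); rewrite oddD oddM -/(smono_odd a) oa andbF.
by case: (odd (inversions a.2 b.2)); case: (odd (inversions b.2 a.2)).
Qed.

End SeriesAlgebra.

(** * Locally finite sums and operators *)

Section LocallyFinite.
Context {R : realType}.
Local Notation K := {fraction {poly R[i]}}.
Local Open Scope classical_set_scope.

(* locally finite families *)
Definition lf (I : Type) (F : I -> sser R) : Prop :=
  forall m, finite_set [set i | F i m != 0].

Definition lsum (I : choiceType) (F : I -> sser R) : sser R :=
  fun m => \sum_(i \in [set: I]) F i m.

Lemma lfD (I : Type) (F G : I -> sser R) : lf F -> lf G -> lf (fun i => F i + G i).
Proof.
move=> hF hG m; apply: (@sub_finite_set _ _ ([set i | F i m != 0] `|` [set i | G i m != 0])).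
  move=> i /=; rewrite sserDE; have [->|] := eqVneq (F i m) 0; last by left.
  by rewrite add0r; right.
by rewrite finite_setU.
Qed.

Lemma lfN (I : Type) (F : I -> sser R) : lf F -> lf (fun i => - F i).
Proof.
move=> hF m; apply: sub_finite_set (hF m) => i /=.
by rewrite sserNE oppr_eq0.
Qed.

Lemma lfZ (I : Type) (F : I -> sser R) c : lf F -> lf (fun i => sscale c (F i)).
Proof.
by move=> hF m; apply: sub_finite_set (hF m) => i /=; rewrite mulf_eq0 negb_or => /andP[].
Qed.

(** Only the finitely many divisors of m can occur as monomials of the first factor, and each
    selects finitely many i. *)
Lemma lfMl (I : Type) (F G : I -> sser R) : lf F -> lf (fun i => sser_mul (F i) (G i)).
Proof.
move=> hF m.
apply: (@sub_finite_set _ _ (\bigcup_(a in [set a | sdvd a m]) [set i | F i a != 0])).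
  by move=> i /= /sser_mul_neq0[a [b [/smono_prod_dvdl am fa _]]]; exists a.
by apply: bigcup_finite => [|a _]; [exact: finite_sdvd|exact: hF].
Qed.

Lemma lfMr (I : Type) (F G : I -> sser R) : lf G -> lf (fun i => sser_mul (F i) (G i)).
Proof.
move=> hF m.
apply: (@sub_finite_set _ _ (\bigcup_(a in [set a | sdvd a m]) [set i | G i a != 0])).
  by move=> i /= /sser_mul_neq0[a [b [/smono_prod_dvdr am _ fa]]]; exists b.
by apply: bigcup_finite => [|a _]; [exact: finite_sdvd|exact: hF].
Qed.

Lemma lf_pairM (I J : Type) (F : I -> sser R) (G : I -> J -> sser R) :
  lf F -> (forall i, lf (G i)) ->
  lf (fun ij : I * J => sser_mul (F ij.1) (G ij.1 ij.2)).
Proof.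
move=> hF hG m.
pose A := \bigcup_(a in [set a | sdvd a m]) [set i | F i a != 0].
pose B i := \bigcup_(a in [set a | sdvd a m]) [set j | G i j a != 0].
apply: (@sub_finite_set _ _ (\bigcup_(i in A) [set (i, j) | j in B i])).
  move=> [i j] /= /sser_mul_neq0[a [b [/[dup]/smono_prod_dvdl am /smono_prod_dvdr bm fa gb]]].
  exists i; first by exists a; [exact: am|exact: fa].
  by exists j => //; exists b; [exact: bm|exact: gb].
apply: bigcup_finite => [|i _].
  by apply: bigcup_finite => [|a _]; [exact: finite_sdvd|exact: hF].
apply: finite_image; apply: bigcup_finite => [|a _]; [exact: finite_sdvd|exact: hG].
Qed.

Lemma lsumE (I : choiceType) (F : I -> sser R) (A : {fset I}) m :
  (forall i, F i m != 0 -> i \in A) -> lsum F m = \sum_(i <- A) F i m.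
Proof. exact: fsumE. Qed.

Lemma lf_fset (I : choiceType) (F : I -> sser R) m : lf F ->
  exists A : {fset I}, forall i, F i m != 0 -> i \in A.
Proof.
move=> hF; exists (fset_set [set i | F i m != 0]) => i h.
by rewrite in_fset_set ?inE //=; exact: hF.
Qed.

Lemma lf_fset_dvd (I : choiceType) (F : I -> sser R) m : lf F ->
  exists A : {fset I}, forall i a, sdvd a m -> F i a != 0 -> i \in A.
Proof.
move=> hF; exists (fset_set (\bigcup_(a in [set a | sdvd a m]) [set i | F i a != 0])) => i a am h.
rewrite in_fset_set; first by rewrite inE; exists a.
by apply: bigcup_finite => [|b _]; [exact: finite_sdvd|exact: hF].
Qed.

Lemma lsumD (I : choiceType) (F G : I -> sser R) : lf F -> lf G ->
  lsum (fun i => F i + G i) = lsum F + lsum G.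
Proof.
move=> hF hG; apply/funext => m; rewrite sserDE.
have [A inA] := lf_fset m hF; have [B inB] := lf_fset m hG.
have inAB i : (i \in A) || (i \in B) -> i \in (A `|` B)%fset by rewrite in_fsetU.
rewrite (lsumE (F := fun i => F i + G i) (A := (A `|` B)%fset)); last first.
  move=> i /=; rewrite sserDE => h; apply: inAB; move: h; have [->|/inA->] := eqVneq (F i m) 0; last by [].
  by rewrite add0r => /inB ->; rewrite orbT.
rewrite (lsumE (F := F) (A := (A `|` B)%fset)); last by move=> i /inA h; apply: inAB; rewrite h.
rewrite (lsumE (F := G) (A := (A `|` B)%fset)); last by move=> i /inB h; apply: inAB; rewrite h orbT.
exact: big_split.
Qed.


Lemma lsumZ (I : choiceType) (F : I -> sser R) c : lf F ->
  lsum (fun i => sscale c (F i)) = sscale c (lsum F).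
Proof.
move=> hF; apply/funext => m; have [A inA] := lf_fset m hF.
rewrite (lsumE (A := A)); last by move=> i; rewrite mulf_eq0 negb_or => /andP[_ /inA].
by rewrite [RHS]/sscale (lsumE inA) mulr_sumr.
Qed.

Lemma sser_sumE (I : Type) (s : seq I) (F : I -> sser R) m :
  (\sum_(i <- s) F i) m = \sum_(i <- s) F i m.
Proof. by rewrite fct_sumE. Qed.

Lemma lsum_mull (I : choiceType) (F : I -> sser R) g : lf F ->
  sser_mul (lsum F) g = lsum (fun i => sser_mul (F i) g).
Proof.
move=> hF; apply/funext => m; have [A inA] := lf_fset_dvd m hF.
rewrite (lsumE (A := A)); last first.
  by move=> i /sser_mul_neq0[a [b [/smono_prod_dvdl /inA h /h]]].
rewrite -(sser_sumE A (fun i => sser_mul (F i) g)) -sser_mul_suml; apply: eq_sser_mul => a b /smono_prod_dvdl am.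
by rewrite sser_sumE (lsumE (A := A)) // => i; exact: inA.
Qed.

Lemma lsum_mulr (I : choiceType) (F : I -> sser R) g : lf F ->
  sser_mul g (lsum F) = lsum (fun i => sser_mul g (F i)).
Proof.
move=> hF; apply/funext => m; have [A inA] := lf_fset_dvd m hF.
rewrite (lsumE (A := A)); last first.
  by move=> i /sser_mul_neq0[a [b [/smono_prod_dvdr /inA h _ /h]]].
rewrite -(sser_sumE A (fun i => sser_mul g (F i))) -sser_mul_sumr; apply: eq_sser_mul => a b /smono_prod_dvdr am.
by rewrite sser_sumE (lsumE (A := A)) // => i; exact: inA.
Qed.

Lemma lsum_exchange (I J : choiceType) (F : I -> J -> sser R) :
  lf (fun ij : I * J => F ij.1 ij.2) ->
  lsum (fun i => lsum (F i)) = lsum (fun j => lsum (F^~ j)).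
Proof.
move=> hF; apply/funext => m; have [S inS] := lf_fset m hF.
have [A inA] : exists A : {fset I}, forall i j, F i j m != 0 -> i \in A.
  by exists [fset ij.1 | ij in S]%fset => i j h; apply/imfsetP; exists (i, j); rewrite ?inS.
have [B inB] : exists B : {fset J}, forall i j, F i j m != 0 -> j \in B.
  by exists [fset ij.2 | ij in S]%fset => i j h; apply/imfsetP; exists (i, j); rewrite ?inS.
have rowE i : lsum (F i) m = \sum_(j <- B) F i j m by apply: lsumE => j; exact: inB.
have colE j : lsum (F^~ j) m = \sum_(i <- A) F i j m by apply: lsumE => i; exact: inA.
rewrite (lsumE (A := A)); last first.
  move=> i; rewrite rowE; apply: contraNT => iA; rewrite big1 // => j _.
  by apply/eqP; apply: contraNT iA; exact: inA.
rewrite (lsumE (A := B)); last first.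
  move=> j; rewrite colE; apply: contraNT => iA; rewrite big1 // => i _.
  by apply/eqP; apply: contraNT iA; exact: inB.
by rewrite (eq_bigr _ (fun i _ => rowE i)) (eq_bigr _ (fun i _ => colE i)) exchange_big.
Qed.

Lemma lsum_only (I : choiceType) (F : I -> sser R) i0 :
  (forall i, i != i0 -> F i = 0) -> lsum F = F i0.
Proof.
by move=> h; apply/funext => m; apply: fsum_only => i /h ->.
Qed.

End LocallyFinite.

(** * The algebra of column-finite operators *)

Section Operators.
Context {R : realType}.
Local Notation K := {fraction {poly R[i]}}.
Local Open Scope classical_set_scope.
Implicit Types S T U : sop R.

(** Column q is the image of a monomial x^n phi^b; at each m this image is required to be a Laurent
    polynomial in x and phi. This keeps the sums in [sop_mul] away from the default value of
    infinite supports. *)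
Definition colfin T : Prop := forall q, lf (fun p => T p q).

Lemma sopP S T : (forall p q, S p q = T p q) -> S = T.
Proof. by move=> h; apply/funext => p; apply/funext => q. Qed.

Lemma sopDE S T p q : (S + T) p q = S p q + T p q.
Proof. by []. Qed.

Lemma sop_mulE S T p q : sop_mul S T p q = lsum (fun r => sser_mul (T r q) (S p r)).
Proof. by []. Qed.

Lemma colfin_mul S T : colfin S -> colfin T -> colfin (sop_mul S T).
Proof.
move=> hS hT q m; have h := lf_pairM (hT q) hS.
apply: sub_finite_set (finite_image snd (h m)) => p /=.
have [[r hr] _|h0] := pselect (exists r, sser_mul (T r q) (S p r) m != 0).
  by exists (r, p).
rewrite sop_mulE /lsum fsbig1 ?eqxx // => r _.
by apply/eqP/negPn/negP => hr; apply: h0; exists r.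
Qed.

(** At a given monomial, column q of [U] leaves finitely many s, and for each of them column s of
    [T] leaves finitely many r; so the two summations can be exchanged. *)
Lemma sop_mulA S T U : colfin T -> colfin U ->
  sop_mul S (sop_mul T U) = sop_mul (sop_mul S T) U.
Proof.
move=> hT hU; apply: sopP => p q; rewrite !sop_mulE.
transitivity (lsum (fun r => lsum (fun s =>
    sser_mul (sser_mul (U s q) (T r s)) (S p r)))).
  congr lsum; apply/funext => r; rewrite sop_mulE lsum_mull //.
  exact: lfMl (hU q).
rewrite lsum_exchange.
  congr lsum; apply/funext => s; rewrite sop_mulE lsum_mulr; last exact: lfMl (hT s).
  by congr lsum; apply/funext => r; rewrite sser_mulA.
move=> m; have h := lfMl (fun sr => S p sr.2) (lf_pairM (hU q) hT).
apply: sub_finite_set (finite_image (fun sr => (sr.2, sr.1)) (h m)) => -[r s] /= hrs.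
by exists (s, r).
Qed.

Lemma sop_mulDl S T U : colfin U -> sop_mul (S + T) U = sop_mul S U + sop_mul T U.
Proof.
move=> hU; apply: sopP => p q; rewrite sopDE !sop_mulE -lsumD.
- by congr lsum; apply/funext => r; rewrite sopDE sser_mulDr.
- exact: lfMl (hU q).
- exact: lfMl (hU q).
Qed.

Lemma sop_mulDr S T U : colfin T -> colfin U -> sop_mul S (T + U) = sop_mul S T + sop_mul S U.
Proof.
move=> hT hU; apply: sopP => p q; rewrite sopDE !sop_mulE -lsumD.
- by congr lsum; apply/funext => r; rewrite sopDE sser_mulDl.
- exact: lfMl (hT q).
- exact: lfMl (hU q).
Qed.

Definition sop_scale (c : K) T : sop R := fun p q => sscale c (T p q).

Lemma sop_mulZl c S T : colfin T -> sop_mul (sop_scale c S) T = sop_scale c (sop_mul S T).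
Proof.
move=> hT; apply: sopP => p q; rewrite /sop_scale !sop_mulE -lsumZ; last exact: lfMl (hT q).
by congr lsum; apply/funext => r; rewrite sser_mulZr.
Qed.

Lemma sop_mulZr c S T : colfin T -> sop_mul S (sop_scale c T) = sop_scale c (sop_mul S T).
Proof.
move=> hT; apply: sopP => p q; rewrite /sop_scale !sop_mulE -lsumZ; last exact: lfMl (hT q).
by congr lsum; apply/funext => r; rewrite sser_mulZl.
Qed.

Definition dg (d : xphi -> sser R) : sop R := fun p q => if p == q then d q else 0.

Lemma colfin_dg d : colfin (dg d).
Proof.
move=> q m; apply: (@sub_finite_set _ _ [set q]) => // p /=.
by rewrite /dg; have [->//|_] := eqVneq p q; rewrite eqxx.
Qed.

Lemma sop_mul_dgl d T p q : sop_mul (dg d) T p q = sser_mul (T p q) (d p).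
Proof.
rewrite sop_mulE (lsum_only (i0 := p)) /dg ?eqxx // => r.
by rewrite eq_sym => /negPf ->; rewrite sser_mul0r.
Qed.

Lemma sop_mul_dgr d T p q : sop_mul T (dg d) p q = sser_mul (d q) (T p q).
Proof.
rewrite sop_mulE (lsum_only (i0 := q)) /dg ?eqxx // => r.
by move=> /negPf ->; rewrite sser_mul0l.
Qed.

Lemma sop1_dg : @sop1 R = dg (fun=> sconst 1).
Proof.
apply: sopP => p q; apply/funext => m; rewrite /sop1 /dg /sconst.
by case: (p == q) => //=; case: (m == smono1).
Qed.

Lemma alpha_dg t : @alpha_2L0 R t = dg (fun q => sconst (ah ^ (- t * (2 * q.1 + (q.2 : nat)%:Z)))).
Proof.
apply: sopP => p q; apply/funext => m; rewrite /alpha_2L0 /dg /sconst.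
by case: (p == q).
Qed.

Lemma sop_mul1l T : sop_mul (@sop1 R) T = T.
Proof. by apply: sopP => p q; rewrite sop1_dg sop_mul_dgl sser_mul_constr sscale1. Qed.

Lemma sop_mul1r T : sop_mul T (@sop1 R) = T.
Proof. by apply: sopP => p q; rewrite sop1_dg sop_mul_dgr sser_mul_constl sscale1. Qed.

(* the operators whose coefficients all map K[x, 1/x, phi] to itself *)
Record eop := Eop { opf :> xphi -> xphi -> sser R; eop_colfin : `[< colfin opf >] }.
HB.instance Definition _ := [isSub for opf].
HB.instance Definition _ := [Choice of eop by <:].

Lemma colfinP (T : eop) : colfin (opf T).
Proof. exact/asboolP/eop_colfin. Qed.

Definition mk_eop T (hT : colfin T) : eop := Eop (asboolT hT).

Lemma eopP (S T : eop) : (forall p q m, S p q m = T p q m) -> S = T.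
Proof.
by move=> h; apply: val_inj; apply: sopP => p q; apply/funext => m; exact: h.
Qed.

Lemma colfin0 : colfin 0.
Proof. by move=> q m; apply: (@sub_finite_set _ _ set0) => // p /=; rewrite eqxx. Qed.

Lemma colfinD S T : colfin S -> colfin T -> colfin (S + T).
Proof. by move=> hS hT q; apply: lfD. Qed.

Lemma colfinN T : colfin T -> colfin (- T).
Proof. by move=> hT q; apply: lfN. Qed.

Lemma colfinZ c T : colfin T -> colfin (sop_scale c T).
Proof. by move=> hT q; apply: lfZ. Qed.

Lemma colfin1 : colfin (@sop1 R).
Proof. by rewrite sop1_dg; exact: colfin_dg. Qed.

Definition eop0 := mk_eop colfin0.
Definition eop1 := mk_eop colfin1.
Definition eopD (S T : eop) := mk_eop (colfinD (colfinP S) (colfinP T)).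
Definition eopN (T : eop) := mk_eop (colfinN (colfinP T)).
Definition eopM (S T : eop) := mk_eop (colfin_mul (colfinP S) (colfinP T)).
Definition eopZ c (T : eop) := mk_eop (colfinZ c (colfinP T)).

Lemma eopDA : associative eopD.
Proof. by move=> S T U; apply: val_inj; apply: addrA. Qed.
Lemma eopDC : commutative eopD.
Proof. by move=> S T; apply: val_inj; apply: addrC. Qed.
Lemma eop0D : left_id eop0 eopD.
Proof. by move=> S; apply: val_inj; apply: add0r. Qed.
Lemma eopND : left_inverse eop0 eopN eopD.
Proof. by move=> S; apply: val_inj; apply: addNr. Qed.
HB.instance Definition _ := GRing.isZmodule.Build eop eopDA eopDC eop0D eopND.

Lemma eopMA : associative eopM.
Proof. by move=> S T U; apply: val_inj; apply: sop_mulA; exact: colfinP. Qed.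
Lemma eop1M : left_id eop1 eopM.
Proof. by move=> S; apply: val_inj; apply: sop_mul1l. Qed.
Lemma eopM1 : right_id eop1 eopM.
Proof. by move=> S; apply: val_inj; apply: sop_mul1r. Qed.
Lemma eopMDl : left_distributive eopM +%R.
Proof. by move=> S T U; apply: val_inj; apply: sop_mulDl; exact: colfinP. Qed.
Lemma eopMDr : right_distributive eopM +%R.
Proof. by move=> S T U; apply: val_inj; apply: sop_mulDr; exact: colfinP. Qed.
Lemma eop1_neq0 : eop1 != 0.
Proof.
apply/eqP => h; have /eqP := oner_neq0 K; apply.
transitivity (eop1 (0, false) (0, false) smono1); last by rewrite h.
have -> : opf eop1 = @sop1 R by [].
by rewrite /sop1 !eqxx.
Qed.
HB.instance Definition _ :=
  GRing.Zmodule_isNzRing.Build eop eopMA eop1M eopM1 eopMDl eopMDr eop1_neq0.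

Lemma eopZA c d (T : eop) : eopZ c (eopZ d T) = eopZ (c * d) T.
Proof. by apply: val_inj; apply: sopP => p q; apply: sscaleA. Qed.
Lemma eop1Z : left_id 1 eopZ.
Proof. by move=> T; apply: val_inj; apply: sopP => p q; apply: sscale1. Qed.
Lemma eopZDr : right_distributive eopZ +%R.
Proof.
by move=> c S T; apply: eopP => p q m; apply: mulrDr.
Qed.
Lemma eopZDl (T : eop) : {morph eopZ^~ T : c d / c + d}.
Proof. by move=> c d; apply: eopP => p q m; apply: mulrDl. Qed.
HB.instance Definition _ := GRing.Zmodule_isLmodule.Build K eop eopZA eop1Z eopZDr eopZDl.

Lemma eopZAl c (S T : eop) : c *: (S * T) = (c *: S) * T.
Proof. by apply: val_inj; apply/esym/sop_mulZl/colfinP. Qed.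
HB.instance Definition _ := GRing.Lmodule_isLalgebra.Build K eop eopZAl.
Lemma eopZAr c (S T : eop) : c *: (S * T) = S * (c *: T).
Proof. by apply: val_inj; apply/esym/sop_mulZr/colfinP. Qed.
HB.instance Definition _ := GRing.Lalgebra_isAlgebra.Build K eop eopZAr.

Lemma eopDE (S T : eop) p q m : (S + T) p q m = S p q m + T p q m. Proof. by []. Qed.
Lemma eopNE (T : eop) p q m : (- T) p q m = - T p q m. Proof. by []. Qed.
Lemma eopZE c (T : eop) p q m : (c *: T) p q m = c * T p q m. Proof. by []. Qed.
Lemma eopME (S T : eop) : opf (S * T) = sop_mul (opf S) (opf T). Proof. by []. Qed.
Lemma eop1E p q m : (1 : eop) p q m = ((p == q) && (m == smono1))%:R. Proof. by []. Qed.
Lemma eop_sumE (I : Type) (s : seq I) (P : pred I) (F : I -> eop) p q m :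
  (\sum_(i <- s | P i) F i) p q m = \sum_(i <- s | P i) F i p q m.
Proof. by elim/big_rec2: _ => [//|i y z _ <-]. Qed.
Lemma eopXE (T : eop) k : opf (T ^+ k) = iter k (sop_mul (opf T)) (@sop1 R).
Proof. by elim: k => [//|k IH]; rewrite exprS iterS -IH. Qed.

End Operators.
Arguments eop R : clear implicits.

(** * Laurent polynomials in alpha_0^(1/2), with bounds on the exponents *)

Section LaurentCoefficients.
Context {R : realType}.
Local Notation C := R[i].
Local Notation K := {fraction {poly R[i]}}.
Implicit Types f g : K.

Lemma ah_neq0 : (ah : K) != 0.
Proof. by rewrite /ah tofrac_eq0 polyX_eq0. Qed.

Lemma tofrac_sum (I : Type) (s : seq I) (F : I -> {poly C}) :
  tofrac (\sum_(i <- s) F i) = \sum_(i <- s) tofrac (F i) :> K.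
Proof. exact: (big_morph _ (@tofracD _) (@tofrac0 _)). Qed.

(** The exponents of alpha_0^(1/2) lie in [-N, N). In this form closure under products is a bound on
    the size of a polynomial, and one N can serve all entries of a matrix. *)
Definition lbounded (N : nat) f : Prop :=
  exists2 P : {poly C}, (size P <= N.*2)%N & f * ah ^+ N = tofrac P.

Lemma lbounded_widen N M f : (N <= M)%N -> lbounded N f -> lbounded M f.
Proof.
move=> NM [P sP hP]; exists (P * 'X^(M - N)).
  by rewrite (leq_trans (size_polyMleq _ _)) // size_polyXn; lia.
by rewrite tofracM -hP tofracXn -mulrA -exprD subnKC.
Qed.

Lemma lbounded0 N : lbounded N 0.
Proof. by exists 0; rewrite ?size_poly0 // mul0r tofrac0. Qed.

Lemma lboundedD N f g : lbounded N f -> lbounded N g -> lbounded N (f + g).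
Proof.
move=> [P sP hP] [Q sQ hQ]; exists (P + Q); last by rewrite mulrDl hP hQ tofracD.
by rewrite (leq_trans (size_polyD _ _)) // geq_max sP.
Qed.

Lemma lboundedN N f : lbounded N f -> lbounded N (- f).
Proof. by move=> [P sP hP]; exists (- P); rewrite ?size_polyN // mulNr hP tofracN. Qed.

Lemma lbounded_sum N (I : eqType) (s : seq I) (F : I -> K) :
  (forall i, i \in s -> lbounded N (F i)) -> lbounded N (\sum_(i <- s) F i).
Proof.
move=> h; rewrite big_seq; elim/big_rec: _ => [|i x /h]; first exact: lbounded0.
exact: lboundedD.
Qed.

Lemma lboundedM N M f g : lbounded N f -> lbounded M g -> lbounded (N + M) (f * g).
Proof.
move=> [P sP hP] [Q sQ hQ]; exists (P * Q).
  by rewrite (leq_trans (size_polyMleq _ _)) // doubleD; lia.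
by rewrite exprD mulrACA hP hQ tofracM.
Qed.

(** For N = 0 the range of exponents is empty and only 0 is allowed. *)
Lemma lbounded_cst (c : C) N : (0 < N)%N -> lbounded N (Defs.cst c).
Proof.
move=> N0; apply: (@lbounded_widen 1) => //; exists (c%:P * 'X).
  by rewrite (leq_trans (size_polyMleq _ _)) // size_polyX size_polyC; case: (c != 0).
by rewrite expr1 tofracM.
Qed.

Lemma lbounded_expand N (P : {poly C}) f : (size P <= N.*2)%N -> f * ah ^+ N = tofrac P ->
  f = \sum_(k < N.*2) Defs.cst P`_k * ah ^ (k%:Z - N%:Z).
Proof.
move=> sP hP.
apply: (mulIf (expf_neq0 N ah_neq0)); rewrite hP mulr_suml.
have -> : P = \sum_(i < N.*2) P`_i *: 'X^i.
  rewrite -poly_def; apply/polyP => i; rewrite coef_poly; case: ltnP => // h.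
  by rewrite nth_default // (leq_trans sP).
rewrite tofrac_sum; apply: eq_bigr => k _.
rewrite -mul_polyC tofracM tofracXn -mulrA; congr (_ * _).
  by rewrite -poly_def; congr (tofrac _%:P); rewrite coef_poly ltn_ord.
by rewrite !exprnP -expfzDr ?ah_neq0 //; congr (_ ^ _); lia.
Qed.

Lemma lboundedP f : laurent f <-> exists N, lbounded N f.
Proof.
split=> [[N [c ->]]|[N [P sP hP]]].
  exists N; exists (\sum_(k < N.*2) (c k)%:P * 'X^k).
    rewrite (eq_bigr (fun k : 'I__ => c k *: 'X^k)) => [|k _]; last by rewrite mul_polyC.
    by rewrite -poly_def size_poly.
  rewrite mulr_suml tofrac_sum; apply: eq_bigr => k _.
  rewrite tofracM tofracXn -mulrA; congr (_ * _).
  by rewrite !exprnP -expfzDr ?ah_neq0 //; congr (_ ^ _); lia.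
by exists N, (fun k => P`_k); exact: lbounded_expand.
Qed.

Lemma laurent0 : laurent (0 : K).
Proof. by apply/lboundedP; exists 0; exact: lbounded0. Qed.

Lemma laurentD f g : laurent f -> laurent g -> laurent (f + g).
Proof.
move=> /lboundedP[N hf] /lboundedP[M hg]; apply/lboundedP; exists (N + M)%N.
apply: lboundedD.
  exact: lbounded_widen (leq_addr _ _) hf.
exact: lbounded_widen (leq_addl _ _) hg.
Qed.

Lemma laurentN f : laurent f -> laurent (- f).
Proof. by move=> /lboundedP[N hf]; apply/lboundedP; exists N; apply: lboundedN. Qed.

Lemma laurentM f g : laurent f -> laurent g -> laurent (f * g).
Proof.
move=> /lboundedP[N hf] /lboundedP[M hg]; apply/lboundedP; exists (N + M)%N.
exact: lboundedM.
Qed.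

Lemma laurent_cst (c : C) : laurent (Defs.cst c).
Proof. by apply/lboundedP; exists 1%N; apply: lbounded_cst. Qed.

Lemma laurent1 : laurent (1 : K).
Proof. by rewrite -[1](_ : Defs.cst 1 = 1) ?tofrac1 //; exact: laurent_cst. Qed.

Lemma laurent_sum (I : eqType) (s : seq I) (F : I -> K) :
  (forall i, i \in s -> laurent (F i)) -> laurent (\sum_(i <- s) F i).
Proof.
move=> h; rewrite big_seq; elim/big_rec: _ => [|i x /h]; first exact: laurent0.
exact: laurentD.
Qed.

Lemma laurent_ah (k : int) : laurent (ah ^ k : K).
Proof.
(* With N = |k| + 1 one has -N <= k < N. *)
apply/lboundedP; exists `|k|.+1, ('X^(absz (k + `|k|.+1%:Z))).
  by rewrite size_polyXn; lia.
by rewrite tofracXn !exprnP -expfzDr ?ah_neq0 //; congr (_ ^ _); lia.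
Qed.

End LaurentCoefficients.

(** * Products and substitution as operators *)

Section Substitution.
Context {R : realType}.
Local Notation C := R[i].
Local Notation K := {fraction {poly R[i]}}.
Local Open Scope classical_set_scope.
Implicit Types (u v : fser R) (S T : sop R).

Lemma lsum_inj (I J : choiceType) (h : I -> J) (F : J -> sser R) : injective h ->
  (forall j, (forall i, h i != j) -> F j = 0) -> lsum F = lsum (F \o h).
Proof.
move=> hi h0; apply/funext => m; rewrite /lsum.
rewrite -(fsbig_image (R := K) [set: I] h (fun j => F j m)); last by move=> x y _ _; exact: hi.
apply/esym/fsbig_widen => // j [_ /= hj]; rewrite h0 // => i.
by apply/eqP => ij; apply: hj; exists i.
Qed.

Lemma sop_appE T u p : sop_app T u p = lsum (fun q => sser_mul (u q) (T p q)).
Proof. by []. Qed.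

Lemma sop_app_mul S T u : colfin T -> lf u ->
  sop_app (sop_mul S T) u = sop_app S (sop_app T u).
Proof.
(* The series is viewed as an operator all of whose columns are [u], which reduces the claim to
   associativity. *)
move=> hT hu; have := @sop_mulA _ S T (fun q _ => u q) hT (fun _ => hu).
by move=> /(congr1 (fun U : sop R => U ^~ (0, false)))/esym.
Qed.

Lemma lf_sop_app T u : colfin T -> lf u -> lf (sop_app T u).
Proof. by move=> hT hu; exact: (@colfin_mul _ T (fun q _ => u q) hT (fun _ => hu) (0, false)). Qed.

Lemma fser_monE c p q : @fser_mon R c p q = if q == p then sconst c else 0.
Proof. by apply/funext => m; rewrite /fser_mon /sconst; case: (q == p). Qed.

Lemma lf_fser_mon c p : lf (@fser_mon R c p).
Proof.
move=> m; apply: (@sub_finite_set _ _ [set p]) => // q /=.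
by rewrite fser_monE; have [->//|_] := eqVneq q p; rewrite eqxx.
Qed.

Lemma sop_app_mon T c p : sop_app T (fser_mon c p) = fun q => sscale c (T q p).
Proof.
apply/funext => q; rewrite sop_appE (lsum_only (i0 := p)) /= ?fser_monE ?eqxx ?sser_mul_constl // => r rp.
by rewrite fser_monE (negPf rp) sser_mul0l.
Qed.

Lemma sop_app_mon1 T p : sop_app T (fser_mon 1 p) = T ^~ p.
Proof. by rewrite sop_app_mon; apply/funext => q; rewrite sscale1. Qed.

Lemma sop_app1 u : sop_app (@sop1 R) u = u.
Proof.
apply/funext => p; rewrite sop_appE (lsum_only (i0 := p)).
  by rewrite sop1_dg /dg eqxx sser_mul_constr sscale1.
by move=> q qp; rewrite sop1_dg /dg eq_sym (negPf qp) sser_mul0r.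
Qed.

(* the parity of the coefficients in an even series in x, phi *)
Definition evenf u : Prop := forall p, par p.2 (u p).
Definition evenop T : Prop := forall p q, par (p.2 (+) q.2) (T p q).

(* left multiplication by u, for even u *)
Definition mulop u : sop R := fun p q =>
  if q.2 then (if p.2 then u (p.1 - q.1, false) else 0) else u (p.1 - q.1, p.2).

Lemma colfin_mulop u : lf u -> colfin (mulop u).
Proof.
move=> hu q m; pose h (s : xphi) : xphi := (s.1 + q.1, true).
pose k (s : xphi) : xphi := (s.1 + q.1, s.2).
apply: (@sub_finite_set _ _ ((h @` [set p | u p m != 0]) `|` (k @` [set p | u p m != 0]))).
  move=> [a b]; rewrite /= /mulop /=; case: q.2; last first.
    by right; exists (a - q.1, b) => //; rewrite /k /= subrK.
  case: b; last by rewrite eqxx.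
  by left; exists (a - q.1, false) => //; rewrite /h /= subrK.
by rewrite finite_setU; split; apply: finite_image; exact: hu.
Qed.

Lemma mulop_app u : (mulop u)^~ (0, false) = u.
Proof. by apply/funext => -[a b]; rewrite /mulop /= subr0. Qed.

Lemma mulop1 : mulop (@fser1 R) = @sop1 R.
Proof.
apply: sopP => -[a b] [c d]; rewrite sop1_dg /dg /mulop /fser1 !fser_monE /= !xpair_eqE.
by rewrite subr_eq0; case: b d (a == c) => [] [] [].
Qed.

(** Multiplication by a series commutes with the shift by x^c, and since phi^2 = 0 a column with phi
    involves only the phi-free part of the multiplier. The cases follow the parities of row and
    column. *)
Lemma mulopM u v : sop_mul (mulop u) (mulop v) = mulop (sop_app (mulop u) v).
Proof.
apply: sopP => -[a b] [c d]; rewrite sop_mulE [RHS]/mulop /=; case: d; last first.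
  pose h (s : xphi) : xphi := (s.1 + c, s.2).
  rewrite sop_appE (lsum_inj (h := h)).
  - congr lsum; apply/funext => -[s t] /=; rewrite {1}/mulop /= addrK; congr sser_mul.
    by rewrite /mulop /= opprD addrAC addrA.
  - by move=> [s t] [s' t'] [/addIr -> ->].
  - by move=> [s t] /(_ (s - c, t)); rewrite /h /= subrK eqxx.
case: b; last first.
  rewrite (lsum_only (i0 := (a, true))); first by rewrite /mulop /= sser_mul0r.
  by move=> [s []] _; rewrite /mulop /= ?sser_mul0r ?sser_mul0l.
rewrite sop_appE; pose h (s : int) : xphi := (s + c, true); pose k (s : int) : xphi := (s, false).
rewrite (lsum_inj (h := h)).
- rewrite [RHS](lsum_inj (h := k)).
  + congr lsum; apply/funext => s /=; rewrite /mulop /= addrK; congr sser_mul.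
    by rewrite opprD addrAC addrA.
  + by move=> s t [].
  + by move=> [s []] hs; [rewrite /mulop /= sser_mul0r|have := hs s; rewrite eqxx].
- by move=> s t [/addIr].
- move=> [s []] hs; last by rewrite /mulop /= sser_mul0l.
  by have := hs (s - c); rewrite /h subrK eqxx.
Qed.

(** [fser_mul] writes the coefficients of [u] first, [sop_app] those of [v]. The coefficients in the
    phi-free part of an even [u] are even and commute; those in the phi part are odd, and moving
    them produces the same [sser_sign] as moving phi past the coefficients of [v]. *)
Lemma fser_mul_mulop u v : lf u -> evenf u -> fser_mul u v = sop_app (mulop u) v.
Proof.
move=> hu eu; apply/funext => -[a b]; rewrite sop_appE.
pose h (s : int) : xphi := (a - s, false); pose k (s : int) : xphi := (a - s, true).
have hi : injective h by move=> s t [/addrI /oppr_inj].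
have ki : injective k by move=> s t [/addrI /oppr_inj].
have hh (F : xphi -> sser R) : (forall s, F (s, true) = 0) -> lsum F = lsum (F \o h).
  move=> F0; apply: lsum_inj => // -[s []] // hs.
  by have := hs (a - s); rewrite /h subKr eqxx.
have kk (F : xphi -> sser R) : (forall s, F (s, false) = 0) -> lsum F = lsum (F \o k).
  move=> F0; apply: lsum_inj => // -[s []] // hs.
  by have := hs (a - s); rewrite /k subKr eqxx.
case: b; last first.
  rewrite hh => [|s]; last by rewrite /mulop /= sser_mul0r.
  apply/funext => m; apply: eq_fsbigr => s _ /=.
  by rewrite /mulop /= subKr sser_even_comm //; exact: (eu (_, _)).
pose F0 (q : xphi) := if q.2 then 0 else sser_mul (v q) (mulop u (a, true) q).
pose F1 (q : xphi) := if q.2 then sser_mul (v q) (mulop u (a, true) q) else 0.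
have lf0 : lf (fun q => sser_mul (v q) (mulop u (a, true) q)).
  apply: lfMr => m; pose g (s : xphi) : xphi := (a - s.1, ~~ s.2).
  apply: sub_finite_set (finite_image g (hu m)) => -[s t] /=.
  by rewrite /mulop /=; case: t => h1; [exists (a - s, false)|exists (a - s, true)];
    rewrite // /g /= subKr.
have -> : (fun q => sser_mul (v q) (mulop u (a, true) q)) = (fun q => F0 q + F1 q).
  by apply/funext => -[s []]; rewrite /F0 /F1 /= ?add0r ?addr0.
rewrite lsumD.
- rewrite (hh F0) // (kk F1) // -lsumD.
  + apply/funext => m; apply: eq_fsbigr => s _ /=; rewrite sserDE [RHS]addrC.
    rewrite /F0 /F1 /mulop /= !subKr; congr (_ + _).
      by rewrite sser_even_comm //; exact: (eu (_, _)).
    by rewrite -sser_odd_comm //; exact: (eu (_, _)).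
  + apply: lfMr => m; apply: sub_finite_set (finite_image fst (hu m)) => s /=.
    by rewrite /mulop /= subKr => hs; exists (s, true).
  + apply: lfMr => m; apply: sub_finite_set (finite_image fst (hu m)) => s /=.
    by rewrite /mulop /= subKr => hs; exists (s, false).
- move=> m; apply: sub_finite_set (lf0 m) => -[s t]; rewrite /F0 /=.
  by case: t => [|h1]; [rewrite eqxx|exact: h1].
- move=> m; apply: sub_finite_set (lf0 m) => -[s t]; rewrite /F1 /=.
  by case: t => [h1|]; [exact: h1|rewrite eqxx].
Qed.

End Substitution.

(** * Multiplicative operators are substitutions *)

Section Multiplicative.
Context {R : realType}.
Local Notation C := R[i].
Local Notation K := {fraction {poly R[i]}}.
Local Open Scope classical_set_scope.
Implicit Types (u v : fser R) (S T : sop R).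

Lemma par_lsum (I : choiceType) b (F : I -> sser R) : (forall i, par b (F i)) -> par b (lsum F).
Proof.
move=> h m; have [[i hi] _|h0] := pselect (exists i, F i m != 0); first exact: h hi.
rewrite /lsum fsbig1 ?eqxx // => i _.
by apply/eqP/negPn/negP => hi; apply: h0; exists i.
Qed.

Lemma evenop_mul S T : evenop S -> evenop T -> evenop (sop_mul S T).
Proof.
move=> hS hT p q; rewrite sop_mulE; apply: par_lsum => r.
suff <- : (r.2 (+) q.2) (+) (p.2 (+) r.2) = p.2 (+) q.2 by exact: parM.
by case: p.2; case: q.2; case: r.2.
Qed.

Lemma evenf_app T u : evenop T -> evenf u -> evenf (sop_app T u).
Proof.
move=> hT hu p; rewrite sop_appE; apply: par_lsum => r.
suff <- : r.2 (+) (p.2 (+) r.2) = p.2 by exact: parM.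
by case: p.2; case: r.2.
Qed.

Definition lau T : Prop := forall p q, laurent_sser (T p q).

Lemma laurent_lsum (I : choiceType) (F : I -> sser R) :
  (forall i, laurent_sser (F i)) -> laurent_sser (lsum F).
Proof. by move=> h m; apply: laurent_sum => i _; exact: h. Qed.

Lemma laurent_sser_mul (f g : sser R) :
  laurent_sser f -> laurent_sser g -> laurent_sser (sser_mul f g).
Proof.
move=> hf hg m; apply: laurent_sum => p _.
apply: laurentM (hg _); apply: laurentM (hf _).
by rewrite -signr_odd; case: odd; [apply: laurentN|]; exact: laurent1.
Qed.

Lemma laurent_sconst (c : K) : laurent c -> laurent_sser (sconst c).
Proof. by move=> h m; rewrite /sconst; case: (m == smono1) => //; exact: laurent0. Qed.

Lemma lau_mul S T : lau S -> lau T -> lau (sop_mul S T).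
Proof.
by move=> hS hT p q; apply: laurent_lsum => r; apply: laurent_sser_mul.
Qed.

Lemma lau_dg d : (forall q, laurent_sser (d q)) -> lau (dg d).
Proof. by move=> h p q m; rewrite /dg; case: (p == q); [exact: h|exact: laurent0]. Qed.

(* The left linear map T preserves products: T (u w) = (T u) (T w), as an
   equality of operators in w. *)
Definition multop T : Prop :=
  [/\ colfin T, evenop T, T^~ (0, false) = @fser1 R &
      forall u, lf u -> evenf u -> sop_mul T (mulop u) = sop_mul (mulop (sop_app T u)) T].

Lemma multop_mul S T : multop S -> multop T -> multop (sop_mul S T).
Proof.
move=> [cS eS S1 mS] [cT eT T1 mT]; split.
- exact: colfin_mul.
- exact: evenop_mul.
- rewrite -[LHS]/(sop_app S (T^~ (0, false))) T1 /fser1 sop_app_mon1; exact: S1.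
- move=> u hu eu; have hTu := lf_sop_app cT hu; have eTu := evenf_app eT eu.
  have cu : colfin (mulop u) by exact: colfin_mulop.
  have cTu : colfin (mulop (sop_app T u)) by exact: colfin_mulop.
  rewrite -(sop_mulA S cT cu) (mT u hu eu) (sop_mulA S cTu cT) (mS _ hTu eTu).
  by rewrite -(sop_mulA _ cS cT) (sop_app_mul S cT hu).
Qed.

Lemma mulop_monx n p q : mulop (@fser_mon R 1 (n, false)) p q =
  if p == (q.1 + n, q.2) then sconst 1 else 0.
Proof.
case: p q => a b [c d]; rewrite /mulop /= !fser_monE !xpair_eqE /=.
by rewrite !subr_eq [n + c]addrC; case: b d (a == c + n) => [] [] [].
Qed.

Lemma sop_mul_monx T n p q : sop_mul T (mulop (fser_mon 1 (n, false))) p q = T p (q.1 + n, q.2).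
Proof.
rewrite sop_mulE (lsum_only (i0 := (q.1 + n, q.2))) /= ?mulop_monx ?eqxx.
  by rewrite sser_mul_constl sscale1.
by move=> r /negPf rn; rewrite mulop_monx rn sser_mul0l.
Qed.

Lemma evenf_mon c n : evenf (@fser_mon R c (n, false)).
Proof.
move=> p; rewrite fser_monE; have [->|_] := eqVneq p (n, false); last exact: par0.
exact: par_const.
Qed.

Section SubstMult.
Context (T : sop R) (hT : multop T) (lT : lau T).

Let cT : colfin T. Proof. by case: hT. Qed.
Let eT q : evenf (T^~ (q, false)).
Proof. by case: hT => _ h _ _ p; have := h p (q, false); rewrite addbF. Qed.

Lemma multop_monx n q : sop_app (mulop (T^~ (n, false))) (T^~ q) = T^~ (q.1 + n, q.2).
Proof.
case: hT => _ _ _ /(_ (fser_mon 1 (n, false)) (@lf_fser_mon _ _ _) (@evenf_mon _ _)).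
rewrite sop_app_mon1 => h; apply/funext => p.
have /(congr1 (fun U : sop R => U p q)) := h.
by rewrite sop_mul_monx => /esym.
Qed.

Lemma multop_fser_mul n q : fser_mul (T^~ (n, false)) (T^~ q) = T^~ (q.1 + n, q.2).
Proof. by rewrite fser_mul_mulop ?multop_monx //; exact: cT. Qed.

Lemma multop_in_fpoly q : in_fpoly (T^~ q).
Proof. by move=> m; split; [exact: cT|move=> p; exact: lT]. Qed.

(* The inverse chosen by [fser_inv] is unique, because left multiplication by
   T x^{-1} undoes left multiplication by T x. *)
Lemma multop_fser_inv : fser_inv (T^~ (1, false)) = T^~ (-1, false).
Proof.
case: hT => _ _ T1 _; apply: xget_unique.
  split; first exact: multop_in_fpoly.
    by rewrite multop_fser_mul /= addNr.
  by rewrite multop_fser_mul /= addrN.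
move=> v [hv uv _]; have lv : lf v by move=> m; case: (hv m).
have uu : lf (T^~ (1, false)) by exact: cT.
move: uv; rewrite fser_mul_mulop // => uv.
have <- : sop_app (mulop (T^~ (-1, false))) (@fser1 R) = T^~ (-1, false).
  by rewrite /fser1 sop_app_mon1 mulop_app.
have cu : colfin (mulop (T^~ (1, false))) by exact: colfin_mulop.
rewrite -uv -(sop_app_mul _ cu lv) mulopM multop_monx addrN T1 mulop1.
by rewrite sop_app1.
Qed.

Lemma multop_fser_pow n : fser_pow (T^~ (1, false)) n = T^~ (n, false).
Proof.
case: hT => _ _ T1 _.
have it (e : int) k : iter k (fser_mul (T^~ (e, false))) (@fser1 R) = T^~ (e *+ k, false).
  by elim: k => [//|k IH]; rewrite iterS IH multop_fser_mul /= mulrSr.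
case: n => k; first by rewrite /fser_pow it natz.
by rewrite /fser_pow multop_fser_inv it mulNrn natz NegzE.
Qed.

(** Multiplicativity makes the factor that [subst] attaches to x^n phi^b equal to the column of [T]
    at (n, b); negative n go through [multop_fser_inv]. *)
Lemma multop_subst q : fser_mul (fser_pow (T^~ (1, false)) q.1)
  (if q.2 then T^~ (0, true) else @fser1 R) = T^~ q.
Proof.
case: hT => _ _ T1 _; rewrite multop_fser_pow; case: q => n [] /=.
  by rewrite multop_fser_mul /= add0r.
by rewrite -T1 multop_fser_mul /= add0r.
Qed.

Lemma substE f : subst f (T^~ (1, false), T^~ (0, true)) = sop_app T f.
Proof.
apply/funext => p; apply/funext => m; rewrite /subst /sop_app.
by apply: eq_fsbigr => q _ /=; rewrite multop_subst.
Qed.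

Lemma fpair_app_id : fpair_app T (@id_pair R) = (T^~ (1, false), T^~ (0, true)).
Proof. by rewrite /fpair_app /= !sop_app_mon1. Qed.

Lemma compE F : Defs.comp F (fpair_app T (@id_pair R)) = fpair_app T F.
Proof. by rewrite fpair_app_id /Defs.comp !substE. Qed.

End SubstMult.

Lemma multop_inj S T : multop S -> lau S -> multop T -> lau T ->
  fpair_app S (@id_pair R) = fpair_app T (@id_pair R) -> S = T.
Proof.
move=> mS lS mT lT; rewrite !fpair_app_id => -[h1 h2].
suff h q : S^~ q = T^~ q by apply: sopP => p q; exact: (congr1 (fun u : fser R => u p) (h q)).
by rewrite -[LHS](multop_subst mS lS) -[RHS](multop_subst mT lT) h1 h2.
Qed.

End Multiplicative.

(** * Exponentials *)

Section Exponential.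
Context {R : realType}.
Local Notation K := {fraction {poly R[i]}}.
Implicit Types (X Y T : eop R) (u : fser R) (a b c : nat -> eop R).

Lemma natK_neq0 n : (0 < n)%N -> (n%:R : K) != 0.
Proof.
move=> n0; have -> : (n%:R : K) = tofrac (n%:R)%:P by rewrite polyC_natr tofracMn tofrac1.
by rewrite tofrac_eq0 polyC_eq0 pnatr_eq0 -lt0n.
Qed.

(** The degree filtration. Orders add under products, and equalities are proved modulo order d for
    every d, as in [eop_ord_eq]. *)
Definition ord (k : nat) X : Prop := forall m, (mdeg m < k)%N -> forall p q, X p q m = 0.

Lemma ord0 X : ord 0 X.
Proof. by []. Qed.

Lemma ord_zero k : ord k 0.
Proof. by []. Qed.

Lemma ord_le k l X : (k <= l)%N -> ord l X -> ord k X.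
Proof. by move=> kl h m mk; apply: h; apply: leq_trans kl. Qed.

Lemma ordD k X Y : ord k X -> ord k Y -> ord k (X + Y).
Proof. by move=> hX hY m mk p q; rewrite eopDE hX // hY // addr0. Qed.

Lemma ordN k X : ord k X -> ord k (- X).
Proof. by move=> hX m mk p q; rewrite eopNE hX // oppr0. Qed.

Lemma ordB k X Y : ord k X -> ord k Y -> ord k (X - Y).
Proof. by move=> hX hY; apply: ordD => //; apply: ordN. Qed.

Lemma ordZ k z X : ord k X -> ord k (z *: X).
Proof. by move=> hX m mk p q; rewrite eopZE hX // mulr0. Qed.

Lemma ord_sum k (I : Type) (s : seq I) (P : pred I) (F : I -> eop R) :
  (forall i, P i -> ord k (F i)) -> ord k (\sum_(i <- s | P i) F i).
Proof.
by move=> h; elim/big_rec: _ => [|i x /h]; [exact: ord_zero|exact: ordD].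
Qed.

Lemma ordM k l X Y : ord k X -> ord l Y -> ord (k + l) (X * Y).
Proof.
move=> hX hY m mk p q; rewrite eopME sop_mulE.
apply: fsbig1 => r _; apply/eqP/negPn/negP => /sser_mul_neq0[x [y [/mdegM xy Yx Xy]]].
have hx : (l <= mdeg x)%N by rewrite leqNgt; apply/negP => /hY h; rewrite h eqxx in Yx.
have hy : (k <= mdeg y)%N by rewrite leqNgt; apply/negP => /hX h; rewrite h eqxx in Xy.
by move: mk; rewrite xy ltnNge addnC leq_add.
Qed.

Lemma ordMr k X Y : ord k X -> ord k (X * Y).
Proof. by move=> h; apply: (@ord_le k (k + 0)); [rewrite addn0|exact: ordM]. Qed.

Lemma ordMl k X Y : ord k Y -> ord k (X * Y).
Proof. by move=> h; apply: (@ord_le k (0 + k)) => //; exact: ordM. Qed.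

Lemma ordX k X : ord 1 X -> ord k (X ^+ k).
Proof.
by move=> h; elim: k => [|k IH]; [exact: ord0|rewrite exprS -add1n; exact: ordM].
Qed.

Lemma eop_ord_eq X Y : (forall d, ord d (X - Y)) -> X = Y.
Proof.
move=> h; apply/eqP; rewrite -subr_eq0; apply/eqP; apply: eopP => p q m.
exact: (h (mdeg m).+1 m (ltnSn _)).
Qed.

Lemma ord_subM d X Y X' Y' : ord d (X - X') -> ord d (Y - Y') -> ord d (X * Y - X' * Y').
Proof.
move=> hX hY; have -> : X * Y - X' * Y' = (X - X') * Y + X' * (Y - Y').
  by rewrite mulrBl mulrBr addrA subrK.
by apply: ordD; [exact: ordMr|exact: ordMl].
Qed.

Definition exps_trunc d a : eop R := \sum_(k < d.+1) (k`!%:R)^-1 *: a k.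

(** Cutting the sum at the degree of m loses nothing when [a k] has order k, and it makes the result
    column-finite by construction. *)
Definition exps_op a : sop R := fun p q m =>
  \sum_(k < (mdeg m).+1) (k`!%:R)^-1 * a k p q m.

Lemma exps_opE a p q m : exps_op a p q m = exps_trunc (mdeg m) a p q m.
Proof. by rewrite eop_sumE. Qed.

Lemma colfin_exps a : colfin (exps_op a).
Proof.
move=> q m; have := colfinP (exps_trunc (mdeg m) a) q m.
by apply: sub_finite_set => p /=; rewrite exps_opE.
Qed.

(* the sum of the a k / k!; meant for families such that a k has order k *)
Definition exps a : eop R := mk_eop (colfin_exps a).

Lemma expsE a p q m : exps a p q m = exps_trunc (mdeg m) a p q m.
Proof. exact: exps_opE. Qed.

Definition filt a : Prop := forall k, ord k (a k).

Lemma exps_truncP d a : filt a -> ord d.+1 (exps a - exps_trunc d a).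
Proof.
move=> fa m md p q; rewrite eopDE eopNE expsE /exps_trunc !eop_sumE.
rewrite -!(big_mkord xpredT (fun k => ((k`!%:R)^-1 *: a k) p q m)).
rewrite (big_cat_nat (n := (mdeg m).+1) (p := d.+1)) //= opprD addrA subrr add0r.
have -> : \sum_((mdeg m).+1 <= k < d.+1) ((k`!%:R)^-1 *: a k) p q m = 0; last exact: oppr0.
rewrite big_nat_cond; apply: big1 => k /andP[/andP[mk _] _].
have -> : ((k`!%:R)^-1 *: a k) p q m = (k`!%:R)^-1 * a k p q m by exact: eopZE.
by rewrite (fa k m mk) mulr0.
Qed.

(** The truncations modulo each order determine the sum, so identities between infinite sums reduce
    to finite ones. *)
Lemma exps_uniq a X : filt a -> (forall d, ord d.+1 (X - exps_trunc d a)) -> X = exps a.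
Proof.
move=> fa h; apply: eop_ord_eq => -[//|d].
rewrite -(subrK (exps_trunc d a) X) -addrA; apply: ordD; first exact: h.
by rewrite -opprB; apply/ordN/exps_truncP.
Qed.

Lemma exps_mulr a Y : filt a -> exps (fun k => a k * Y) = exps a * Y.
Proof.
move=> fa; apply/esym/exps_uniq => [k|d].
  exact: ordMr.
have -> : exps_trunc d (fun k => a k * Y) = exps_trunc d a * Y.
  by rewrite /exps_trunc mulr_suml; apply: eq_bigr => k _; rewrite -scalerAl.
by rewrite -mulrBl; apply/ordMr/exps_truncP.
Qed.

(** Dividing by the factorials turns the binomial convolution into a plain Cauchy product. Truncated
    at d, the two sides differ only by products of a term i and a term j with i + j > d, which have
    order above d. It serves both exp(T + S) and the Leibniz formula. *)
Lemma exps_cauchy a b c : filt a -> filt b ->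
  (forall n, c n = \sum_(i < n.+1) (a i * b (n - i)%N) *+ 'C(n, i)) ->
  exps c = exps a * exps b.
Proof.
move=> fa fb hc; pose a' i := (i`!%:R)^-1 *: a i : eop R; pose b' i := (i`!%:R)^-1 *: b i : eop R.
have fab i j : ord (i + j) (a' i * b' j) by apply: ordM; apply: ordZ; [exact: fa|exact: fb].
have hc' n : (n`!%:R)^-1 *: c n = \sum_(i < n.+1) a' i * b' (n - i)%N :> eop R.
  rewrite hc scaler_sumr; apply: eq_bigr => i _.
  rewrite /a' /b' -scalerAl -scalerAr scalerA -scaler_nat scalerA; congr (_ *: _).
  have hi : (i <= n)%N by rewrite -ltnS.
  have b0 : ('C(n, i)%:R : K) != 0 by apply: natK_neq0; rewrite bin_gt0.
  by rewrite -(bin_fact hi) !natrM invfM mulrAC (mulVf b0) mul1r invfM.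
apply/esym/exps_uniq => [n|d].
  rewrite hc; apply: ord_sum => i _; rewrite -scaler_nat; apply: ordZ.
  by have := ordM (fa i) (fb (n - i)%N); rewrite subnKC // -ltnS.
have h : ord d.+1 (exps_trunc d a * exps_trunc d b - exps_trunc d c); last first.
  rewrite -(subrK (exps_trunc d a * exps_trunc d b) (exps a * exps b)) -addrA.
  by apply: ordD h; apply: ord_subM; exact: exps_truncP.
(* The product of the truncated sums is the value at 1 of a product of polynomials. *)
pose P := \poly_(i < d.+1) a' i; pose Q := \poly_(i < d.+1) b' i.
have ev (F : nat -> eop R) : (\poly_(i < d.+1) F i).[1] = \sum_(i < d.+1) F i.
  by rewrite horner_poly; apply: eq_bigr => i _; rewrite expr1n mulr1.
have -> : exps_trunc d a * exps_trunc d b = (P * Q).[1].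
  rewrite hornerM_comm; last by rewrite /comm_poly mulr1 mul1r.
  by rewrite (ev a') (ev b').
have sPQ : (size (P * Q)%R <= d.+1 + d.+1)%N.
  apply: leq_trans (size_polyMleq _ _) _; rewrite (leq_trans (leq_pred _)) //.
  by rewrite leq_add ?size_poly.
rewrite (horner_coef_wide _ sPQ) (eq_bigr (fun i : 'I__ => (P * Q)`_i)); last first.
  by move=> i _; rewrite expr1n mulr1.
rewrite big_split_ord /= /exps_trunc.
rewrite (eq_bigr (fun i : 'I_d.+1 => (i`!%:R)^-1 *: c i)); last first.
  move=> n _; rewrite coefM hc'; apply: eq_bigr => i _; rewrite !coef_poly.
  rewrite (leq_ltn_trans (leq_subr _ _) (ltn_ord n)).
  by rewrite (leq_ltn_trans _ (ltn_ord n)) // -ltnS.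
rewrite addrAC subrr add0r; apply: ord_sum => n _; rewrite coefM.
apply: ord_sum => i _; rewrite !coef_poly; case: ifP => _; last by rewrite mul0r; exact: ord_zero.
case: ifP => _; last by rewrite mulr0; exact: ord_zero.
apply: ord_le (fab _ _); rewrite subnKC; first exact: leq_addr.
by rewrite -ltnS.
Qed.

End Exponential.

(** * Exponentials of operators and of derivations *)

Section OperatorExponential.
Context {R : realType}.
Local Notation K := {fraction {poly R[i]}}.
Local Open Scope classical_set_scope.
Implicit Types (X Y T S : eop R) (u : fser R).

Definition expe T : eop R := exps (fun k => T ^+ k).

Lemma filtX T : ord 1 T -> filt (fun k => T ^+ k).
Proof. by move=> h k; apply: ordX. Qed.

Lemma sop_exp_expe T : ord 1 T -> sop_exp (opf T) = opf (expe T).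
Proof.
move=> oT; apply: sopP => p q; apply/funext => m; rewrite expsE eop_sumE.
rewrite (@fsbig_ord _ 0 _ (mdeg m).+1 (fun k => ((k`!%:R)^-1 *: T ^+ k) p q m)).
rewrite /sop_exp (eq_fsbigr (fun k => ((k`!%:R)^-1 *: T ^+ k) p q m)); last first.
  by move=> k _; rewrite -eopXE.
apply/esym/fsbig_widen => // k [_ /= /negP]; rewrite -leqNgt => mk.
have e : ((k`!%:R)^-1 *: T ^+ k) p q m = 0 by rewrite eopZE (ordX oT mk) mulr0.
exact: e.
Qed.

Lemma expeD T S : ord 1 T -> ord 1 S -> T * S = S * T -> expe (T + S) = expe T * expe S.
Proof.
move=> hT hS cTS; apply: exps_cauchy => [| |n]; [exact: filtX|exact: filtX|].
by rewrite addrC exprDn_comm; [|exact: esym]; apply: eq_bigr => i _; rewrite commrX //; apply/commr_sym/commrX.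
Qed.

Lemma expe0 : expe (0 : eop R) = 1.
Proof.
apply: eopP => p q m; rewrite expsE eop_sumE big_ord_recl big1 => [|k _].
  by rewrite addr0 eopZE fact0 invr1 mul1r expr0.
by rewrite eopZE exprS mul0r mulr0.
Qed.

Lemma expeN T : ord 1 T -> expe T * expe (- T) = 1.
Proof.
move=> hT; rewrite -expeD ?subrr ?expe0 //; first exact: ordN.
by rewrite mulrN mulNr.
Qed.

Lemma expeNl T : ord 1 T -> expe (- T) * expe T = 1.
Proof. by move=> hT; rewrite -[in X in _ * X](opprK T) expeN //; exact: ordN. Qed.

Lemma evenop1 : evenop (@sop1 R).
Proof.
move=> p q; rewrite sop1_dg /dg; have [->|_] := eqVneq p q; last exact: par0.
by rewrite addbb; exact: par_const.
Qed.

Lemma evenopX T k : evenop (opf T) -> evenop (opf (T ^+ k)).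
Proof.
by move=> hT; elim: k => [|k IH]; [exact: evenop1|rewrite exprS; exact: evenop_mul].
Qed.

Lemma evenop_expe T : evenop (opf T) -> evenop (opf (expe T)).
Proof.
move=> hT p q m; rewrite expsE eop_sumE.
have [[k hk] _|h0] := pselect (exists k : 'I_(mdeg m).+1, (T ^+ k) p q m != 0).
  exact: evenopX hk.
rewrite big1 ?eqxx // => k _; rewrite eopZE.
have [->|hk] := eqVneq ((T ^+ k) p q m) 0; first by rewrite mulr0.
by case: h0; exists k.
Qed.

Lemma lau1 : lau (@sop1 R).
Proof. by rewrite sop1_dg; apply: lau_dg => q; apply: laurent_sconst; exact: laurent1. Qed.

Lemma lauX T k : lau (opf T) -> lau (opf (T ^+ k)).
Proof. by move=> hT; elim: k => [|k IH]; [exact: lau1|rewrite exprS; exact: lau_mul]. Qed.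

Lemma cst_invf n : Defs.cst ((n`!%:R)^-1) = (n`!%:R)^-1 :> K.
Proof.
have f0 : (n`!%:R : R[i]) != 0 by rewrite pnatr_eq0 -lt0n fact_gt0.
apply: (mulfI (natK_neq0 (fact_gt0 n))); rewrite divff ?natK_neq0 ?fact_gt0 //.
have -> : (n`!%:R : K) = Defs.cst (n`!%:R) by rewrite /Defs.cst polyC_natr tofracMn tofrac1.
by rewrite /Defs.cst -tofracM -polyCM divff ?tofrac1.
Qed.

Lemma laurent_invf n : laurent ((n`!%:R)^-1 : K).
Proof. by rewrite -cst_invf; exact: laurent_cst. Qed.

Lemma lau_expe T : lau (opf T) -> lau (opf (expe T)).
Proof.
move=> hT p q m; rewrite expsE eop_sumE; apply: laurent_sum => k _.
rewrite eopZE; apply: laurentM; [exact: laurent_invf|exact: lauX].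
Qed.

(** The Leibniz rule T(u w) = (T u) w + u (T w), as an identity of operators in w; for even T and u
    it carries no sign. *)
Definition derop (T : sop R) : Prop := forall u, lf u -> evenf u ->
  sop_mul T (mulop u) = mulop (sop_app T u) + sop_mul (mulop u) T.

(** With [a i] the multiplication by T^i u, the hypothesis says that the commutator of [T] and [a i]
    is [a i.+1]; the conclusion is the Leibniz formula for T^n, by Pascal's rule. *)
Lemma leibniz T (a : nat -> eop R) : (forall i, T * a i = a i.+1 + a i * T) ->
  forall n, T ^+ n * a 0%N = \sum_(i < n.+1) (a i * T ^+ (n - i)) *+ 'C(n, i).
Proof.
move=> h; elim=> [|n IH]; first by rewrite big_ord_recl big_ord0 addr0 mul1r mulr1.
rewrite exprS -mulrA IH mulr_sumr.
rewrite (eq_bigr (fun i : 'I_n.+1 =>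
  (a i.+1 * T ^+ (n - i)) *+ 'C(n, i) + (a i * T ^+ (n.+1 - i)) *+ 'C(n, i))).
  rewrite big_split /= [RHS]big_ord_recl /= bin0 subn0.
  under [in RHS]eq_bigr => i _ do rewrite /bump /= add1n binS mulrnDr subSS.
  rewrite big_split /= addrCA [in RHS]addrCA addrA [in RHS]addrC; congr (_ + _).
  rewrite big_ord_recl bin0 subn0 [in RHS]big_ord_recr /= bin_small // mulr0n addr0.
  by congr (_ + _); apply: eq_bigr => i _; rewrite /bump /= add1n.
move=> i _; rewrite -mulrnAr mulrA h mulrDl mulrnAr; congr (_ + _).
by rewrite mulrnAr subSn -1?ltnS // exprS mulrA.
Qed.

(** The Leibniz formula for T^n is a binomial convolution, so [exps_cauchy] sums it to a product of
    two exponential sums: the exponential of a derivation is multiplicative. *)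
Lemma derop_expe T u : ord 1 T -> derop (opf T) -> evenop (opf T) -> lf u -> evenf u ->
  sop_mul (opf (expe T)) (mulop u) = sop_mul (mulop (sop_app (opf (expe T)) u)) (opf (expe T)).
Proof.
move=> oT dT eT hu eu.
have hk k : lf (sop_app (opf (T ^+ k)) u) by exact: lf_sop_app (colfinP _) hu.
pose a k : eop R := mk_eop (colfin_mulop (hk k)).
(* The series [u] repeated in every column, so that statements in the ring [eop] apply to it. *)
pose U : eop R := @mk_eop R (fun q _ => u q) (fun _ => hu).
have a0 : opf (a 0%N) = mulop u.
  by congr mulop; exact: sop_app1.
have fa : filt a.
  move=> k m mk p q; rewrite /a /= /mulop.
  have h0 p' : sop_app (opf (T ^+ k)) u p' m = 0.
    by have := @ordMr _ k _ U (@ordX _ k T oT) m mk p' (0, false); rewrite eopME.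
  by case: q.2 p.2 => [] []; rewrite ?h0.
have hT i : T * a i = a i.+1 + a i * T.
  have eTi : evenf (sop_app (opf (T ^+ i)) u) by apply: evenf_app eu; exact: evenopX.
  apply: val_inj; rewrite [LHS](dT _ (hk i) eTi).
  by rewrite [in RHS]/= /a /= exprS -(sop_app_mul _ (colfinP (T ^+ i)) hu).
have h : expe T * a 0%N = exps a * expe T.
  by rewrite -(exps_cauchy fa (filtX oT) (leibniz hT)) (exps_mulr _ (filtX oT)).
transitivity (opf (expe T * a 0%N)); first by rewrite (eopME (expe T)) a0.
(* [mulop] is linear in the series, so the multiplications by T^k u / k! sum to the multiplication
   by exp(T) u. *)
suff ea : opf (exps a) = mulop (sop_app (opf (expe T)) u) by rewrite h (eopME (exps a)) ea.
apply: sopP => p q; apply/funext => m; rewrite expsE eop_sumE.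
have key p' : sop_app (opf (expe T)) u p' m =
    \sum_(i < (mdeg m).+1) (i`!%:R)^-1 * sop_app (opf (T ^+ i)) u p' m.
  have -> : sop_app (opf (expe T)) u p' m = (expe T * U) p' (0, false) m by [].
  by rewrite -(exps_mulr _ (filtX oT)) expsE eop_sumE; apply: eq_bigr => i _; rewrite eopZE.
transitivity (\sum_(i < (mdeg m).+1) (i`!%:R)^-1 * mulop (sop_app (opf (T ^+ i)) u) p q m).
  by apply: eq_bigr => i _; rewrite eopZE.
rewrite /mulop; case: q.2; last by rewrite key.
case: p.2; first by rewrite key.
by rewrite big1 // => i _; rewrite mulr0.
Qed.

Lemma expe_col0 T q : ord 1 T -> opf T ^~ q = 0 -> opf (expe T) ^~ q = @sop1 R ^~ q.
Proof.
move=> oT T0; have h k p : (T ^+ k.+1) p q = 0.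
  elim: k p => [|k IH] p; first by rewrite expr1; exact: (congr1 (fun u : fser R => u p) T0).
  rewrite exprS eopME sop_mulE (lsum_only (i0 := q)) => [|r _]; by rewrite IH sser_mul0l.
apply/funext => p; apply/funext => m; rewrite expsE eop_sumE big_ord_recl big1 => [|k _].
  by rewrite addr0 eopZE fact0 invr1 mul1r expr0.
by rewrite eopZE h mulr0.
Qed.

Lemma multop_expe T : ord 1 T -> derop (opf T) -> evenop (opf T) ->
  opf T ^~ (0, false) = 0 -> multop (opf (expe T)).
Proof.
move=> oT dT eT T0; split.
- exact: colfinP.
- exact: evenop_expe.
- rewrite (expe_col0 oT T0); apply/funext => p; rewrite sop1_dg /dg /fser1 fser_monE.
  by case: (p == _).
- by move=> u; exact: derop_expe.
Qed.

End OperatorExponential.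

(** * Vector fields *)

Section VectorFields.
Context {R : realType}.
Local Notation C := R[i].
Local Notation K := {fraction {poly R[i]}}.
Local Open Scope classical_set_scope.
Implicit Types (e o : int -> sser R) (u : fser R).

(* the matrix of \sum_j (e j L_j + o j G_{j-1/2}) *)
Definition vf e o : sop R := fun p q =>
  let d := p.1 - q.1 in
  if q.2 then
    if p.2 then sscale (- (q.1%:~R + (d + 1)%:~R / 2)) (e d) else - o d
  else if p.2 then sscale q.1%:~R (o (d + 1)) else sscale (- q.1%:~R) (e d).

Lemma colfin_vf e o : lf e -> lf o -> colfin (vf e o).
Proof.
move=> he ho q m; pose h b (j : int) : xphi := (j + q.1, b).
pose h' (j : int) : xphi := (j - 1 + q.1, true).
apply: (@sub_finite_set _ _ ((h true @` [set j | e j m != 0]) `|` (h false @` [set j | e j m != 0])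
  `|` ((h false @` [set j | o j m != 0]) `|` (h' @` [set j | o j m != 0])))); last first.
  by rewrite !finite_setU; split; split; apply: finite_image; [exact: he|exact: he|exact: ho|exact: ho].
move=> [a b]; rewrite /vf /=; case: q.2; case: b.
- rewrite /sscale mulf_eq0 negb_or => /andP[_ hj]; left; left.
  by exists (a - q.1) => //; rewrite /h subrK.
- rewrite sserNE oppr_eq0 => hj; right; left.
  by exists (a - q.1) => //; rewrite /h subrK.
- rewrite /sscale mulf_eq0 negb_or => /andP[_ hj]; right; right.
  by exists (a - q.1 + 1) => //; rewrite /h' addrK subrK.
- rewrite /sscale mulf_eq0 negb_or => /andP[_ hj]; left; right.
  by exists (a - q.1) => //; rewrite /h subrK.
Qed.

Lemma evenop_vf e o : (forall j, par false (e j)) -> (forall j, par true (o j)) ->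
  evenop (vf e o).
Proof.
move=> he ho [a []] [b []]; rewrite /vf /=.
- exact/parZ/he.
- exact/parZ/ho.
- exact/parN/ho.
- exact/parZ/he.
Qed.

Lemma cst0 : Defs.cst (0 : C) = 0. Proof. exact: tofrac0. Qed.
Lemma cst1 : Defs.cst (1 : C) = 1. Proof. exact: tofrac1. Qed.
Lemma cstD (x y : C) : Defs.cst (x + y) = Defs.cst x + Defs.cst y.
Proof. by rewrite /Defs.cst polyCD tofracD. Qed.
Lemma cstN (x : C) : Defs.cst (- x) = - Defs.cst x.
Proof. by rewrite /Defs.cst polyCN tofracN. Qed.
Lemma cstM (x y : C) : Defs.cst (x * y) = Defs.cst x * Defs.cst y.
Proof. by rewrite /Defs.cst polyCM tofracM. Qed.
Lemma cst_nat n : Defs.cst (n%:R : C) = n%:R.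
Proof. by rewrite /Defs.cst polyC_natr tofracMn tofrac1. Qed.
Lemma cst_int (n : int) : Defs.cst (n%:~R : C) = n%:~R.
Proof. by case: n => n; rewrite ?NegzE ?mulrNz ?cstN -!pmulrn cst_nat. Qed.
Lemma cstV2 : Defs.cst (2^-1 : C) = 2^-1.
Proof.
apply: (mulfI (natK_neq0 (isT : 0 < 2)%N)); rewrite divff ?natK_neq0 //.
by rewrite -(cst_nat 2) -cstM divff ?cst1 // pnatr_eq0.
Qed.

Lemma entryL (j : int) (p q : xphi) : entry (@L R j) p q =
  if (p.1 - q.1 == j) && (p.2 == q.2)
  then - (q.1%:~R + (if q.2 then (j + 1)%:~R / 2 else 0)) else 0.
Proof.
case: p q => a b [c d] /=; rewrite /entry /L /mul_x /d_x /mul_phi /d_phi /= !xpair_eqE.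
have -> : (a - (j + 1) + 1 == c) = (a - c == j) by lia.
have -> : (a - j == c) = (a - c == j) by lia.
have [<-|_] := eqVneq (a - c) j; last by rewrite /= !mulr0 if_same mulr0 addr0 oppr0 cst0.
have -> : a - (a - c + 1) + 1 = c by lia.
case: b d => [] [] /=; rewrite ?mulr0 ?mulr1 ?addr0 ?oppr0 ?cst0 //.
  by rewrite cstN cstD cstM cstV2 !cst_int.
by rewrite cstN cst_int.
Qed.

(** The term phi d/dx lowers the exponent of x by one and the term d/dphi does not, hence two
    different shifts in the matrix. *)
Lemma entryG (j : int) (p q : xphi) : entry (@G R j) p q =
  if q.2 then if ~~ p.2 && (p.1 - q.1 == j) then -1 else 0
  else if p.2 && (p.1 - q.1 + 1 == j) then q.1%:~R else 0.
Proof.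
case: p q => a b [c d] /=; rewrite /entry /G /mul_x /d_x /mul_phi /d_phi /=.
have e1 : (a - j == c) = (a - c == j) by lia.
have e2 : (a - j + 1 == c) = (a - c + 1 == j) by lia.
case: b => /=; rewrite !xpair_eqE /= ?e1 ?e2; case: d; rewrite ?andbF ?andbT /=.
- by rewrite mulr0 subrr oppr0 cst0.
- rewrite sub0r opprK; have [<-|_] := eqVneq (a - c + 1) j; last by rewrite mulr0 cst0.
  by rewrite mulr1 cst_int; congr (_%:~R); lia.
- by rewrite subr0; case: (a - c == j); [rewrite cstN cst1|rewrite oppr0 cst0].
- by rewrite subr0 oppr0 cst0.
Qed.

(** Extension by zero to all integers, so that [vf_pos], [vf_neg] and [vf_zero] all become instances
    of [vf]. *)
Definition posfam (E : nat -> sser R) (j : int) : sser R :=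
  if 1 <= j then E `|j|%N else 0.

(* z = 0 for the L_{-j}, z = 1 for the G_{-j+1/2}, which are the [G (1 - j)] *)
Definition negfam (z : int) (E : nat -> sser R) (j : int) : sser R :=
  if 1 <= z - j then E `|z - j|%N else 0.

(** A matrix entry receives a contribution from at most one j. So the entries of [vf_pos] and
    [vf_neg] make sense for every family, which matters before finiteness of the Psi_j is known. *)
Lemma fsum_posfam E (d : int) (c : K) (x : nat -> K) m :
  (forall j : nat, (1 <= j)%N -> x j = if d == j%:Z then c else 0) ->
  \sum_(j \in [set j : nat | (1 <= j)%N]) E j m * x j = sscale c (posfam E d) m.
Proof.
rewrite /posfam /sscale => xE; case: ifP => [d1|nd1]; last first.
  rewrite mulr0 fsbig1 // => j /= j1; rewrite xE //; case: eqP; rewrite ?mulr0 //; lia.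
rewrite -(fsbig_widen [set `|d|%N]) => [|j /= ->|j /= [j1 jd]].
- by rewrite fsbig_set1 xE; [case: eqP; [rewrite mulrC|lia]|lia].
- by lia.
- by rewrite xE //; case: eqP => [dj|_]; [case: jd; lia|rewrite mulr0].
Qed.

Arguments fsum_posfam {E} d c {x m}.

Lemma vf_posE E O : vf_pos E O = vf (posfam E) (posfam O).
Proof.
apply: sopP => -[a b] [c d]; apply/funext => m; rewrite /vf_pos /vf /=.
under eq_fsbigr do rewrite entryL entryG /=.
case: d; case: b => /=.
- under eq_fsbigr do rewrite mulr0 addr0.
  by rewrite (fsum_posfam (a - c) (- (c%:~R + (a - c + 1)%:~R / 2))) // => j _;
    rewrite andbT; case: eqP => // ->.
- under eq_fsbigr do rewrite andbF mulr0 add0r.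
  rewrite (fsum_posfam (a - c) (- 1)) => [|j _]; last by case: eqP.
  by rewrite /sscale mulN1r.
- under eq_fsbigr do rewrite andbF mulr0 add0r.
  by rewrite (fsum_posfam (a - c + 1) (c%:~R)) // => j _; case: eqP.
- under eq_fsbigr do rewrite mulr0 addr0.
  by rewrite (fsum_posfam (a - c) (- c%:~R)) // => j _; rewrite andbT addr0; case: eqP.
Qed.

Lemma vf_negE E O : vf_neg E O = vf (negfam 0 E) (negfam 1 O).
Proof.
have nf z F d : negfam z F d = posfam F (z - d) by [].
apply: sopP => -[a b] [c d]; apply/funext => m; rewrite /vf_neg /vf /= !nf.
under eq_fsbigr do rewrite entryL entryG /=.
case: d; case: b => /=.
- under eq_fsbigr do rewrite mulr0 addr0.
  rewrite (fsum_posfam (0 - (a - c)) (- (c%:~R + (a - c + 1)%:~R / 2))) // => j _.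
  rewrite andbT (_ : (a - c == - j%:Z) = (0 - (a - c) == j%:Z)); last by lia.
  by case: eqP => // h; rewrite (_ : - j%:Z = a - c) //; lia.
- under eq_fsbigr do rewrite andbF mulr0 add0r.
  rewrite (fsum_posfam (1 - (a - c)) (- 1)) => [|j _]; first by rewrite /sscale mulN1r.
  by rewrite (_ : (a - c == 1 - j%:Z) = (1 - (a - c) == j%:Z)); [case: eqP|lia].
- under eq_fsbigr do rewrite andbF mulr0 add0r.
  rewrite (fsum_posfam (1 - (a - c + 1)) (c%:~R)) // => j _.
  by rewrite (_ : (a - c + 1 == 1 - j%:Z) = (1 - (a - c + 1) == j%:Z)); [case: eqP|lia].
- under eq_fsbigr do rewrite mulr0 addr0.
  rewrite (fsum_posfam (0 - (a - c)) (- c%:~R)) // => j _.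
  rewrite andbT addr0 (_ : (a - c == - j%:Z) = (0 - (a - c) == j%:Z)); last by lia.
  by case: eqP.
Qed.

Lemma vf_zeroE c f : vf_zero c f = vf (fun j => if j == 0 then sscale c%:~R f else 0) (fun=> 0).
Proof.
apply: sopP => -[a b] [n d]; apply/funext => m; rewrite /vf_zero /vf entryL /=.
case: d; case: b => /=; rewrite ?andbF ?andbT ?mulr0 ?sscale0r ?oppr0 //.
  case: eqP => [->|_]; last by rewrite mulr0 sscale0r.
  by rewrite /sscale mulrC.
case: eqP => [_|_]; last by rewrite mulr0 sscale0r.
by rewrite /sscale addr0 mulrC.
Qed.

End VectorFields.

(** * The Leibniz rule for vector fields *)

Section Derivation.
Context {R : realType}.
Local Notation K := {fraction {poly R[i]}}.
Implicit Types (e o : int -> sser R) (u : fser R).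

Lemma sser_odd_anticomm (f g : sser R) : par true f -> par true g ->
  sser_mul f g = - sser_mul g f.
Proof.
move=> hf hg; rewrite (sser_odd_comm g hf) -sser_mulNr; congr sser_mul.
apply/funext => m; rewrite /sser_sign sserNE; have [->|/hg ->] := eqVneq (g m) 0.
  by rewrite mulr0 oppr0.
by rewrite expr1 mulN1r opprK.
Qed.

(** Even coefficients times even derivations and odd coefficients times odd ones add up to an even
    derivation. The sums are reindexed by the monomials of [u] and compared term by term; the
    remaining scalar identities are affine in the exponents. *)
Lemma derop_vf e o : (forall j, par false (e j)) -> (forall j, par true (o j)) ->
  derop (vf e o).
Proof.
move=> he ho u hu eu; apply: sopP => p r; set T := vf e o.
have u0 a : par false (u (a, false)) by exact: (eu (a, false)).
have u1 a : par true (u (a, true)) by exact: (eu (a, true)).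
have lA r' F : lf (fun q => sser_mul (u q) (F q r' : sser R)) by exact: lfMl.
rewrite sopDE; case: p r => k c [n d].
pose h (q : xphi) : xphi := (q.1 + n, q.2).
have hi : injective h by move=> [a b] [a' b'] [/addIr -> ->].
case: d.
- have -> : sop_mul T (mulop u) (k, c) (n, true) =
      lsum (fun q : xphi => if q.2 then 0 else sser_mul (u q) (T (k, c) (q.1 + n, true))).
    rewrite sop_mulE; pose h1 (a : int) : xphi := (a + n, true); pose h0 (a : int) : xphi := (a, false).
    rewrite (lsum_inj (h := h1)); first rewrite [RHS](lsum_inj (h := h0)).
    + by congr lsum; apply/funext => a; rewrite /= /mulop /= addrK.
    + by move=> a a' [].
    + by move=> [a []] // /(_ a); rewrite eqxx.
    + by move=> a a' [/addIr].
    + move=> [a []]; rewrite /mulop /= ?sser_mul0l // => /(_ (a - n)).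
      by rewrite /h1 subrK eqxx.
  case: c.
  + pose g (q : xphi) : xphi := (k - q.1, ~~ q.2).
    have gi : injective g by move=> [a b] [a' b'] [/addrI/oppr_inj -> /negb_inj ->].
    have -> : sop_mul (mulop u) T (k, true) (n, true) =
        lsum (fun q : xphi => sser_mul (T (g q) (n, true)) (u q)).
      rewrite sop_mulE (lsum_inj (h := g)) //.
        congr lsum; apply/funext => -[a b]; rewrite /= /mulop /= subKr.
        by case: b.
      by move=> [a b] /(_ (k - a, ~~ b)); rewrite /g /= subKr negbK eqxx.
    have -> : mulop (sop_app T u) (k, true) (n, true) =
      lsum (fun q => sser_mul (u q) (T (k - n, false) q)) by [].
    rewrite -lsumD; [|exact: lfMl|exact: lfMr].
    congr lsum; apply/funext => -[a b]; rewrite /T /vf /=.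
    have -> : k - n - a = k - (a + n) by lia.
    have -> : k - a - n = k - (a + n) by lia.
    (* For the phi part of [u], its product with phi is 0, and the terms coming from (T u) phi and u
       (T phi) cancel because odd coefficients anticommute. *)
    case: b => /=.
      by rewrite sser_mulNr sser_mulNl (sser_odd_anticomm (u1 a)) // opprK subrr.
    rewrite -(sser_even_comm _ (u0 a)) !sser_mulZr.
    apply/funext => m; rewrite sserDE /sscale -mulrDl; congr (_ * _).
    by rewrite rmorphD /=; ring.
  + pose g (a : int) : xphi := (k - a, false); pose h0 (a : int) : xphi := (a, false).
    have -> : mulop (sop_app T u) (k, false) (n, true) = 0 by [].
    rewrite add0r sop_mulE [RHS](lsum_inj (h := g)); first rewrite (lsum_inj (h := h0)).
    * congr lsum; apply/funext => a; rewrite /= /T /vf /mulop /= subKr.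
      have -> : k - a - n = k - (a + n) by lia.
      by rewrite sser_mulNr sser_mulNl (sser_even_comm _ (u0 a)).
    * by move=> a a' [].
    * by move=> [a []] // /(_ a); rewrite eqxx.
    * by move=> a a' [/addrI/oppr_inj].
    * move=> [a []]; rewrite /mulop /= ?sser_mul0r // => /(_ (k - a)).
      by rewrite /g subKr eqxx.
- have -> : sop_mul T (mulop u) (k, c) (n, false) =
      lsum (fun q : xphi => sser_mul (u q) (T (k, c) (h q))).
    rewrite sop_mulE (lsum_inj (h := h)) //.
      by congr lsum; apply/funext => -[a b]; rewrite /= /mulop /= addrK.
    by move=> [a b] /(_ (a - n, b)); rewrite /h /= subrK eqxx.
  have -> : mulop (sop_app T u) (k, c) (n, false) =
    lsum (fun q => sser_mul (u q) (T (k - n, c) q)) by [].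
  case: c.
  + pose g (q : xphi) : xphi := (k - q.1, ~~ q.2).
    have gi : injective g by move=> [a b] [a' b'] [/addrI/oppr_inj -> /negb_inj ->].
    have -> : sop_mul (mulop u) T (k, true) (n, false) =
        lsum (fun q : xphi => sser_mul (T (g q) (n, false)) (u q)).
      rewrite sop_mulE (lsum_inj (h := g)) //.
        congr lsum; apply/funext => -[a b]; rewrite /= /mulop /= subKr.
        by case: b.
      by move=> [a b] /(_ (k - a, ~~ b)); rewrite /g /= subKr negbK eqxx.
    rewrite -lsumD; [|exact: lfMl|exact: lfMr].
    congr lsum; apply/funext => -[a b]; rewrite /h /T /vf /=.
    have -> : k - n - a = k - (a + n) by lia.
    have -> : k - a - n = k - (a + n) by lia.
    case: b => /=.
      rewrite sser_mulZl (sser_even_comm (u (a, true)) (he _)) !sser_mulZr.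
      apply/funext => m; rewrite sserDE /sscale -mulrDl; congr (_ * _).
      by rewrite rmorphD /=; ring.
    rewrite -(sser_even_comm _ (u0 a)) !sser_mulZr.
    apply/funext => m; rewrite sserDE /sscale -mulrDl; congr (_ * _).
    by rewrite rmorphD.
  + pose g (a : int) : xphi := (k - a, false); pose h0 (a : int) : xphi := (a, false).
    have -> : sop_mul (mulop u) T (k, false) (n, false) = lsum (fun q : xphi =>
        if q.2 then 0 else sser_mul (T (k - q.1, false) (n, false)) (u q)).
      rewrite sop_mulE (lsum_inj (h := g)); first rewrite [RHS](lsum_inj (h := h0)).
      * by congr lsum; apply/funext => a; rewrite /= /mulop /= subKr.
      * by move=> a a' [].
      * by move=> [a []] // /(_ a); rewrite eqxx.
      * by move=> a a' [/addrI/oppr_inj].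
      * move=> [a []]; rewrite /mulop /= ?sser_mul0r // => /(_ (k - a)).
        by rewrite /g subKr eqxx.
    rewrite -lsumD; [|exact: lfMl|]; last first.
      move=> m; have hT : lf (fun q : xphi => sser_mul (T (k - q.1, false) (n, false)) (u q)) by exact: lfMr.
      by apply: sub_finite_set (hT m) => -[a []]; rewrite /= ?eqxx.
    congr lsum; apply/funext => -[a b]; rewrite /h /T /vf /=.
    have -> : k - n - a = k - (a + n) by lia.
    have -> : k - a - n = k - (a + n) by lia.
    case: b => /=; first by rewrite addr0.
    rewrite sser_mulZl (sser_even_comm _ (he _)) !sser_mulZr.
    apply/funext => m; rewrite sserDE /sscale -mulrDl; congr (_ * _).
    by rewrite rmorphD /=; ring.
Qed.

End Derivation.

(** * The operators of the sewing equation *)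

Section BasicOperators.
Context {R : realType}.
Local Notation K := {fraction {poly R[i]}}.
Local Open Scope classical_set_scope.
Implicit Types (e o : int -> sser R) (u : fser R).

(** The conditions under which [vf e o] is an even column-finite derivation with Laurent
    coefficients. The last two fields give it order 1, so that its exponential exists. *)
Record vfield e o : Prop := Vfield {
  vfield_lfe : lf e; vfield_lfo : lf o;
  vfield_pare : forall j, par false (e j); vfield_paro : forall j, par true (o j);
  vfield_laue : forall j, laurent_sser (e j); vfield_lauo : forall j, laurent_sser (o j);
  vfield_e1 : forall j, e j smono1 = 0; vfield_o1 : forall j, o j smono1 = 0 }.

Lemma vfieldN e o : vfield e o -> vfield (fun j => - e j) (fun j => - o j).
Proof.
move=> [h1 h2 h3 h4 h5 h6 h7 h8]; split; do ?[exact: lfN|by move=> j; exact: parN].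
- by move=> j m; exact/laurentN/h5.
- by move=> j m; exact/laurentN/h6.
- by move=> j; rewrite sserNE h7 oppr0.
- by move=> j; rewrite sserNE h8 oppr0.
Qed.

Lemma laurent_int (n : int) : laurent (n%:~R : K).
Proof. by rewrite -cst_int; exact: laurent_cst. Qed.

Lemma laurent_half : laurent (2^-1 : K).
Proof. by rewrite -cstV2; exact: laurent_cst. Qed.

Lemma lau_vf e o : vfield e o -> lau (vf e o).
Proof.
move=> [_ _ _ _ h5 h6 _ _] [a b] [c d] m; rewrite /vf /sscale /=.
have li := laurent_int; have lc n n' : laurent (- (n%:~R + n'%:~R / 2) : K).
  by apply/laurentN/laurentD; [exact: li|apply: laurentM; [exact: li|exact: laurent_half]].
case: d; case: b.
- by apply: laurentM; [exact: lc|exact: h5].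
- exact/laurentN/h6.
- by apply: laurentM; [exact: li|exact: h6].
- by apply: laurentM; [exact/laurentN/li|exact: h5].
Qed.

Lemma vf_sop_opp e o : sop_opp (vf e o) = vf (fun j => - e j) (fun j => - o j).
Proof.
apply: sopP => -[a b] [c d]; apply/funext => m; rewrite /sop_opp /vf /sscale /=.
by case: d; case: b; rewrite ?sserNE ?mulrN // opprK.
Qed.

Lemma vf_vanish e o (m : smono) p q :
  (forall j, e j m = 0) -> (forall j, o j m = 0) -> vf e o p q m = 0.
Proof.
move=> he ho; rewrite /vf /sscale; case: q.2; case: p.2; rewrite ?he ?ho ?mulr0 //.
by rewrite sserNE ho oppr0.
Qed.

Lemma vf_col0 e o : vf e o ^~ (0, false) = 0.
Proof.
apply/funext => -[a []]; rewrite /vf /=; first by rewrite sscale0l.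
by rewrite oppr0 sscale0l.
Qed.

Definition vfop e o (h : vfield e o) : eop R :=
  mk_eop (colfin_vf (vfield_lfe h) (vfield_lfo h)).

Lemma vfopN e o (h : vfield e o) : vfop (vfieldN h) = - vfop h.
Proof. by apply: val_inj; rewrite /= -vf_sop_opp. Qed.

Lemma vfop_ord1 e o (h : vfield e o) : ord 1 (vfop h).
Proof.
move=> m; rewrite ltnS leqn0 mdeg_eq0 => /eqP-> p q; apply: vf_vanish => j.
  exact: vfield_e1 h j.
exact: vfield_o1 h j.
Qed.

Lemma sop_exp_vf e o (h : vfield e o) : sop_exp (vf e o) = opf (expe (vfop h)).
Proof. by rewrite -(sop_exp_expe (vfop_ord1 h)). Qed.

Lemma sop_exp_vfN e o (h : vfield e o) : sop_exp (sop_opp (vf e o)) = opf (expe (- vfop h)).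
Proof. by rewrite vf_sop_opp (sop_exp_vf (vfieldN h)) vfopN. Qed.

Lemma multop_exp_vf e o (h : vfield e o) : multop (opf (expe (vfop h))).
Proof.
have [_ _ he ho _ _ _ _] := h; apply: multop_expe.
- exact: vfop_ord1.
- exact: derop_vf.
- exact: evenop_vf.
- exact: vf_col0.
Qed.

Lemma multop_exp_vfN e o (h : vfield e o) : multop (opf (expe (- vfop h))).
Proof. by rewrite -vfopN; exact: multop_exp_vf. Qed.

Lemma lau_exp_vf e o (h : vfield e o) : lau (opf (expe (vfop h))).
Proof. exact/lau_expe/lau_vf. Qed.

Lemma lau_exp_vfN e o (h : vfield e o) : lau (opf (expe (- vfop h))).
Proof. by rewrite -vfopN; exact: lau_exp_vf. Qed.

(** The eigenvalue of -2 L_0 on x^n phi^b. *)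
Definition xweight (p : xphi) : int := 2 * p.1 + (p.2 : nat)%:Z.

Definition alpha_op t : eop R :=
  mk_eop (colfin_dg (fun q => sconst (ah ^ (- t * xweight q)) : sser R)).

Lemma alpha_opE t : @alpha_2L0 R t = opf (alpha_op t).
Proof. by rewrite alpha_dg. Qed.

Lemma eop_dgl d (S : eop R) p q : (mk_eop (colfin_dg d) * S) p q = sser_mul (S p q) (d p).
Proof. by rewrite eopME sop_mul_dgl. Qed.

Lemma eop_dgr d (S : eop R) p q : (S * mk_eop (colfin_dg d)) p q = sser_mul (d q) (S p q).
Proof. by rewrite eopME sop_mul_dgr. Qed.

Lemma alpha_opM s t : alpha_op s * alpha_op t = alpha_op (s + t).
Proof.
apply: eopP => p q m; rewrite eop_dgl sser_mul_constr /sscale /= /dg.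
have [->|_] := eqVneq p q; last by rewrite mulr0.
rewrite /sconst; case: (m == smono1); last by rewrite mulr0.
by rewrite -expfzDr ?ah_neq0 //; congr (_ ^ _); ring.
Qed.

Lemma alpha_op0 : alpha_op 0 = 1.
Proof.
apply: eopP => p q m; rewrite eop1E /= /dg /sconst; case: (p == q); last by [].
by rewrite oppr0 mul0r expr0z; case: (m == smono1).
Qed.

Lemma lau_alpha t : lau (opf (alpha_op t)).
Proof. by apply: lau_dg => q; apply/laurent_sconst/laurent_ah. Qed.

(** The weight is additive on products of monomials. *)
Lemma multop_alpha t : multop (opf (alpha_op t)).
Proof.
split; first exact: colfinP.
- move=> p q; rewrite /= /dg; have [->|_] := eqVneq p q; last exact: par0.
  by rewrite addbb; exact: par_const.
- apply/funext => p; rewrite /= /dg /fser1 fser_monE.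
  by have -> : - t * xweight (0, false) = 0 by rewrite /xweight /=; lia.
- move=> u hu eu; apply: sopP => p q; rewrite sop_mul_dgl sop_mul_dgr.
  have appE p' : sop_app (opf (alpha_op t)) u p' = sscale (ah ^ (- t * xweight p')) (u p').
    rewrite sop_appE (lsum_only (i0 := p')) /= /dg ?eqxx ?sser_mul_constr // => r.
    by rewrite eq_sym => /negPf ->; rewrite sser_mul0r.
  rewrite sser_mul_constl sser_mul_constr /mulop; case: p q => a b [c d] /=.
  case: d; last first.
    rewrite appE sscaleA -expfzDr ?ah_neq0 //; congr (sscale (_ ^ _) _).
    by rewrite /xweight /=; ring.
  case: b; last by rewrite !sscale0r.
  rewrite appE sscaleA -expfzDr ?ah_neq0 //; congr (sscale (_ ^ _) _).
  by rewrite /xweight /=; ring.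
Qed.

(* f |-> f o I *)
Definition Iop : sop R := fun p q =>
  if p == (- q.1 - (q.2 : nat)%:Z, q.2) then sconst (if q.2 then Defs.cst 'i else 1) else 0.

(** The map (n, b) -> (-n - b, b) on exponents is an involution, so the nonzero entries can be
    located from the row as well as from the column. *)
Lemma IopE p q : Iop p q =
  if q == (- p.1 - (p.2 : nat)%:Z, p.2) then sconst (if p.2 then Defs.cst 'i else 1) else 0.
Proof.
rewrite /Iop; case: p q => a b [c d] /=; rewrite !xpair_eqE [d == b]eq_sym.
have [->|_] := eqVneq b d; last by rewrite !andbF.
by rewrite !andbT (_ : (a == - c - (d : nat)%:Z) = (c == - a - (d : nat)%:Z)) //; lia.
Qed.

Lemma colfin_Iop : colfin Iop.
Proof.
move=> q m; apply: (@sub_finite_set _ _ [set (- q.1 - (q.2 : nat)%:Z, q.2)]) => // p /=.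
by rewrite /Iop; have [->//|_] := eqVneq p (_, _); rewrite eqxx.
Qed.

Lemma Iop_mull (T : sop R) p q : sop_mul Iop T p q =
  sscale (if p.2 then Defs.cst 'i else 1) (T (- p.1 - (p.2 : nat)%:Z, p.2) q).
Proof.
rewrite sop_mulE (lsum_only (i0 := (- p.1 - (p.2 : nat)%:Z, p.2))) /= ?IopE ?eqxx ?sser_mul_constr // => r.
by rewrite IopE => /negPf ->; rewrite sser_mul0r.
Qed.

Lemma Iop_mulr (T : sop R) p q : sop_mul T Iop p q =
  sscale (if q.2 then Defs.cst 'i else 1) (T p (- q.1 - (q.2 : nat)%:Z, q.2)).
Proof.
rewrite sop_mulE (lsum_only (i0 := (- q.1 - (q.2 : nat)%:Z, q.2))) /= /Iop ?eqxx ?sser_mul_constl // => r.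
by move=> /negPf ->; rewrite sser_mul0l.
Qed.

Lemma lau_Iop : lau Iop.
Proof.
move=> p q m; rewrite /Iop; case: (p == _); last exact: laurent0.
by apply: laurent_sconst; case: q.2; [exact: laurent_cst|exact: laurent1].
Qed.

Lemma multop_Iop : multop Iop.
Proof.
split; first exact: colfin_Iop.
- move=> p q; rewrite /Iop; have [->|_] := eqVneq p _; last exact: par0.
  by rewrite addbb; exact: par_const.
- by apply/funext => p; rewrite /Iop /fser1 fser_monE /= oppr0 subr0.
- move=> u hu eu; apply: sopP => p q; rewrite Iop_mull Iop_mulr.
  have appE p' : sop_app Iop u p' = sscale (if p'.2 then Defs.cst 'i else 1) (u (- p'.1 - (p'.2 : nat)%:Z, p'.2)).
    rewrite sop_appE (lsum_only (i0 := (- p'.1 - (p'.2 : nat)%:Z, p'.2))) /= ?IopE ?eqxx ?sser_mul_constr // => r.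
    by rewrite IopE => /negPf ->; rewrite sser_mul0r.
  rewrite /mulop; case: p q => a b [c []] /=; last first.
    rewrite appE sscale1 /=; congr (sscale _ (u (_, _))); lia.
  case: b; last by rewrite !sscale0r.
  by rewrite appE /= sscale1; congr (sscale _ (u (_, _))); lia.
Qed.

Lemma I_pairE : @I_pair R = fpair_app Iop (@id_pair R).
Proof.
rewrite fpair_app_id /I_pair; congr pair; apply/funext => p; rewrite fser_monE /Iop /=.
  by rewrite subr0.
by rewrite oppr0 sub0r.
Qed.

Lemma fpair_app_mul (S T : sop R) (F : fpair R) : colfin T -> lf F.1 -> lf F.2 ->
  fpair_app (sop_mul S T) F = fpair_app S (fpair_app T F).
Proof. by move=> cT h1 h2; rewrite /fpair_app /= !sop_app_mul. Qed.

Lemma fpair_app1 (F : fpair R) : fpair_app (@sop1 R) F = F.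
Proof. by rewrite /fpair_app !sop_app1; case: F. Qed.

Lemma count_fset0 (P : pred gvar) : count P (fset0 : {fset gvar}) = 0%N.
Proof. by rewrite -sum1_count big_mkcond big_seq_fset0. Qed.

Lemma count_fset1 (P : pred gvar) x : count P [fset x]%fset = P x.
Proof. by rewrite -sum1_count big_mkcond big_seq_fset1; case: (P x). Qed.

Lemma smono_deg_even s t k : smono_deg t ([mset (s, k)]%mset, fset0) = (s == t).
Proof. by rewrite /smono_deg count_fset0 (enum_msetn 1) /= !addn0. Qed.

Lemma smono_deg_odd s t k : smono_deg t (mset0, [fset (s, k)]%fset) = (s == t).
Proof. by rewrite /smono_deg count_fset1 enum_mset0. Qed.

Lemma sser_mon_neq0 m n : @sser_mon R n m != 0 -> m = n.
Proof. by apply: contraNeq => /negPf h; rewrite /sser_mon h. Qed.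

Lemma even_var_neq0 s j m : even_var R s j m != 0 -> m = ([mset (s, j.-1)]%mset, fset0).
Proof. by rewrite /even_var => /sser_mon_neq0. Qed.

Lemma odd_var_neq0 s j m : odd_var R s j m != 0 -> m = (mset0, [fset (s, j.-1)]%fset).
Proof. by rewrite /odd_var => /sser_mon_neq0. Qed.

Lemma even_var_eq0 s t j m : smono_deg t m != (s == t) -> even_var R s j m = 0.
Proof.
by apply: contraNeq => /even_var_neq0 ->; rewrite smono_deg_even.
Qed.

Lemma odd_var_eq0 s t j m : smono_deg t m != (s == t) -> odd_var R s j m = 0.
Proof.
by apply: contraNeq => /odd_var_neq0 ->; rewrite smono_deg_odd.
Qed.

Lemma smono_deg1 s : smono_deg s smono1 = 0%N.
Proof.
have /eqP : mdeg smono1 = 0%N by apply/eqP; rewrite mdeg_eq0.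
by rewrite /mdeg addn_eq0; case: s => /andP[/eqP ? /eqP ?].
Qed.

Lemma par_even_var s j : par false (even_var R s j).
Proof.
by move=> m /even_var_neq0 ->; rewrite /smono_odd cardfs0.
Qed.

Lemma par_odd_var s j : par true (odd_var R s j).
Proof.
by move=> m /odd_var_neq0 ->; rewrite /smono_odd cardfs1.
Qed.

Lemma mset1_inj (x y : gvar) : [mset x]%mset = [mset y]%mset -> x = y.
Proof. by move=> h; apply/eqP; rewrite -in_mset1 -h in_mset1. Qed.

Lemma even_var_inj s j k m : even_var R s j m != 0 -> even_var R s k m != 0 -> j.-1 = k.-1.
Proof.
move=> /even_var_neq0 -> /even_var_neq0 h.
have h1 : [mset (s, j.-1)]%mset = [mset (s, k.-1)]%mset := congr1 fst h.
by have [] := mset1_inj h1.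
Qed.

Lemma odd_var_inj s j k m : odd_var R s j m != 0 -> odd_var R s k m != 0 -> j.-1 = k.-1.
Proof.
move=> /odd_var_neq0 -> /odd_var_neq0 h.
have h1 : [fset (s, j.-1)]%fset = [fset (s, k.-1)]%fset := congr1 snd h.
by have [] := fset1_inj h1.
Qed.

Lemma laurent_sser_mon m : laurent_sser (@sser_mon R m).
Proof.
by move=> m'; rewrite /sser_mon; case: (_ == _); [exact: laurent1|exact: laurent0].
Qed.

Lemma laurent_sser0 : laurent_sser (0 : sser R).
Proof. by move=> m; exact: laurent0. Qed.

Lemma finite_at_most_one (T : Type) (A : set T) :
  (forall x y, A x -> A y -> x = y) -> finite_set A.
Proof.
move=> h; have [[x Ax]|h0] := pselect (exists x, A x).
  by apply: (@sub_finite_set _ _ [set x]) => // y Ay; exact: h.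
by apply: (@sub_finite_set _ _ set0) => // y Ay; case: h0; exists y.
Qed.

Lemma posfam_neq0 (E : nat -> sser R) j m : posfam E j m != 0 -> 1 <= j /\ E `|j|%N m != 0.
Proof.
rewrite /posfam; have [j1 h|_] := boolP (1 <= j); first by split.
by rewrite -[(0 : sser R) m]/(0 : K) eqxx.
Qed.

(** A monomial is equal to at most one of the variables, which gives local finiteness. *)
Lemma vfield_pos s : vfield (posfam (even_var R s)) (posfam (odd_var R s)).
Proof.
split.
- move=> m; apply: finite_at_most_one => i j /posfam_neq0[i1 hi] /posfam_neq0[j1 hj].
  by have := even_var_inj hi hj; clear -i1 j1; lia.
- move=> m; apply: finite_at_most_one => i j /posfam_neq0[i1 hi] /posfam_neq0[j1 hj].
  by have := odd_var_inj hi hj; clear -i1 j1; lia.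
- by move=> j; rewrite /posfam; case: ifP => _; [exact: par_even_var|exact: par0].
- by move=> j; rewrite /posfam; case: ifP => _; [exact: par_odd_var|exact: par0].
- by move=> j; rewrite /posfam; case: ifP => _; [exact: laurent_sser_mon|exact: laurent_sser0].
- by move=> j; rewrite /posfam; case: ifP => _; [exact: laurent_sser_mon|exact: laurent_sser0].
- by move=> j; rewrite /posfam; case: ifP => // _; apply: (@even_var_eq0 _ s); rewrite smono_deg1 eqxx.
- by move=> j; rewrite /posfam; case: ifP => // _; apply: (@odd_var_eq0 _ s); rewrite smono_deg1 eqxx.
Qed.

Lemma vfield_reindex e o (h k : int -> int) : injective h -> injective k ->
  vfield e o -> vfield (e \o h) (o \o k).
Proof.
move=> hi ki [h1 h2 h3 h4 h5 h6 h7 h8]; split.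
- by move=> m; apply: finite_preimage (h1 m) => i j _ _; exact: hi.
- by move=> m; apply: finite_preimage (h2 m) => i j _ _; exact: ki.
- by move=> j; exact: h3.
- by move=> j; exact: h4.
- by move=> j; exact: h5.
- by move=> j; exact: h6.
- by move=> j; exact: h7.
- by move=> j; exact: h8.
Qed.

Lemma vfield_neg s : vfield (negfam 0 (even_var R s)) (negfam 1 (odd_var R s)).
Proof.
have h (c : int) : injective (fun j : int => c - j) by move=> i j /addrI/oppr_inj.
exact: (vfield_reindex (h 0) (h 1) (vfield_pos s)).
Qed.

End BasicOperators.

(** * Exponentials of operators not yet known to be column-finite *)

Section Truncation.
Context {R : realType}.
Local Notation K := {fraction {poly R[i]}}.
Local Open Scope classical_set_scope.
Implicit Types (e o : int -> sser R) (u : fser R).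

(** If k >= 2 factors without constant term share a degree at most d, each gets degree below d,
    where [T] and [T'] agree; a factor of degree d would force the others into degree 0, where they
    vanish. Only k = 1 in degree d can tell [T] from [T']. *)
Lemma iter_sop_mul_trunc (T : sop R) (T' : eop R) d : (0 < d)%N -> ord 1 T' ->
  (forall m p q, (mdeg m < d)%N -> T p q m = T' p q m) ->
  forall k m p q, (mdeg m <= d)%N -> (mdeg m < d)%N \/ k != 1%N ->
  iter k (sop_mul T) (@sop1 R) p q m = (T' ^+ k) p q m.
Proof.
move=> d0 oT' TT'; elim=> [//|k IH] m p q md hk.
rewrite exprS eopME iterS !sop_mulE; apply: eq_fsbigr => r _.
apply: eq_sser_mul => a b /mdegM mab.
have [k0|k0] := eqVneq k 0%N.
  have {}md : (mdeg m < d)%N by case: hk => //; rewrite k0.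
  have ad : (mdeg a < d)%N by lia.
  have bd : (mdeg b < d)%N by lia.
  by rewrite (TT' b _ _ bd) (IH a _ _ (ltnW ad) (or_introl ad)).
have oX : ord 1 (T' ^+ k) by case: k k0 {IH hk} => // k _; rewrite exprS; exact: ordMr.
have [b0|b0] := posnP (mdeg b).
  by rewrite TT' ?b0 // (oT' b) ?b0 // !mulr0.
have ad : (mdeg a < d)%N by lia.
rewrite (IH a _ _ (ltnW ad) (or_introl ad)).
have [a0|a0] := posnP (mdeg a); first by rewrite (oX a) ?a0 // !mul0r.
by rewrite TT' //; lia.
Qed.

Lemma fset_ltn n : exists A : {fset nat}, forall k, (k < n)%N -> k \in A.
Proof.
exists (seq_fset tt (iota 0 n)) => k kn.
by rewrite seq_fsetE mem_iota.
Qed.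

(** Here [T'] is the part of [T] of degree below d. Up to degree d, the two exponentials differ by
    the linear term alone, which controls [sop_exp T] although only [T'] is known to be
    column-finite. *)
Lemma sop_exp_trunc (T : sop R) (T' : eop R) d : (0 < d)%N -> ord 1 T' ->
  (forall m p q, (mdeg m < d)%N -> T p q m = T' p q m) ->
  (forall m p q, (d <= mdeg m)%N -> T' p q m = 0) ->
  forall m p q, (mdeg m <= d)%N ->
  sop_exp T p q m = expe T' p q m + (if mdeg m == d then T p q m else 0).
Proof.
move=> d0 oT' TT' T'0 m p q md.
pose D (k : nat) : K := if (k == 1%N) && (mdeg m == d) then T p q m else 0.
have XE k : (k`!%:R)^-1 * iter k (sop_mul T) (@sop1 R) p q m =
    (k`!%:R)^-1 * (T' ^+ k) p q m + D k.
  have [hk|/negP hk] := boolP ((k == 1%N) && (mdeg m == d)).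
    rewrite /D hk; case/andP: hk => /eqP -> /eqP mdd.
    by rewrite expr1 T'0 ?mdd // mulr0 add0r iterS sop_mul1r invr1 mul1r.
  rewrite /D (negPf (introN idP hk)) addr0 (iter_sop_mul_trunc d0 oT' TT') //.
  by have [md'|md'] := eqVneq (mdeg m) d; [right; apply/eqP => k1; apply: hk; rewrite k1 md' !eqxx|left; lia].
rewrite -(sop_exp_expe oT') /sop_exp.
have [A inA] := fset_ltn d.+2.
have Y0 k : (mdeg m < k)%N -> (k`!%:R)^-1 * (T' ^+ k) p q m = 0.
  by move=> hk; rewrite (ordX oT' hk) mulr0.
have D0 k : (1 < k)%N -> D k = 0 by rewrite /D; case: k => [|[]].
rewrite (fsumE (A := A)); last first.
  move=> k hk; apply: inA; rewrite ltnNge; apply/negP => hk'.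
  by case/negP: hk; rewrite XE Y0 ?D0 ?addr0 //; lia.
rewrite (fsumE (A := A)); last first.
  move=> k hk; apply: inA; rewrite ltnNge; apply/negP => hk'.
  by case/negP: hk; rewrite -eopXE Y0 //; lia.
rewrite (eq_bigr _ (fun k _ => XE k)) big_split /=; congr (_ + _).
  by apply: eq_bigr => k _; rewrite -eopXE.
rewrite (big_only (F := D) (i0 := 1%N) (fset_uniq A)) // => [k /negPf k1|].
  by rewrite /D k1.
by rewrite inA.
Qed.

(** When f starts in the degree of m, the only factorization of m that counts is m times 1. *)
Lemma sser_mul_topl (f g : sser R) m :
  (forall a, (mdeg a < mdeg m)%N -> f a = 0) -> sser_mul f g m = f m * g smono1.
Proof.
move=> h; have -> : f m * g smono1 = sser_mul f (sconst (g smono1)) m.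
  by rewrite sser_mul_constr /sscale mulrC.
apply: eq_sser_mul => a b ab; rewrite /sconst.
have [->//|b1] := eqVneq b smono1; rewrite h ?mul0r //.
by rewrite (mdegM ab) -[X in (X < _)%N]addn0 ltn_add2l lt0n mdeg_eq0.
Qed.

Lemma expe_smono1 (T : eop R) p q : ord 1 T -> expe T p q smono1 = ((p == q))%:R.
Proof.
move=> oT; rewrite expsE; have -> : mdeg smono1 = 0%N by apply/eqP; rewrite mdeg_eq0.
rewrite /exps_trunc big_ord_recl big_ord0 addr0 eopZE fact0 invr1 mul1r expr0 eop1E.
by rewrite eqxx andbT.
Qed.

Definition diagonal (T : sop R) : Prop := forall p q, p != q -> T p q = 0.

Lemma diagonalX (T : eop R) k : diagonal (opf T) -> diagonal (opf (T ^+ k)).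
Proof.
move=> hT; elim: k => [|k IH] p q pq.
  by apply/funext => m; rewrite expr0 eop1E (negPf pq).
rewrite exprS eopME sop_mulE (lsum_only (i0 := p)) => [|r rp].
  by rewrite IH // sser_mul0l.
by rewrite hT ?sser_mul0r // eq_sym.
Qed.

Lemma diagonal_expe (T : eop R) : diagonal (opf T) -> diagonal (opf (expe T)).
Proof.
move=> hT p q pq; apply/funext => m; rewrite expsE eop_sumE big1 // => k _.
by rewrite eopZE (diagonalX _ hT pq) mulr0.
Qed.

Lemma sop_mul_diagl (U T : sop R) p q : diagonal U ->
  sop_mul U T p q = sser_mul (T p q) (U p p).
Proof.
move=> hU; rewrite sop_mulE (lsum_only (i0 := p)) // => r rp.
by rewrite hU ?sser_mul0r // eq_sym.
Qed.

End Truncation.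

(** * The sewing equation in operator form *)

Section SewingEquation.
Context {R : realType}.
Local Notation K := {fraction {poly R[i]}}.
Local Open Scope classical_set_scope.

Definition TA : eop R := vfop (vfield_pos false).
Definition TB : eop R := vfop (vfield_neg true).
Definition Theta : eop R := expe (- TA) * (alpha_op (-1) * expe (- TB)).

Lemma exp_AME : @exp_AM R = opf (expe (- TA)).
Proof. by rewrite /exp_AM vf_posE (sop_exp_vfN (vfield_pos false)). Qed.

Lemma exp_BNE : @exp_BN R = opf (expe (- TB)).
Proof. by rewrite /exp_BN vf_negE (sop_exp_vfN (vfield_neg true)). Qed.

Lemma ThetaE : opf Theta = sop_mul exp_AM (sop_mul (alpha_2L0 (-1)) exp_BN).
Proof. by rewrite exp_AME exp_BNE alpha_opE. Qed.

Lemma multopM (S T : eop R) : multop (opf S) -> multop (opf T) -> multop (opf (S * T)).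
Proof. exact: multop_mul. Qed.

Lemma lauM (S T : eop R) : lau (opf S) -> lau (opf T) -> lau (opf (S * T)).
Proof. exact: lau_mul. Qed.

Lemma multop_Theta : multop (opf Theta).
Proof.
apply: multopM; first exact: multop_exp_vfN.
by apply: multopM; [exact: multop_alpha|exact: multop_exp_vfN].
Qed.

Lemma lau_Theta : lau (opf Theta).
Proof.
apply: lauM; first exact: lau_exp_vfN.
by apply: lauM; [exact: lau_alpha|exact: lau_exp_vfN].
Qed.

Lemma lf_id1 : lf (@id_pair R).1.
Proof. exact: lf_fser_mon. Qed.

Lemma lf_id2 : lf (@id_pair R).2.
Proof. exact: lf_fser_mon. Qed.

(** As [H2] is given by the operator exp(TB) [Iop], the relation [comp H2inv H2 = id_pair] says that
    exp(TB) sends [Iop] applied to [H2inv] to the identity pair. Inverting exp(TB) gives H2^{-1} o I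
    without computing H2^{-1}. *)
Lemma comp_H2inv H2inv : is_comp_inverse (@H2 R) H2inv ->
  Defs.comp H2inv (@I_pair R) = fpair_app (opf (expe (- TB))) (@id_pair R).
Proof.
move=> [p1 p2 _ hinv]; pose EB := expe TB.
have l1 : lf H2inv.1 by move=> m; case: (p1 m).
have l2 : lf H2inv.2 by move=> m; case: (p2 m).
have mB : multop (opf EB) by exact: multop_exp_vf.
have lB : lau (opf EB) by exact: lau_exp_vf.
have H2E : @H2 R = fpair_app (sop_mul (opf EB) (@Iop R)) (@id_pair R).
  rewrite (fpair_app_mul _ colfin_Iop lf_id1 lf_id2) -I_pairE /H2 vf_negE.
  by rewrite (sop_exp_vf (vfield_neg true)).
have hI : fpair_app (opf EB) (fpair_app (@Iop R) H2inv) = @id_pair R.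
  rewrite -(fpair_app_mul _ colfin_Iop l1 l2) -hinv H2E.
  by rewrite (compE (multop_mul mB multop_Iop) (lau_mul lB lau_Iop)).
rewrite I_pairE (compE multop_Iop lau_Iop) -hI.
have lI1 : lf (fpair_app (@Iop R) H2inv).1 by exact: lf_sop_app colfin_Iop l1.
have lI2 : lf (fpair_app (@Iop R) H2inv).2 by exact: lf_sop_app colfin_Iop l2.
rewrite -(fpair_app_mul _ (colfinP EB) lI1 lI2) -eopME.
by rewrite (expeNl (vfop_ord1 (vfield_neg true))) fpair_app1.
Qed.

Section Solution.
Context (Psi PsiH : int -> sser R) (hPsi : sewing_solution Psi PsiH).

(** Only the inner maps are turned into operators, while [F2] remains a pair of series; so this is
    usable before the exponentials in Psi are known to lie in [eop]. *)
Lemma F1_Theta : F1 Psi PsiH = fpair_app (opf Theta) (F2 Psi PsiH).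
Proof.
have [_ _ _ [H2inv [hinv ->]] _] := hPsi.
rewrite (comp_H2inv hinv) -(compE multop_Theta lau_Theta); congr Defs.comp.
have mAa : multop (opf (expe (- TA) * alpha_op (-1))).
  by apply: multopM; [exact: multop_exp_vfN|exact: multop_alpha].
have lAa : lau (opf (expe (- TA) * alpha_op (-1))).
  by apply: lauM; [exact: lau_exp_vfN|exact: lau_alpha].
have -> : @H1 R = fpair_app (opf (expe (- TA) * alpha_op (-1))) (@id_pair R).
  by rewrite /H1 exp_AME alpha_opE.
rewrite (compE mAa lAa) -(fpair_app_mul _ (colfinP _) lf_id1 lf_id2) -eopME.
by rewrite /Theta mulrA.
Qed.

Definition cut (P : pred int) (f : int -> sser R) (j : int) : sser R := if P j then f j else 0.

(** Since [G j] is G_{j-1/2}, the negative half consists of j <= -1 for the L_j and of j <= 0 for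
    the [G j]. The index 0 of the L_j belongs to neither half. *)
Definition ltz0 : pred int := fun j => j <= -1.
Definition lez0 : pred int := fun j => j <= 0.
Definition gtz0 : pred int := fun j => 1 <= j.

Lemma vf_Psi_negE : vf_Psi_neg Psi PsiH = vf (cut ltz0 Psi) (cut lez0 PsiH).
Proof.
rewrite /vf_Psi_neg vf_negE; congr vf; apply/funext => j; rewrite /negfam /cut /ltz0 /lez0.
  rewrite (_ : (1 <= 0 - j) = (j <= -1)); last by lia.
  by case: ifP => // h; congr Psi; lia.
rewrite (_ : (1 <= 1 - j) = (j <= 0)); last by lia.
by case: ifP => // h; congr PsiH; lia.
Qed.

Lemma vf_Psi_posE : vf_Psi_pos Psi PsiH = vf (cut gtz0 Psi) (cut gtz0 PsiH).
Proof.
rewrite /vf_Psi_pos vf_posE; congr vf; apply/funext => j; rewrite /posfam /cut /gtz0.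
  by case: ifP => // h; congr Psi; lia.
by case: ifP => // h; congr PsiH; lia.
Qed.

Definition delta0 (c : int) (f : sser R) (j : int) : sser R := if j == 0 then sscale c%:~R f else 0.

Lemma vfield_Psi0 c : vfield (delta0 c (Psi 0)) (fun=> 0).
Proof.
have [h1 h2 h3 _ _] := hPsi; split; rewrite ?/delta0.
- move=> m; apply: (@sub_finite_set _ _ [set 0]) => // j /=.
  by have [->|_] := eqVneq j 0; rewrite ?eqxx.
- by move=> m; apply: (@sub_finite_set _ _ set0) => // j /=; rewrite eqxx.
- move=> j; case: (j == 0); last exact: par0.
  by apply: parZ => m hm; have [_ /(_ m hm) /negbTE] := h1 0.
- by move=> j; exact: par0.
- move=> j; case: (j == 0); last exact: laurent_sser0.
  by move=> m; apply: laurentM; [exact: laurent_int|have [h _] := h1 0; exact: h].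
- by move=> j; exact: laurent_sser0.
- move=> j; case: (j == 0) => //.
  by have [h _] := h3 0; rewrite /sscale h mulr0.
- by [].
Qed.

Definition T0 c : eop R := vfop (vfield_Psi0 c).

Lemma sop_exp_zero c : sop_exp (vf_zero c (Psi 0)) = opf (expe (T0 c)).
Proof. by rewrite vf_zeroE (sop_exp_vf (vfield_Psi0 c)). Qed.

Lemma diagonal_T0 c : diagonal (opf (T0 c)).
Proof.
move=> [a b] [n d] pq; rewrite /= /vf /delta0 /=.
have h : b = d -> a - n == 0 = false.
  by move=> bd; apply/negbTE; apply: contra pq; rewrite subr_eq0 bd => /eqP ->.
by move: h; case: d {pq}; case: b => h; rewrite ?oppr0 ?sscale0r ?h ?sscale0r.
Qed.

Lemma T0N c : T0 (- c) = - T0 c.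
Proof.
apply: eopP => p q m; rewrite eopNE /= /vf /delta0 /sscale.
case: q.2; case: p.2; rewrite ?oppr0 ?mulr0 ?oppr0 //; case: (_ == _);
  by rewrite ?mulr0 ?oppr0 // rmorphN /=; ring.
Qed.

End Solution.
End SewingEquation.

(** * Finiteness of the solution *)

Section Finiteness.
Context {R : realType}.
Local Notation K := {fraction {poly R[i]}}.
Local Open Scope classical_set_scope.

Lemma vfield_cut (P Q : pred int) (e o : int -> sser R) :
  vfield e o -> vfield (cut P e) (cut Q o).
Proof.
move=> [h1 h2 h3 h4 h5 h6 h7 h8]; split; rewrite /cut.
- move=> m; apply: sub_finite_set (h1 m) => j /=.
  by case: (P j); last by rewrite eqxx.
- move=> m; apply: sub_finite_set (h2 m) => j /=.
  by case: (Q j); last by rewrite eqxx.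
- by move=> j; case: (P j); [exact: h3|exact: par0].
- by move=> j; case: (Q j); [exact: h4|exact: par0].
- by move=> j; case: (P j); [exact: h5|exact: laurent_sser0].
- by move=> j; case: (Q j); [exact: h6|exact: laurent_sser0].
- by move=> j; case: (P j); [exact: h7|].
- by move=> j; case: (Q j); [exact: h8|].
Qed.

Definition trunc (d : nat) (f : int -> sser R) (j : int) : sser R :=
  fun m => if (mdeg m < d)%N then f j m else 0.

Lemma vf_congr (e o e' o' : int -> sser R) p q m :
  (forall j, e j m = e' j m) -> (forall j, o j m = o' j m) -> vf e o p q m = vf e' o' p q m.
Proof.
move=> he ho; rewrite /vf /sscale; case: q.2; case: p.2; rewrite ?he ?ho //.
by rewrite !sserNE ho.
Qed.

Lemma cut_trunc P d (f : int -> sser R) j m : (mdeg m < d)%N ->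
  cut P f j m = cut P (trunc d f) j m.
Proof. by move=> md; rewrite /cut /trunc; case: (P j) => //; rewrite md. Qed.

Lemma cut_trunc0 P d (f : int -> sser R) j m : (d <= mdeg m)%N -> cut P (trunc d f) j m = 0.
Proof. by move=> md; rewrite /cut /trunc; case: (P j) => //; rewrite ltnNge md. Qed.

Lemma sser_mul1 (f g : sser R) : sser_mul f g smono1 = f smono1 * g smono1.
Proof.
apply: sser_mul_topl => a; have -> : mdeg smono1 = 0%N by apply/eqP; rewrite mdeg_eq0.
by [].
Qed.

(** Setting all variables to zero reduces [Theta] to alpha_0^{-L_0}. *)
Lemma Theta_smono1 p q : @Theta R p q smono1 = if p == q then ah ^ xweight p else 0.
Proof.
have oA : ord 1 (- @TA R) by apply/ordN/vfop_ord1.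
have oB : ord 1 (- @TB R) by apply/ordN/vfop_ord1.
rewrite /Theta eopME sop_mulE /lsum.
rewrite (fsum_only (i0 := p)) => [|r rp]; last first.
  by rewrite sser_mul1 (expe_smono1 _ _ oA) eq_sym (negPf rp) mulr0.
rewrite sser_mul1 (expe_smono1 _ _ oA) eqxx mulr1 eop_dgl sser_mul1 (expe_smono1 _ _ oB).
rewrite /sconst eqxx opprK mul1r; case: (p == q); [exact: mul1r|exact: mul0r].
Qed.

Context (Psi PsiH : int -> sser R) (hPsi : sewing_solution Psi PsiH).

Let x : xphi := (1, false).

Lemma vfield_trunc d :
  (forall m, (mdeg m < d)%N ->
     finite_set [set j | Psi j m != 0] /\ finite_set [set j | PsiH j m != 0]) ->
  vfield (trunc d Psi) (trunc d PsiH).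
Proof.
have [h1 h2 h3 _ _] := hPsi; move=> IH; split.
- move=> m; have [md|md] := ltnP (mdeg m) d.
    by have [+ _] := IH m md; apply: sub_finite_set => j /=; rewrite /trunc md.
  by apply: (@sub_finite_set _ _ set0) => // j /=; rewrite /trunc ltnNge md eqxx.
- move=> m; have [md|md] := ltnP (mdeg m) d.
    by have [_ +] := IH m md; apply: sub_finite_set => j /=; rewrite /trunc md.
  by apply: (@sub_finite_set _ _ set0) => // j /=; rewrite /trunc ltnNge md eqxx.
- move=> j m; rewrite /trunc; case: ifP => _ h; last by rewrite eqxx in h.
  by have [_ /(_ m h) /negbTE] := h1 j.
- move=> j m; rewrite /trunc; case: ifP => _ h; last by rewrite eqxx in h.
  by have [_ /(_ m h)] := h2 j.
- move=> j m; rewrite /trunc; case: ifP => _; last exact: laurent0.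
  by have [h _] := h1 j; exact: h.
- move=> j m; rewrite /trunc; case: ifP => _; last exact: laurent0.
  by have [h _] := h2 j; exact: h.
- by move=> j; rewrite /trunc; case: ifP => // _; have [] := h3 j.
- by move=> j; rewrite /trunc; case: ifP => // _; have [] := h3 j.
Qed.

Section Step.
Context (d : nat) (d0 : (0 < d)%N) (hv : vfield (trunc d Psi) (trunc d PsiH)).

(** The full vector fields, mere matrices at this stage; [T1] and [T2] are their parts of degree
    below d, column-finite by the induction hypothesis. *)
Let v1 : sop R := vf (cut ltz0 Psi) (cut lez0 PsiH).
Let v2 : sop R := vf (cut gtz0 Psi) (cut gtz0 PsiH).
Let T1 : eop R := vfop (vfield_cut ltz0 lez0 hv).
Let T2 : eop R := vfop (vfield_cut gtz0 gtz0 hv).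

Let exp_v1 m p q : mdeg m = d -> sop_exp v1 p q m = expe T1 p q m + v1 p q m.
Proof.
move=> md; rewrite (sop_exp_trunc d0 (T' := T1)) ?md ?eqxx //.
- exact: vfop_ord1.
- by move=> n p' q' nd; apply: vf_congr => j; exact: cut_trunc.
- by move=> n p' q' nd; apply: vf_vanish => j; exact: cut_trunc0.
Qed.

Let exp_v2 m p q : (mdeg m <= d)%N ->
  sop_exp (sop_opp v2) p q m = expe (- T2) p q m + (if mdeg m == d then - v2 p q m else 0).
Proof.
move=> md; rewrite (sop_exp_trunc d0 (T' := - T2)) ?md ?eqxx //.
- exact/ordN/vfop_ord1.
- move=> n p' q' nd; rewrite /sop_opp eopNE; congr (- _).
  by apply: vf_congr => j; exact: cut_trunc.
- move=> n p' q' nd; rewrite eopNE; have -> : T2 p' q' n = 0; last by rewrite oppr0.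
  by apply: vf_vanish => j; exact: cut_trunc0.
Qed.

Let U : eop R := expe (T0 hPsi (-2)).
Let Y : eop R := U * (alpha_op 1 * expe (- T2)).
(** The matrix of [F2]. The two left factors are diagonal, so these products reduce to single terms;
    [Y] is the counterpart in [eop] with the truncated field. *)
Let W : sop R := sop_mul (opf U) (sop_mul (opf (alpha_op 1)) (sop_exp (sop_opp v2))).

Let dU : diagonal (opf U).
Proof. exact/diagonal_expe/diagonal_T0. Qed.

Let U1 p : U p p smono1 = 1.
Proof. by rewrite expe_smono1 ?eqxx //; exact: vfop_ord1. Qed.

Let WE p q : W p q = sscale (ah ^ (- xweight p)) (sser_mul (sop_exp (sop_opp v2) p q) (U p p)).
Proof. by rewrite /W (sop_mul_diagl _ _ _ dU) sop_mul_dgl sser_mul_constr sser_mulZl mulN1r. Qed.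

Let YE p q : Y p q = sscale (ah ^ (- xweight p)) (sser_mul (expe (- T2) p q) (U p p)).
Proof.
by rewrite eopME (sop_mul_diagl _ _ _ dU) eop_dgl sser_mul_constr sser_mulZl mulN1r.
Qed.

Let W_low p q m : (mdeg m < d)%N -> W p q m = Y p q m.
Proof.
move=> md; rewrite WE YE /sscale; congr (_ * _); apply: eq_sser_mul => a b /mdegM mab.
by rewrite exp_v2; [have -> : (mdeg a == d) = false by lia|lia]; rewrite addr0.
Qed.

(** [U p p] is 1 in degree 0, so the degree d part of [v2] enters linearly, with only a power of
    alpha_0 in front. *)
Let W_top p q m : mdeg m = d -> W p q m = Y p q m - ah ^ (- xweight p) * v2 p q m.
Proof.
move=> md; pose D : sser R := fun a => if mdeg a == d then - v2 p q a else 0.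
have -> : W p q m = ah ^ (- xweight p) * sser_mul (expe (- T2) p q + D) (U p p) m.
  rewrite WE /sscale; congr (_ * _); apply: eq_sser_mul => a b /mdegM mab.
  by rewrite exp_v2 //; lia.
rewrite sser_mulDl sserDE (sser_mul_topl (f := D)); last first.
  by move=> a; rewrite md /D; case: eqP => // ->; rewrite ltnn.
by rewrite /D md eqxx U1 mulr1 mulrDr mulrN YE.
Qed.

Let F1E p m : mdeg m = d -> (F1 Psi PsiH).1 p m = expe T1 p x m + v1 p x m.
Proof. by move=> md; rewrite /F1 vf_Psi_negE /= sop_app_mon1 exp_v1. Qed.

Let F2E p : (F2 Psi PsiH).1 p = W p x.
Proof. by rewrite /F2 vf_Psi_posE (sop_exp_zero hPsi) alpha_opE /= sop_app_mon1. Qed.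

(* At a monomial m of degree d, all terms of the sewing equation except those
   linear in the coefficients Psi_j(m) only involve monomials of smaller degree,
   hence are Laurent polynomials in x and phi. *)
Lemma vf_Psi_finite p m : mdeg m = d -> v1 p x m + v2 p x m = (Theta * Y - expe T1) p x m.
Proof.
move=> md; rewrite eopDE eopNE.
suff h : (F1 Psi PsiH).1 p m = (Theta * Y) p x m - v2 p x m.
  by move: h; rewrite (F1E _ md) => h; rewrite -[v1 p x m](addKr (expe T1 p x m)) h; ring.
rewrite (F1_Theta hPsi).
have -> : (fpair_app (opf Theta) (F2 Psi PsiH)).1 p m =
  \sum_(q \in [set: xphi]) sser_mul ((F2 Psi PsiH).1 q) (Theta p q) m by [].
(* The correction of [W_top], at the monomial m only. It meets [Theta] in degree 0, which is
   diagonal, so just q = p survives and the two powers of alpha_0 cancel. *)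
pose D q : sser R := fun a => if a == m then - (ah ^ (- xweight q) * v2 q x m) else 0.
have key q : sser_mul ((F2 Psi PsiH).1 q) (Theta p q) m =
    sser_mul (Y q x) (Theta p q) m + D q m * Theta p q smono1.
  rewrite -(sser_mul_topl (f := D q)); last first.
    by move=> a am; rewrite /D; have [aem|//] := eqVneq a m; rewrite aem ltnn in am.
  rewrite -sserDE -sser_mulDl; apply: eq_sser_mul => a b ab; congr (_ * _).
  rewrite F2E sserDE /D; have [->|am] := eqVneq a m; first by rewrite W_top.
  rewrite addr0 W_low //; have := mdegM ab; have [b0|] := posnP (mdeg b); last by lia.
  have /eqP b1 : b == smono1 by rewrite -mdeg_eq0 b0.
  by move: ab; rewrite b1 => /smono_prod1r e; rewrite e eqxx in am.
have [A inA] := lf_fset m (lfMl (fun q => Theta p q) (colfinP Y x)).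
rewrite (fsumE (A := (p |` A)%fset)); last first.
  move=> q; rewrite key Theta_smono1 in_fset1U (eq_sym p q); have [//|_] := eqVneq q p.
  by rewrite mulr0 addr0 => /inA ->.
rewrite (eq_bigr _ (fun q _ => key q)).
transitivity (\sum_(q <- (p |` A)%fset) sser_mul (Y q x) (Theta p q) m +
  \sum_(q <- (p |` A)%fset) D q m * Theta p q smono1); first exact: big_split.
congr (_ + _).
  rewrite eopME sop_mulE (lsumE (A := (p |` A)%fset)) // => q /inA h.
  by rewrite in_fset1U h orbT.
rewrite (big_only (i0 := p) (fset_uniq _)) => [|q qp|]; last 2 first.
- by rewrite Theta_smono1 (eq_sym p q) (negPf qp) mulr0.
- by rewrite in_fset1U eqxx.
rewrite Theta_smono1 eqxx /D eqxx mulNr mulrAC -expfzDr ?ah_neq0 // addNr expr0z mul1r.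
by [].
Qed.

End Step.

Lemma Psi_finite d m : (mdeg m < d)%N ->
  finite_set [set j | Psi j m != 0] /\ finite_set [set j | PsiH j m != 0].
Proof.
elim: d m => [//|d IH] m; rewrite ltnS leq_eqVlt => /orP[/eqP md|]; last exact: IH.
have [_ _ h3 _ _] := hPsi; have [d0|d0] := posnP d.
  have /eqP -> : m == smono1 by rewrite -mdeg_eq0 md d0.
  by split; apply: (@sub_finite_set _ _ set0) => // j /=; have [h h'] := h3 j; rewrite ?h ?h' eqxx.
have h p := vf_Psi_finite d0 (vfield_trunc IH) p md.
set Z : eop R := Theta * _ - _ in h; have fZ := colfinP Z x m.
(* A nonzero index lies in exactly one of the two cut fields, so [Z] shows Psi_j at x^(j+1). Index 0
   lies in neither and is added by hand below. *)
have ze j : j != 0 -> Z (j + 1, false) x m = - Psi j m.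
  move=> j0; rewrite -h /vf /= addrK /cut /ltz0 /gtz0 /sscale -mulrDr mulN1r; congr (- _).
  by case: ifP; case: ifP; rewrite ?addr0 ?add0r //; lia.
have zo j : Z (j, true) x m = PsiH j m.
  rewrite -h /vf /= subrK /cut /lez0 /gtz0 /sscale -mulrDr mul1r.
  by case: ifP; case: ifP; rewrite ?addr0 ?add0r //; lia.
split.
  apply: (@sub_finite_set _ _ ([set 0] `|` ((fun p : xphi => p.1 - 1) @` [set p | Z p x m != 0]))).
    move=> j hj; have [->|j0] := eqVneq j 0; [by left|right].
    exists (j + 1, false); last by rewrite /= addrK.
    have g : Z (j + 1, false) x m != 0 by rewrite (ze j j0) oppr_eq0; exact: hj.
    exact: g.
  by rewrite finite_setU; split; [exact: finite_set1|exact: finite_image].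
apply: sub_finite_set (finite_image (fun p : xphi => p.1) fZ) => j hj.
exists (j, true); last by [].
have g : Z (j, true) x m != 0 by rewrite zo; exact: hj.
exact: g.
Qed.

Lemma vfield_Psi : vfield Psi PsiH.
Proof.
have [h1 h2 h3 _ _] := hPsi; split.
- by move=> m; have [] := Psi_finite (ltnSn (mdeg m)).
- by move=> m; have [] := Psi_finite (ltnSn (mdeg m)).
- by move=> j m hm; have [_ /(_ m hm) /negbTE] := h1 j.
- by move=> j m hm; have [_ /(_ m hm)] := h2 j.
- by move=> j; have [] := h1 j.
- by move=> j; have [] := h2 j.
- by move=> j; have [] := h3 j.
- by move=> j; have [] := h3 j.
Qed.

End Finiteness.

(** * Membership in the algebra of endomorphism-valued series *)

Section EndomorphismAlgebra.
Context {R : realType}.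
Local Notation C := R[i].
Local Notation K := {fraction {poly R[i]}}.
Local Open Scope classical_set_scope.
Implicit Types S T : eop R.

(* for each monomial, the exponents of alpha_0^(1/2) are bounded uniformly over the matrix *)
Definition ubounded T : Prop := forall m, exists N, forall p q, lbounded N (T p q m).

Lemma ubounded_seq T (s : seq smono) : ubounded T ->
  exists N, forall m, m \in s -> forall p q, lbounded N (T p q m).
Proof.
move=> hT; elim: s => [|m s [N hN]]; first by exists 0%N.
have [M hM] := hT m; exists (M + N)%N => m'; rewrite inE => /orP[/eqP ->|m's] p q.
  exact: lbounded_widen (leq_addr _ _) (hM p q).
exact: lbounded_widen (leq_addl _ _) (hN _ m's p q).
Qed.

(** A bound on exponents survives finite sums of any length, so it depends on the divisors of m but
    not on the number of intermediate monomials r. *)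
Lemma uboundedM S T : ubounded S -> ubounded T -> ubounded (S * T).
Proof.
move=> hS hT m; have [N hN] := ubounded_seq (dvs m) hS; have [M hM] := ubounded_seq (dvs m) hT.
exists (M + N)%N => p q; rewrite eopME sop_mulE.
apply: lbounded_sum => r _; rewrite (sser_mulE _ _ (sdvd_refl m)).
apply: lbounded_sum => a ha; apply: lbounded_sum => b hb.
rewrite -mulrA /sc; case: smono_prodb; last by rewrite mul0r; exact: lbounded0.
have h : lbounded (M + N) (T r q a * S p r b) by apply: lboundedM; [exact: hM|exact: hN].
by rewrite -signr_odd; case: odd; rewrite ?mulN1r ?mul1r //; exact: lboundedN.
Qed.

Lemma ubounded1 : ubounded 1.
Proof.
move=> m; exists 1%N => p q; rewrite eop1E.
by rewrite -cst_nat; exact: lbounded_cst.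
Qed.

Lemma uboundedX T k : ubounded T -> ubounded (T ^+ k).
Proof.
by move=> hT; elim: k => [|k IH]; [exact: ubounded1|rewrite exprS; exact: uboundedM].
Qed.

Lemma ubounded_expe T : ubounded T -> ubounded (expe T).
Proof.
move=> hT m.
have [N hN] : exists N, forall k, (k < (mdeg m).+1)%N -> forall p q, lbounded N ((T ^+ k) p q m).
  elim: (mdeg m).+1 => [|n [N hN]]; first by exists 0%N.
  have [M hM] := uboundedX n hT m; exists (M + N)%N => k; rewrite ltnS leq_eqVlt => /orP[/eqP ->|kn] p q.
    exact: lbounded_widen (leq_addr _ _) (hM p q).
  exact: lbounded_widen (leq_addl _ _) (hN _ kn p q).
exists (1 + N)%N => p q; rewrite expsE eop_sumE; apply: lbounded_sum => k _; rewrite eopZE.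
apply: lboundedM; last exact: hN.
rewrite -cst_invf; exact: lbounded_cst.
Qed.

(** Local finiteness enters here: at m only finitely many [e j] and [o j] are nonzero, so one bound
    serves all j. The summand 2 covers the numerical factors. *)
Lemma ubounded_vf (e o : int -> sser R) (h : vfield e o) : ubounded (vfop h).
Proof.
move=> m; have [he ho _ _ le lo _ _] := h.
have bnd (f : int -> sser R) : lf f -> (forall j, laurent_sser (f j)) ->
    exists N, forall j, lbounded N (f j m).
  move=> lff lauf; have [A inA] := lf_fset m lff.
  have [N hN] : exists N, forall j, j \in enum_fset A -> lbounded N (f j m).
    elim: (enum_fset A) => [|j s [N hN]]; first by exists 0%N.
    have /lboundedP[M hM] := lauf j m; exists (M + N)%N => j'; rewrite inE => /orP[/eqP ->|js].
      exact: lbounded_widen (leq_addr _ _) hM.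
    exact: lbounded_widen (leq_addl _ _) (hN _ js).
  exists N => j; have [->|/inA/hN//] := eqVneq (f j m) 0; exact: lbounded0.
have [N hN] := bnd e he le; have [M hM] := bnd o ho lo.
have hN' (c : K) j : lbounded 2 c -> lbounded (2 + (M + N)) (c * e j m).
  by move=> hc; apply: lboundedM => //; exact: lbounded_widen (leq_addl _ _) (hN j).
have hM' (c : K) j : lbounded 2 c -> lbounded (2 + (M + N)) (c * o j m).
  by move=> hc; apply: lboundedM => //; exact: lbounded_widen (leq_addr _ _) (hM j).
have li (n : int) : lbounded 2 (n%:~R : K) by rewrite -cst_int; exact: lbounded_cst.
exists (2 + (M + N))%N => p q; rewrite /= /vf /sscale; case: q.2; case: p.2.
- apply/hN'/lboundedN/lboundedD; first exact: li.
  by rewrite -cstV2 -cst_int -cstM; exact: lbounded_cst.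
- by rewrite sserNE -mulN1r; apply/hM'/lboundedN; exact: (li 1).
- exact/hM'/li.
- exact/hN'/lboundedN/li.
Qed.

Lemma in_end_alg_evenP T : ubounded T -> evenop (opf T) -> in_end_alg_even (opf T).
Proof.
move=> uT eT; split; last by move=> m p q; exact: eT.
move=> m; have [N hN] := uT m.
have /choice[P hP] : forall pq : xphi * xphi, exists P : {poly C},
    (size P <= N.*2)%N /\ T pq.1 pq.2 m * ah ^+ N = tofrac P.
  by move=> [p q]; have [P sP hP] := hN p q; exists P.
exists N, (fun k p q => (P (p, q))`_k); split.
  (* [tofrac] is injective, so a zero entry has the zero polynomial, and each coefficient inherits
     the finite columns of [T]. *)
  move=> k q; apply: sub_finite_set (colfinP T q m) => p /=; apply: contraNneq => T0.
  have [_ /= ] := hP (p, q); rewrite T0 mul0r => /esym/eqP; rewrite tofrac_eq0 => /eqP ->.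
  by rewrite coef0.
by move=> p q; have [sP] := hP (p, q); exact: lbounded_expand.
Qed.

End EndomorphismAlgebra.

(** * The operator identity *)

Section OperatorIdentity.
Context {R : realType} (Psi PsiH : int -> sser R) (hPsi : sewing_solution Psi PsiH).
Local Notation K := {fraction {poly R[i]}}.

Definition TN : eop R := vfop (vfield_cut ltz0 lez0 (vfield_Psi hPsi)).
Definition TP : eop R := vfop (vfield_cut gtz0 gtz0 (vfield_Psi hPsi)).

Lemma sop_exp_Psi_neg : sop_exp (vf_Psi_neg Psi PsiH) = opf (expe TN).
Proof. by rewrite vf_Psi_negE (sop_exp_vf (vfield_cut ltz0 lez0 (vfield_Psi hPsi))). Qed.

Lemma sop_exp_Psi_pos : sop_exp (vf_Psi_pos Psi PsiH) = opf (expe TP).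
Proof. by rewrite vf_Psi_posE (sop_exp_vf (vfield_cut gtz0 gtz0 (vfield_Psi hPsi))). Qed.

Definition F2op : eop R := expe (T0 hPsi (-2)) * (alpha_op 1 * expe (- TP)).

Lemma F1E : F1 Psi PsiH = fpair_app (opf (expe TN)) (@id_pair R).
Proof. by rewrite /F1 sop_exp_Psi_neg. Qed.

Lemma F2E : F2 Psi PsiH = fpair_app (opf F2op) (@id_pair R).
Proof.
rewrite /F2 (sop_exp_zero hPsi) alpha_opE vf_Psi_posE.
by rewrite (sop_exp_vfN (vfield_cut gtz0 gtz0 (vfield_Psi hPsi))).
Qed.

Lemma F2op_Theta : expe TN = Theta * F2op.
Proof.
have mF : multop (opf F2op).
  apply: multopM; first exact: multop_exp_vf.
  by apply: multopM; [exact: multop_alpha|exact: multop_exp_vfN].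
have lF : lau (opf F2op).
  apply: lauM; first exact: lau_exp_vf.
  by apply: lauM; [exact: lau_alpha|exact: lau_exp_vfN].
suff h : opf (expe TN) = opf (Theta * F2op) by exact: val_inj.
apply: multop_inj; [exact: multop_exp_vf|exact: lau_exp_vf| | |].
- exact: multopM multop_Theta mF.
- exact: lauM lau_Theta lF.
- rewrite (eopME Theta) (fpair_app_mul _ (colfinP _) (lf_id1 (R := R)) (lf_id2 (R := R))).
  by rewrite -F2E -F1E F1_Theta.
Qed.

(** [F2op_Theta] multiplied on the right by the inverse of [F2op], whose three factors are
    invertible one by one. *)
Lemma sewing_identity :
  Theta = expe TN * (expe TP * (alpha_op (-1) * expe (T0 hPsi 2))).
Proof.
have key (t u a v e a' u' : eop R) : v * e = 1 -> a * a' = 1 -> u * u' = 1 ->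
    t * (u * (a * v)) * (e * (a' * u')) = t.
  move=> ve aa uu; rewrite -(mulrA t) -(mulrA u) -(mulrA a) (mulrA v) ve mul1r.
  by rewrite (mulrA a) aa mul1r uu mulr1.
have oP : ord 1 TP by exact: vfop_ord1.
have oZ : ord 1 (T0 hPsi (-2)) by exact: vfop_ord1.
have T02 : T0 hPsi 2 = - T0 hPsi (-2) by rewrite -T0N.
rewrite F2op_Theta T02; apply/esym/key.
- exact: expeNl oP.
- by rewrite alpha_opM subrr alpha_op0.
- exact: expeN oZ.
Qed.

End OperatorIdentity.

(** * Leading terms *)

Section LeadingTerms.
Context {R : realType}.
Local Notation K := {fraction {poly R[i]}}.
Local Open Scope classical_set_scope.
Implicit Types (X Y S T : eop R) (e o : int -> sser R).

Let x : xphi := (1, false).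

Definition rho_op (s : bool) T : sop R := fun p q m => if smono_deg s m == 0%N then T p q m else 0.

Lemma colfin_rho s T : colfin (rho_op s T).
Proof.
move=> q m; apply: sub_finite_set (colfinP T q m) => p /=; rewrite /rho_op.
by case: (smono_deg s m == 0%N) => [h|]; [exact: h|rewrite eqxx].
Qed.

(* setting the variables of side s to 0 *)
Definition rho (s : bool) T : eop R := mk_eop (colfin_rho s T).

Lemma rhoE s T p q m : rho s T p q m = if smono_deg s m == 0%N then T p q m else 0.
Proof. by []. Qed.

Lemma rho_eq0 s T : (forall p q m, smono_deg s m = 0%N -> T p q m = 0) -> rho s T = 0.
Proof. by move=> h; apply: eopP => p q m; rewrite rhoE; case: eqP => // /h ->. Qed.

Lemma rho_id s T : (forall p q m, smono_deg s m != 0%N -> T p q m = 0) -> rho s T = T.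
Proof. by move=> h; apply: eopP => p q m; rewrite rhoE; case: eqP => // /eqP/h ->. Qed.

(** The degree on side s is additive and nonnegative, so it vanishes on a product exactly when it
    vanishes on both factors. *)
Lemma rhoM s X Y : rho s (X * Y) = rho s X * rho s Y.
Proof.
apply: eopP => p q m; rewrite rhoE !eopME !sop_mulE; have [m0|m0] := eqVneq (smono_deg s m) 0%N.
  apply: eq_fsbigr => r _; apply: eq_sser_mul => a b /(smono_degM s).
  by rewrite !rhoE m0 => /esym/eqP; rewrite addn_eq0 => /andP[-> ->].
apply/esym/fsbig1 => r _; apply/eqP/negPn/negP => /sser_mul_neq0[a [b [/(smono_degM s) ab]]].
rewrite !rhoE; have [a0|_] := eqVneq (smono_deg s a) 0%N; last by rewrite eqxx.
have [b0|_] := eqVneq (smono_deg s b) 0%N; last by rewrite eqxx.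
by rewrite ab a0 b0 in m0.
Qed.

Lemma rho1 s : rho s 1 = 1.
Proof.
apply: rho_id => p q m; rewrite eop1E; have [->|_] := eqVneq m smono1; last by rewrite andbF.
by rewrite smono_deg1.
Qed.

Lemma rhoN s X : rho s (- X) = - rho s X.
Proof. by apply: eopP => p q m; rewrite eopNE !rhoE; case: eqP; rewrite ?oppr0 // eopNE. Qed.

Lemma rhoX s X k : rho s (X ^+ k) = rho s X ^+ k.
Proof. by elim: k => [|k IH]; [exact: rho1|rewrite !exprS rhoM IH]. Qed.

Lemma rho_expe s X : rho s (expe X) = expe (rho s X).
Proof.
apply: eopP => p q m; rewrite rhoE !expsE !eop_sumE; case: ifP => m0.
  by apply: eq_bigr => k _; rewrite !eopZE -rhoX rhoE m0.
by rewrite big1 // => k _; rewrite eopZE -rhoX rhoE m0 mulr0.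
Qed.

Lemma rho_ord s k X : ord k X -> ord k (rho s X).
Proof. by move=> h m mk p q; rewrite rhoE h // if_same. Qed.

Lemma rho_alpha s t : rho s (alpha_op t) = alpha_op t.
Proof.
apply: rho_id => p q m m0; rewrite /= /dg /sconst; case: (p == q) => //.
by case: eqP => // m1; rewrite m1 smono_deg1 in m0.
Qed.

(** In the difference of two powers of exponent at least 2, each telescoped term has a factor T - S
    of order d and at least one more factor of order 1. *)
Lemma expe_sub d T S : (0 < d)%N -> ord 1 T -> ord 1 S -> ord d (T - S) ->
  ord d.+1 (expe T - expe S - (T - S)).
Proof.
move=> d0 oT oS oTS.
have hX k : ord d (T ^+ k.+1 - S ^+ k.+1).
  elim: k => [|k IH]; first by rewrite !expr1.
  by rewrite exprS [S ^+ _]exprS; apply: ord_subM.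
have hX2 k : ord d.+1 (T ^+ k.+2 - S ^+ k.+2).
  have -> : T ^+ k.+2 - S ^+ k.+2 = T * (T ^+ k.+1 - S ^+ k.+1) + (T - S) * S ^+ k.+1.
    by rewrite mulrBr mulrBl addrA subrK -!exprS.
  apply: ordD; first by rewrite -add1n; apply: ordM.
  by rewrite -addn1; apply: ordM => //; rewrite exprS; exact: ordMr.
have h : ord d.+1 (exps_trunc d (fun k => T ^+ k) - exps_trunc d (fun k => S ^+ k) - (T - S)).
  (* For d > 0 the truncation contains the term k = 1, which cancels against T - S. *)
  case: d d0 hX2 {oTS hX} => // d _ hX2.
  rewrite /exps_trunc -sumrB 2!big_ord_recl /= !expr0 subrr add0r.
  rewrite (_ : bump 0 0 = 1%N) // (_ : 1`! = 1%N) // invr1 !scale1r !expr1.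
  rewrite addrAC subrr add0r; apply: ord_sum => k _; rewrite -scalerBr; apply: ordZ.
  exact: hX2.
have hT : ord d.+1 (expe T - exps_trunc d (fun k => T ^+ k)) by exact/exps_truncP/filtX.
have hS : ord d.+1 (expe S - exps_trunc d (fun k => S ^+ k)) by exact/exps_truncP/filtX.
have key (a b c a' b' : eop R) : a - b - c = (a - a') - (b - b') + (a' - b' - c).
  by apply: eopP => p q m; rewrite !(eopDE, eopNE); ring.
rewrite (key _ _ _ (exps_trunc d (fun k => T ^+ k)) (exps_trunc d (fun k => S ^+ k))).
by apply: ordD h; apply: ordB.
Qed.

Lemma expe_sub1 d T : (0 < d)%N -> ord 1 T -> ord d T -> ord d.+1 (expe T - (1 + T)).
Proof.
move=> d0 oT odT; have oT0 : ord d (T - 0) by rewrite subr0.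
by have := expe_sub d0 oT (@ord_zero R 1) oT0; rewrite expe0 subr0 opprD addrA.
Qed.

Lemma ord_ind0 X : ord 1 X -> (forall d, (0 < d)%N -> ord d X -> ord d.+1 X) -> X = 0.
Proof.
move=> o1 h; apply: eop_ord_eq => d; rewrite subr0; case: d => [//|d].
by elim: d => [//|d IH]; exact: h.
Qed.

Lemma ordS d X : ord d X -> (forall m, mdeg m = d -> forall p q, X p q m = 0) -> ord d.+1 X.
Proof.
by move=> oX h m; rewrite ltnS leq_eqVlt => /orP[/eqP/h//|/oX].
Qed.

(** If T - S has order d, equality of the exponentials and [expe_sub] raise this to d + 1. *)
Lemma expe_inj T S : ord 1 T -> ord 1 S -> expe T = expe S -> T = S.
Proof.
move=> oT oS h; apply/eqP; rewrite -subr_eq0; apply/eqP; apply: ord_ind0; first exact: ordB.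
move=> d d0 od; have := expe_sub d0 oT oS od; rewrite h subrr add0r => /ordN.
by rewrite opprK.
Qed.

Lemma expe_conj g h T : g * h = 1 -> h * g = 1 -> ord 1 T ->
  expe (h * T * g) = h * expe T * g.
Proof.
move=> gh hg oT.
have cX k : (h * T * g) ^+ k = h * T ^+ k * g.
  elim: k => [|k IH]; first by rewrite !expr0 mulr1 hg.
  by rewrite exprS IH -!mulrA (mulrA g h) gh mul1r exprS !mulrA.
have oc : ord 1 (h * T * g) by apply/ordMr/ordMl.
apply/esym/exps_uniq => [|d]; first exact: filtX.
have -> : exps_trunc d (fun k => (h * T * g) ^+ k) = h * exps_trunc d (fun k => T ^+ k) * g.
  rewrite /exps_trunc mulr_sumr mulr_suml; apply: eq_bigr => k _.
  by rewrite cX -scalerAr -scalerAl.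
by rewrite -mulrBl -mulrBr; apply/ordMr/ordMl/exps_truncP/filtX.
Qed.

Lemma vf_colx0 e o j m : vf e o (j + 1, false) x m = - e j m.
Proof. by rewrite /vf /= addrK /sscale mulN1r. Qed.

Lemma vf_colx1 e o j m : vf e o (j, true) x m = o j m.
Proof. by rewrite /vf /= subrK /sscale mul1r. Qed.

End LeadingTerms.

(** * Leading terms from the boundary conditions and the operator identity *)

Section SewingLeadingTerms.
Context {R : realType} (Psi PsiH : int -> sser R) (hPsi : sewing_solution Psi PsiH).
Local Notation K := {fraction {poly R[i]}}.

Let x : xphi := (1, false).

Lemma fpair_id1 (T : sop R) p : (fpair_app T (@id_pair R)).1 p = T p x.
Proof. by rewrite -[LHS]/(sop_app T (fser_mon 1 x) p) sop_app_mon1. Qed.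

Lemma vf_col_eq (e o e' o' : int -> sser R) m :
  (forall p, vf e o p x m = vf e' o' p x m) ->
  (forall j, e j m = e' j m) /\ (forall j, o j m = o' j m).
Proof.
move=> h; split=> j; last by have := h (j, true); rewrite !vf_colx1.
by have := h (j + 1, false); rewrite !vf_colx0 => /oppr_inj.
Qed.

Lemma vf_col0_eq (e o : int -> sser R) m : (forall p, vf e o p x m = 0) ->
  (forall j, e j m = 0) /\ (forall j, o j m = 0).
Proof.
move=> h; split=> j; last by have := h (j, true); rewrite vf_colx1.
by have := h (j + 1, false); rewrite vf_colx0 => /eqP; rewrite oppr_eq0 => /eqP.
Qed.

Let oN : ord 1 (TN hPsi). Proof. exact: vfop_ord1. Qed.
Let oP : ord 1 (TP hPsi). Proof. exact: vfop_ord1. Qed.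
Let oZ c : ord 1 (T0 hPsi c). Proof. exact: vfop_ord1. Qed.

(** The boundary condition on [F1] says that exp([rho true] TN) fixes x. In the lowest possible
    degree exp is 1 + TN, so the column of x of TN vanishes there, and with it every coefficient. *)
Lemma rho_TN : rho true (TN hPsi) = 0.
Proof.
apply: ord_ind0 => [|d d0 od]; first exact: rho_ord.
have h := expe_sub1 d0 (rho_ord true oN) od.
apply: ordS od _ => m md p q; rewrite rhoE; case: eqP => // m0.
have [_ _ _ _ [b _]] := hPsi.
have col p' : TN hPsi p' x m = 0.
  have := h m _ p' x; rewrite md ltnSn => /(_ isT).
  rewrite eopDE eopNE eopDE -rho_expe !rhoE m0 eqxx.
  have [b1 _] := b p' m m0; move: b1; rewrite (F1E hPsi) fpair_id1 => ->.
  have -> : (@id_pair R).1 p' m = (1 : eop R) p' x m.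
    by rewrite eop1E /= /fser_mon; case: (_ && _).
  by rewrite opprD addrA subrr sub0r => /eqP; rewrite oppr_eq0 => /eqP.
by have [he ho] := vf_col0_eq col; apply: vf_vanish.
Qed.

Lemma T0_xx c m : T0 hPsi c x x m = - (c%:~R * Psi 0 m).
Proof. by rewrite /= /vf /= subrr /sscale /delta0 eqxx mulN1r. Qed.

Lemma T0_vanish c m : Psi 0 m = 0 -> forall p q, T0 hPsi c p q m = 0.
Proof.
move=> h p q; apply: vf_vanish => // j; rewrite /delta0; case: eqP => // _.
by rewrite /sscale h mulr0.
Qed.

Lemma T0_xx_eq0 (c : int) m : c != 0 -> T0 hPsi c x x m = 0 -> Psi 0 m = 0.
Proof.
move=> c0; rewrite T0_xx => /eqP; rewrite oppr_eq0 mulf_eq0 => /orP[|/eqP//].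
have -> : (c%:~R : K) = Defs.cst c%:~R by rewrite cst_int.
by rewrite /Defs.cst tofrac_eq0 polyC_eq0 intr_eq0 (negPf c0).
Qed.

Lemma TP_xx m : TP hPsi x x m = 0.
Proof. by rewrite /= /vf /= subrr /sscale /cut /gtz0 /= mulr0. Qed.

Lemma alpha_mull t (T : eop R) p q m : (alpha_op t * T) p q m = ah ^ (- t * xweight p) * T p q m.
Proof. by rewrite eop_dgl sser_mul_constr. Qed.

Lemma alpha_mulr t (T : eop R) p q m : (T * alpha_op t) p q m = ah ^ (- t * xweight q) * T p q m.
Proof. by rewrite eop_dgr sser_mul_constl. Qed.

Lemma alphaE t p q m : alpha_op t p q m =
  if (p == q) && (m == smono1) then ah ^ (- t * xweight q) else 0 :> K.
Proof. by rewrite /= /dg /sconst; case: (p == q). Qed.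

(** The boundary condition on [F2] gives only one linear relation between the two fields in degree d
    + 1, so they are treated together. Its x entry involves Psi_0 alone, because [TP] has no index
    0; once Psi_0 is known to vanish, the other entries give [TP]. *)
Lemma ord_T0_TP d : ord d.+1 (rho false (T0 hPsi (-2))) /\ ord d.+1 (rho false (TP hPsi)).
Proof.
elim: d => [|d [od0 od2]]; first by split; apply: rho_ord.
set X0 := rho _ (T0 _ _) in od0 *; set X2 := rho _ (TP _) in od2 *.
have o0 : ord 1 X0 by exact: rho_ord.
have o2 : ord 1 X2 by exact: rho_ord.
have h0 := expe_sub1 (ltn0Sn d) o0 od0.
have h2 := expe_sub1 (ltn0Sn d) (ordN o2) (ordN od2).
have hprod : ord d.+2 (expe X0 * (alpha_op 1 * expe (- X2)) - (1 + X0) * (alpha_op 1 * (1 - X2))).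
  by apply: (ord_subM h0); rewrite -mulrBr; exact: ordMl.
have key : (1 + X0) * (alpha_op 1 * (1 - X2)) =
    alpha_op 1 + (X0 * alpha_op 1 - alpha_op 1 * X2) - X0 * (alpha_op 1 * X2).
  rewrite mulrDl mul1r mulrBr mulr1 mulrBr.
  by apply: eopP => p q m; rewrite !(eopDE, eopNE); ring.
have o02 : ord d.+2 (X0 * (alpha_op 1 * X2)) by rewrite -addn1; apply/ordM/ordMl.
have hF : rho false (F2op hPsi) = expe X0 * (alpha_op 1 * expe (- X2)).
  by rewrite /F2op !rhoM !rho_expe rho_alpha rhoN.
have [_ _ _ _ [_ b]] := hPsi.
have col m p : mdeg m = d.+1 -> smono_deg false m = 0%N ->
    ah ^ (- 2) * T0 hPsi (-2) p x m - ah ^ (- xweight p) * TP hPsi p x m = 0.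
  move=> md m0; have [b1 _] := b p m m0.
  have := hprod m _ p x; rewrite md ltnSn => /(_ isT).
  rewrite -hF key !(eopDE, eopNE) rhoE m0 eqxx (o02 m) ?md // oppr0 addr0.
  rewrite alpha_mull alpha_mulr !rhoE m0 eqxx.
  move: b1; rewrite (F2E hPsi) fpair_id1 => ->.
  have -> : (fser_mon (ah ^- 2) (1, false), fser_mon ah^-1 (0, true)).1 p m = alpha_op 1 p x m :> K.
    by rewrite alphaE /= /fser_mon /xweight /= mulr1 addr0 mulN1r -exprnN.
  rewrite opprD addrA subrr sub0r !mulN1r => /eqP; rewrite oppr_eq0 => /eqP.
  by rewrite {1}/xweight /= mulr1 addr0.
have zero m : mdeg m = d.+1 -> smono_deg false m = 0%N ->
    (forall p q, T0 hPsi (-2) p q m = 0) /\ (forall p q, TP hPsi p q m = 0).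
  move=> md m0; have P0 : Psi 0 m = 0.
    apply: (@T0_xx_eq0 (-2)) => //; have := col m x md m0; rewrite TP_xx mulr0 subr0 => /eqP.
    by rewrite mulf_eq0 expfz_eq0 (negPf ah_neq0) andbF => /eqP.
  split; first exact: T0_vanish.
  have c2 p : TP hPsi p x m = 0.
    have := col m p md m0; rewrite T0_vanish // mulr0 sub0r => /eqP.
    by rewrite oppr_eq0 mulf_eq0 expfz_eq0 (negPf ah_neq0) andbF => /eqP.
  have [he ho] := vf_col0_eq c2.
  by move=> p q; apply: vf_vanish.
split.
  by apply: ordS od0 _ => m md p q; rewrite rhoE; case: eqP => // m0; have [h _] := zero m md m0.
by apply: ordS od2 _ => m md p q; rewrite rhoE; case: eqP => // m0; have [_ h] := zero m md m0.
Qed.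

Lemma rho_TP : rho false (TP hPsi) = 0.
Proof. by apply: eop_ord_eq => d; rewrite subr0; have [_] := ord_T0_TP d; exact: ord_le. Qed.

Lemma rho_T0 : rho false (T0 hPsi 2) = 0.
Proof.
have -> : T0 hPsi 2 = - T0 hPsi (-2) by rewrite -T0N.
rewrite rhoN; apply: eop_ord_eq => d; rewrite subr0.
by apply: ordN; have [h _] := ord_T0_TP d; exact: ord_le h.
Qed.

Lemma posfam_eq0 (E : nat -> sser R) j m : (forall k, E k m = 0) -> posfam E j m = 0.
Proof. by move=> h; rewrite /posfam; case: (1 <= j); [exact: h|]. Qed.

Lemma rho_TA : rho false (TA : eop R) = 0.
Proof.
apply: rho_eq0 => p q m m0; apply: vf_vanish => j; apply: posfam_eq0 => k.
  by apply: (@even_var_eq0 _ _ false); rewrite m0.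
by apply: (@odd_var_eq0 _ _ false); rewrite m0.
Qed.

Lemma rho_TA_id : rho true (TA : eop R) = TA.
Proof.
apply: rho_id => p q m m0; apply: vf_vanish => j; apply: posfam_eq0 => k.
  exact: (@even_var_eq0 _ _ true).
exact: (@odd_var_eq0 _ _ true).
Qed.

Lemma rho_TB : rho true (TB : eop R) = 0.
Proof.
apply: rho_eq0 => p q m m0; apply: vf_vanish => j; apply: posfam_eq0 => k.
  by apply: (@even_var_eq0 _ _ true); rewrite m0.
by apply: (@odd_var_eq0 _ _ true); rewrite m0.
Qed.

Lemma rho_TB_id : rho false (TB : eop R) = TB.
Proof.
apply: rho_id => p q m m0; apply: vf_vanish => j; apply: posfam_eq0 => k.
  exact: (@even_var_eq0 _ _ false).
exact: (@odd_var_eq0 _ _ false).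
Qed.

Let oA : ord 1 (TA : eop R). Proof. exact: vfop_ord1. Qed.
Let oB : ord 1 (TB : eop R). Proof. exact: vfop_ord1. Qed.

Lemma sewing_mod_BN : expe (- TA) * alpha_op (-1) =
  expe (rho true (TP hPsi)) * (alpha_op (-1) * expe (rho true (T0 hPsi 2))).
Proof.
have := congr1 (rho true) (sewing_identity hPsi); rewrite /Theta !rhoM !rho_expe !rhoN.
by rewrite rho_TA_id rho_TB rho_TN rho_alpha oppr0 expe0 mulr1 mul1r.
Qed.

Lemma sewing_mod_AM : alpha_op (-1) * expe (- TB) = expe (rho false (TN hPsi)) * alpha_op (-1).
Proof.
have := congr1 (rho false) (sewing_identity hPsi); rewrite /Theta !rhoM !rho_expe !rhoN.
by rewrite rho_TA rho_TB_id rho_TP rho_T0 rho_alpha oppr0 expe0 mul1r mul1r mulr1.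
Qed.

Lemma TA_xx m : (TA : eop R) x x m = 0.
Proof. by rewrite /= /vf /= subrr /sscale /posfam /= mulr0. Qed.

(** Two unknown exponentials stand on the right of [sewing_mod_BN], so injectivity of exp is not
    enough. In the next degree the equation becomes linear; its x entry involves Psi_0 alone, since
    neither [TA] nor [TP] has index 0, and the rest identifies [TP] with - [TA]. *)
Lemma ord_TP_TA d : ord d.+1 (- TA - rho true (TP hPsi)) /\ ord d.+1 (rho true (T0 hPsi 2)).
Proof.
elim: d => [|d [odD od0]].
  by split; [apply: ordB; [exact: ordN|exact: rho_ord]|exact: rho_ord].
set Y2 := rho _ (TP _) in odD *; set Y0 := rho _ (T0 _ _) in od0 *.
have o0 : ord 1 Y0 by exact: rho_ord.
have o2 : ord 1 Y2 by exact: rho_ord.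
have h0 := expe_sub1 (ltn0Sn d) o0 od0.
have hD := expe_sub (ltn0Sn d) (ordN oA) o2 odD.
have e1 : ord 1 (expe Y2 - 1).
  move=> m; rewrite ltnS leqn0 mdeg_eq0 => /eqP -> p q.
  by rewrite eopDE eopNE expe_smono1 // eop1E eqxx andbT subrr.
have e0 : ord d.+1 (expe Y0 - 1).
  have -> : expe Y0 - 1 = (expe Y0 - (1 + Y0)) + Y0 by rewrite opprD addrA subrK.
  by apply: ordD od0; exact: ord_le h0.
(* By the exact identity below, the linear part equals a product of factors of orders 1 and d + 1
   plus the remainders of two exponentials, all of order d + 2. *)
have hdiff : ord d.+2 ((- TA - Y2) * alpha_op (-1) - alpha_op (-1) * Y0).
  have -> : (- TA - Y2) * alpha_op (-1) - alpha_op (-1) * Y0 =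
     (expe Y2 - 1) * (alpha_op (-1) * (expe Y0 - 1)) + alpha_op (-1) * (expe Y0 - (1 + Y0)) -
     (expe (- TA) - expe Y2 - (- TA - Y2)) * alpha_op (-1).
    rewrite [X in _ = _ - X]mulrBl [X in _ = _ - (X - _)]mulrBl sewing_mod_BN -/Y2 -/Y0.
    rewrite [X in _ = X + _ - _]mulrBl mul1r !mulrBr !mulr1 mulrDr mulr1.
    by apply: eopP => p q m; rewrite !(eopDE, eopNE); ring.
  apply: ordB; last exact: ordMr.
  apply: ordD; last exact: ordMl.
  by rewrite -add1n; apply: ordM e1 _; exact: ordMl.
have col m p : mdeg m = d.+1 -> smono_deg true m = 0%N ->
    ah ^ 2 * (- TA - TP hPsi) p x m - ah ^ (xweight p) * T0 hPsi 2 p x m = 0.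
  move=> md m0; have := hdiff m _ p x; rewrite md ltnSn => /(_ isT).
  rewrite eopDE eopNE alpha_mull alpha_mulr opprK !mul1r !eopDE !eopNE !rhoE m0 eqxx.
  by rewrite /xweight.
have zero m : mdeg m = d.+1 -> smono_deg true m = 0%N ->
    (forall p q, T0 hPsi 2 p q m = 0) /\ (forall p q, (- TA : eop R) p q m = TP hPsi p q m).
  move=> md m0; have P0 : Psi 0 m = 0.
    apply: (@T0_xx_eq0 2) => //; have := col m x md m0.
    rewrite eopDE !eopNE TA_xx TP_xx oppr0 addr0 mulr0 sub0r => /eqP.
    by rewrite oppr_eq0 mulf_eq0 expfz_eq0 (negPf ah_neq0) andbF => /eqP.
  split; first exact: T0_vanish.
  have c2 p : (- TA : eop R) p x m = TP hPsi p x m.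
    have := col m p md m0; rewrite T0_vanish // mulr0 subr0 => /eqP.
    rewrite mulf_eq0 expfz_eq0 (negPf ah_neq0) andbF => /eqP.
    by rewrite eopDE [X in _ + X]eopNE => /eqP; rewrite subr_eq0 => /eqP.
  move: c2; rewrite -(vfopN (vfield_pos false)) => c2.
  have [he ho] := vf_col_eq c2.
  by move=> p q; apply: vf_congr.
split; apply: ordS => // m md p q.
  rewrite eopDE [X in _ + X]eopNE /Y2 rhoE; case: eqP => m0; first by have [_ ->] := zero m md m0; rewrite subrr.
  by rewrite oppr0 addr0 -rho_TA_id -rhoN rhoE; case: eqP.
by rewrite /Y0 rhoE; case: eqP => // m0; have [h _] := zero m md m0.
Qed.

Lemma Psi_mod_BN m : smono_deg true m = 0%N ->
  [/\ Psi 0 m = 0,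
      forall j, gtz0 j -> Psi j m = - posfam (even_var R false) j m /\
                          PsiH j m = - posfam (odd_var R false) j m,
      forall j, ltz0 j -> Psi j m = 0 & forall j, lez0 j -> PsiH j m = 0].
Proof.
move=> m0; have [hT h0] := ord_TP_TA (mdeg m).
have z0 : T0 hPsi 2 x x m = 0 by have := h0 m (ltnSn _) x x; rewrite rhoE m0.
have zT p : vf (fun j => - posfam (even_var R false) j) (fun j => - posfam (odd_var R false) j) p x m =
    vf (cut gtz0 Psi) (cut gtz0 PsiH) p x m.
  rewrite -vf_sop_opp; have := hT m (ltnSn _) p x.
  rewrite eopDE !eopNE rhoE m0 eqxx => /eqP; rewrite subr_eq0 => /eqP.
  by [].
have [he ho] := vf_col_eq zT.
have zN p : vf (cut ltz0 Psi) (cut lez0 PsiH) p x m = 0.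
  have : rho true (TN hPsi) p x m = 0 by rewrite rho_TN.
  by rewrite rhoE m0.
have [he' ho'] := vf_col0_eq zN.
split.
- exact: (@T0_xx_eq0 2).
- by move=> j j1; have := he j; have := ho j; rewrite /cut j1 !sserNE.
- by move=> j j1; have := he' j; rewrite /cut j1.
- by move=> j j1; have := ho' j; rewrite /cut j1.
Qed.

(** Conjugation by alpha_0^{-L_0} multiplies the entry from x to x^n phi^b by the power 2n + b - 2
    of alpha_0^(1/2). At (j + 1, 0) and (j, 1) the exponent is 2j and 2j - 1, the origin of
    alpha_0^{-j} and alpha_0^{-j+1/2}. Both sides are single exponentials, so [expe_inj] applies. *)
Lemma Psi_mod_AM m : smono_deg false m = 0%N ->
  [/\ Psi 0 m = 0,
      forall j, gtz0 j -> Psi j m = 0 /\ PsiH j m = 0,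
      forall j, ltz0 j -> Psi j m = - (ah ^ (2 * j) * negfam 0 (even_var R true) j m) &
      forall j, lez0 j -> PsiH j m = - (ah ^ (2 * j - 1) * negfam 1 (odd_var R true) j m)].
Proof.
move=> m0.
have z0 : T0 hPsi 2 x x m = 0.
  have : rho false (T0 hPsi 2) x x m = 0 by rewrite rho_T0.
  by rewrite rhoE m0.
have zT p : vf (cut gtz0 Psi) (cut gtz0 PsiH) p x m = 0.
  have : rho false (TP hPsi) p x m = 0 by rewrite rho_TP.
  by rewrite rhoE m0.
have [he ho] := vf_col0_eq zT.
have a1 : alpha_op 1 * alpha_op (-1) = 1 :> eop R by rewrite alpha_opM subrr alpha_op0.
have a2 : alpha_op (-1) * alpha_op 1 = 1 :> eop R by rewrite alpha_opM addNr alpha_op0.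
have conj : alpha_op (-1) * (- TB) * alpha_op 1 = rho false (TN hPsi).
  apply: expe_inj; [by apply/ordMr/ordMl/ordN|exact: rho_ord|].
  rewrite (expe_conj a1 a2); last exact: ordN.
  by rewrite sewing_mod_AM -mulrA a2 mulr1.
have zN p : vf (cut ltz0 Psi) (cut lez0 PsiH) p x m =
    ah ^ (xweight p - 2) * - vf (negfam 0 (even_var R true)) (negfam 1 (odd_var R true)) p x m.
  have : rho false (TN hPsi) p x m = vf (cut ltz0 Psi) (cut lez0 PsiH) p x m by rewrite rhoE m0.
  move=> <-; rewrite -conj alpha_mulr alpha_mull eopNE mulrA -expfzDr ?ah_neq0 //.
  by congr (ah ^ _ * _); rewrite {1}/xweight /=; lia.
split.
- exact: (@T0_xx_eq0 2).
- by move=> j j1; have := he j; have := ho j; rewrite /cut j1.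
- move=> j j1; have := zN (j + 1, false); rewrite !vf_colx0 /cut j1 opprK => /eqP.
  rewrite eqr_oppLR => /eqP ->; congr (- (ah ^ _ * _)); rewrite /xweight /=; lia.
- move=> j j1; have := zN (j, true); rewrite !vf_colx1 /cut j1 mulrN => ->.
  by congr (- (ah ^ _ * _)); rewrite /xweight /=; lia.
Qed.

End SewingLeadingTerms.

Theorem proposition3p28 (R : realType) (Psi PsiH : int -> sser R)
    (hPsi : sewing_solution Psi PsiH) :
  (exists P PH : int -> sser R,
     (forall j : int, mixed (P j) /\ mixed (PH j)) /\
     (forall j : nat, (1 <= j)%N ->
        [/\ forall m, Psi j%:Z m = - varA j m + P j%:Z m,
            forall m, PsiH j%:Z m = - varM j m + PH j%:Z m,
            forall m, Psi (- j%:Z) m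
              = - (ah ^ (- (2 * j%:Z)) * varB j m) + P (- j%:Z) m &
            forall m, PsiH (1 - j%:Z) m
              = - (ah ^ (1 - 2 * j%:Z) * varN j m) + PH (1 - j%:Z) m]) /\
     (forall m, Psi 0 m = 0 + P 0 m)) /\
  in_end_alg_even (sop_exp (vf_Psi_neg Psi PsiH)) /\
  in_end_alg_even (sop_exp (vf_Psi_pos Psi PsiH)) /\
  sop_mul exp_AM (sop_mul (alpha_2L0 (-1)) exp_BN)
    = sop_mul (sop_exp (vf_Psi_neg Psi PsiH))
        (sop_mul (sop_exp (vf_Psi_pos Psi PsiH))
           (sop_mul (alpha_2L0 (-1)) (sop_exp (vf_zero 2 (Psi 0))))).
Proof.
split; last first.
  rewrite (sop_exp_Psi_neg hPsi) (sop_exp_Psi_pos hPsi); split; [|split].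
  - by apply: in_end_alg_evenP; [exact/ubounded_expe/ubounded_vf|case: (multop_exp_vf (vfield_cut ltz0 lez0 (vfield_Psi hPsi)))].
  - by apply: in_end_alg_evenP; [exact/ubounded_expe/ubounded_vf|case: (multop_exp_vf (vfield_cut gtz0 gtz0 (vfield_Psi hPsi)))].
  - by rewrite -ThetaE (sop_exp_zero hPsi) alpha_opE (sewing_identity hPsi).
(* The remainders are defined by subtracting the claimed leading terms, so only [mixed] needs a
   proof. [PH] has two cases instead of three as the half-integer indices have no middle one;
   N_{k-1/2} goes with j = 1 - k, hence [|1 - j|]. *)
pose P (j : int) : sser R := fun m => if gtz0 j then Psi j m + varA `|j|%N m
  else if ltz0 j then Psi j m + ah ^ (2 * j) * varB `|j|%N m else Psi j m.
pose PH (j : int) : sser R := fun m => if gtz0 j then PsiH j m + varM `|j|%N m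
  else PsiH j m + ah ^ (2 * j - 1) * varN `|1 - j|%N m.
have Pmix (f : sser R) :
    (forall m, smono_deg true m = 0%N -> f m = 0) ->
    (forall m, smono_deg false m = 0%N -> f m = 0) -> mixed f.
  by move=> ht hf m fm; split; rewrite lt0n; apply: contra fm => /eqP; [move=> /hf ->|move=> /ht ->].
have A0 (j : nat) m : smono_deg false m = 0%N -> varA j m = 0 :> {fraction {poly R[i]}}.
  by move=> m0; apply: (@even_var_eq0 _ _ false); rewrite m0.
have M0 (j : nat) m : smono_deg false m = 0%N -> varM j m = 0 :> {fraction {poly R[i]}}.
  by move=> m0; apply: (@odd_var_eq0 _ _ false); rewrite m0.
have B0 (j : nat) m : smono_deg true m = 0%N -> varB j m = 0 :> {fraction {poly R[i]}}.
  by move=> m0; apply: (@even_var_eq0 _ _ true); rewrite m0.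
have N0 (j : nat) m : smono_deg true m = 0%N -> varN j m = 0 :> {fraction {poly R[i]}}.
  by move=> m0; apply: (@odd_var_eq0 _ _ true); rewrite m0.
exists P, PH; split; last split.
- move=> j; split; apply: Pmix => m m0; rewrite /P /PH.
  + have [P0 hg hl _] := Psi_mod_BN hPsi m0.
    have [jg|jg] := boolP (gtz0 j); first by have [-> _] := hg j jg; rewrite /posfam -/(gtz0 j) jg addNr.
    have [jl|jl] := boolP (ltz0 j); first by rewrite (hl j jl) B0 // mulr0 addr0.
    by have -> : j = 0 by move: jg jl; rewrite /gtz0 /ltz0; lia.
  + have [P0 hg hl _] := Psi_mod_AM hPsi m0.
    have [jg|jg] := boolP (gtz0 j); first by have [-> _] := hg j jg; rewrite A0 // addr0.
    have [jl|jl] := boolP (ltz0 j).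
      rewrite (hl j jl) /negfam; have -> : 1 <= 0 - j by move: jl; rewrite /ltz0; lia.
      by rewrite sub0r abszN addNr.
    by have -> : j = 0 by move: jg jl; rewrite /gtz0 /ltz0; lia.
  + have [P0 hg _ hl] := Psi_mod_BN hPsi m0.
    have [jg|jg] := boolP (gtz0 j); first by have [_ ->] := hg j jg; rewrite /posfam -/(gtz0 j) jg addNr.
    by rewrite hl ?N0 ?mulr0 ?addr0 //; move: jg; rewrite /gtz0 /lez0; lia.
  + have [P0 hg _ hl] := Psi_mod_AM hPsi m0.
    have [jg|jg] := boolP (gtz0 j); first by have [_ ->] := hg j jg; rewrite M0 // addr0.
    have jl : lez0 j by move: jg; rewrite /gtz0 /lez0; lia.
    rewrite hl // /negfam; have -> : 1 <= 1 - j by move: jl; rewrite /lez0; lia.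
    by rewrite addNr.
- move=> j j1.
  have g1 : gtz0 j%:Z by rewrite /gtz0; lia.
  have g2 : gtz0 (- j%:Z) = false by rewrite /gtz0; lia.
  have g3 : ltz0 (- j%:Z) by rewrite /ltz0; lia.
  have g4 : gtz0 (1 - j%:Z) = false by rewrite /gtz0; lia.
  split=> m; rewrite /P /PH ?g1 ?g2 ?g3 ?g4.
  + by rewrite addrC addrK.
  + by rewrite addrC addrK.
  + by rewrite abszN absz_nat mulrN [RHS]addrC addrK.
  + rewrite subKr; have -> : 2 * (1 - j%:Z) - 1 = 1 - 2 * j%:Z by lia.
    by rewrite [RHS]addrC addrK.
- by move=> m; rewrite add0r.
Qed.
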